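(* Let $X$ be a sober topological space and let $A$ be a $C^*$-algebra. There is a bijective correspondence between continuous maps $\mathrm{Prim}(A)\to X$ and maps $\mathbb O(X)\to\mathbb I(A)$ that commute with arbitrary suprema and finite infima; it sends a continuous map $\psi\colon\mathrm{Prim}(A)\to X$ to the map $\psi^*\colon\mathbb O(X)\to\mathbb O(\mathrm{Prim}(A))=\mathbb I(A)$, $U\mapsto\psi^{-1}(U)$.
   Context: $\mathbb O(X)$ is the complete lattice of open subsets of $X$ ordered by inclusion (suprema are unions, finite infima are intersections). $\mathbb I(A)$ is the complete lattice of closed $*$-ideals of $A$ ordered by inclusion (infima are intersections, suprema are closures of sums). $\mathrm{Prim}(A)$ is the primitive ideal space with the hull-kernel topology, and $\mathbb O(\mathrm{Prim}(A))$ is identified with $\mathbb I(A)$ via the lattice isomorphism $U\mapsto\bigcap_{\mathfrak p\in\mathrm{Prim}(A)\setminus U}\mathfrak p$. Suprema and finite infima include those of the empty set, so the maps considered send $\emptyset$ to $\{0\}$ and $X$ to $A$. A space is sober if every irreducible closed subset (a non-empty closed subset that is not the union of two proper closed subsets of itself) is the closure of exactly one singleton. *)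

(* Defs.v *)
From HB Require Import structures.
From mathcomp Require Import all_boot all_order all_algebra.
From mathcomp Require Import complex sesquilinear.
From mathcomp Require Import all_classical all_reals.
From mathcomp Require Import topology normedtype.

Set Implicit Arguments.
Unset Strict Implicit.
Unset Printing Implicit Defensive.

Import Order.TTheory GRing.Theory Num.Theory.
Import numFieldNormedType.Exports.

Local Open Scope classical_set_scope.
Local Open Scope ring_scope.

(** Throughout, [R : realType] and the field of complex numbers is [R[i]].
    Norms of normed modules over [R[i]] take values in [R[i]]; they are
    nonnegative, hence real. *)

(** A C*-algebra is not required to have a unit, which is why its product is
    not the product of a MathComp ring structure. *)
HB.mixin Record CompleteNormedModule_isCStarAlgebra (R : realType) A
    of CompleteNormedModule R[i] A := {
  cmul : A -> A -> A ;
  cstar : A -> A ;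
  cmulA : associative cmul ;
  cmulDl : left_distributive cmul +%R ;
  cmulDr : right_distributive cmul +%R ;
  cmulZl : forall (k : R[i]) (a b : A), cmul (k *: a) b = k *: cmul a b ;
  cmulZr : forall (k : R[i]) (a b : A), cmul a (k *: b) = k *: cmul a b ;
  cstarK : involutive cstar ;
  cstarD : {morph cstar : a b / a + b} ;
  cstarZ : forall (k : R[i]) (a : A), cstar (k *: a) = k^* *: cstar a ;
  cstarM : forall a b : A, cstar (cmul a b) = cmul (cstar b) (cstar a) ;
  ler_normcM : forall a b : A, `|cmul a b| <= `|a| * `|b| ;
  normc_star : forall a : A, `|cmul (cstar a) a| = `|a| ^+ 2
}.

#[short(type="cstarAlgType")]
HB.structure Definition CStarAlgebra (R : realType) :=
  {A of CompleteNormedModule R[i] A & CompleteNormedModule_isCStarAlgebra R A}.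

HB.mixin Record CompleteNormedModule_isHilbert (R : realType) H
    of CompleteNormedModule R[i] H := {
  inner : {dot H for Num.conj} ;
  innerE : forall x : H, inner x x = `|x| ^+ 2
}.

#[short(type="hilbertType")]
HB.structure Definition Hilbert (R : realType) :=
  {H of CompleteNormedModule R[i] H & CompleteNormedModule_isHilbert R H}.

Definition linear_subspace (K : numDomainType) (V : lmodType K) (S : set V) :=
  S 0 /\ forall (k : K) (x y : V), S x -> S y -> S (k *: x + y).

Section Representations.
Context {R : realType} (A : cstarAlgType R) (H : hilbertType R).

(** *-homomorphisms from [A] to the bounded operators on [H]. *)
Record is_star_rep (pi : A -> H -> H) : Prop := IsStarRep {
  star_rep_linear : forall a, linear (pi a) ;
  star_rep_continuous : forall a, continuous (pi a) ;
  star_repD : forall a b x, pi (a + b) x = pi a x + pi b x ;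
  star_repZ : forall k a x, pi (k *: a) x = k *: pi a x ;
  star_repM : forall a b x, pi (cmul a b) x = pi a (pi b x) ;
  star_rep_adj : forall a x y, inner (pi a x) y = inner x (pi (cstar a) y)
}.

(** The zero representation on a line satisfies the second clause; it is
    excluded by the first. *)
Definition irreducible_rep (pi : A -> H -> H) :=
  (exists a x, pi a x <> 0) /\
  (forall V : set H, linear_subspace V -> closed V ->
     (forall a x, V x -> V (pi a x)) -> V = [set 0] \/ V = setT).

Definition rep_kernel (pi : A -> H -> H) : set A :=
  [set a | forall x, pi a x = 0].

End Representations.

Record is_closed_ideal (R : realType) (A : cstarAlgType R) (I : set A) : Prop :=
  IsClosedIdeal {
    ideal_subspace : linear_subspace I ;
    ideal_mull : forall a b, I b -> I (cmul a b) ;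
    ideal_mulr : forall a b, I a -> I (cmul a b) ;
    ideal_star : forall a, I a -> I (cstar a) ;
    ideal_closed : closed I
  }.

Record closed_ideal (R : realType) (A : cstarAlgType R) := ClosedIdeal {
  ideal_set :> set A ;
  ideal_setP : is_closed_ideal ideal_set
}.

Section ClosedIdeals.
Context {R : realType} {A : cstarAlgType R}.
Implicit Types (F : set (closed_ideal A)) (I J : closed_ideal A).

Lemma closed_ideal_eq I J : I = J :> set A -> I = J.
Proof.
case: I J => [I Ip] [J Jp] /= IJ; case: _ / IJ Jp => Jp.
by congr ClosedIdeal; exact: Prop_irrelevance.
Qed.

Lemma cmul0r (a : A) : cmul a 0 = 0.
Proof. by rewrite -[X in cmul a X](scale0r (0 : A)) cmulZr scale0r. Qed.

Lemma cmul0l (a : A) : cmul 0 a = 0.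
Proof. by rewrite -[X in cmul X a](scale0r (0 : A)) cmulZl scale0r. Qed.

Lemma cstar0 : cstar (0 : A) = 0.
Proof. by rewrite -[X in cstar X](scale0r (0 : A)) cstarZ conjC0 scale0r. Qed.

Lemma cstarB (a b : A) : cstar (a - b) = cstar a - cstar b.
Proof. by rewrite cstarD -scaleN1r cstarZ rmorphN1 scaleN1r. Qed.

Lemma norm_cstar (a : A) : `|cstar a| = `|a|.
Proof.
have le b : `|b| <= `|cstar b|.
  have [->|b0] := eqVneq b 0; first by rewrite normr0.
  have nb0 : 0 < `|b| by rewrite normr_gt0.
  by rewrite -(ler_pM2r nb0) -expr2 -normc_star ler_normcM.
by apply: le_anti; rewrite le andbT -[X in _ <= `|X|]cstarK le.
Qed.

Lemma cstar_continuous : continuous (cstar : A -> A).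
Proof.
move=> a; apply/cvgrPdist_lt => e e0; near=> b.
rewrite -cstarB norm_cstar; near: b.
by apply: cvgr_dist_lt; [exact: cvg_id|].
Unshelve. all: by end_near. Qed.

Lemma cmull_continuous (a : A) : continuous (cmul a : A -> A).
Proof.
have a1 : 0 < `|a| + 1 by rewrite ltr_wpDl.
move=> b; apply/cvgrPdist_lt => e e0; near=> c.
have -> : cmul a b - cmul a c = cmul a (b - c).
  by rewrite cmulDr -[X in _ = _ + cmul a X]scaleN1r cmulZr scaleN1r.
apply: (le_lt_trans (ler_normcM _ _)).
apply: (@le_lt_trans _ _ ((`|a| + 1) * `|b - c|)).
  by rewrite ler_wpM2r // lerDl.
rewrite mulrC -ltr_pdivlMr //; near: c.
by apply: cvgr_dist_lt; [exact: cvg_id|rewrite divr_gt0].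
Unshelve. all: by end_near. Qed.

Lemma cmulr_continuous (a : A) : continuous (cmul^~ a : A -> A).
Proof.
move=> b.
have -> : cmul^~ a = cstar \o cmul (cstar a) \o cstar.
  by apply/funext => c /=; rewrite cstarM !cstarK.
by apply: continuous_comp; [exact: cstar_continuous|];
  apply: continuous_comp; [exact: cmull_continuous|exact: cstar_continuous].
Qed.

Lemma is_closed_ideal_bigcap F :
  is_closed_ideal (\bigcap_(I in F) (I : set A)).
Proof.
split.
- split=> [I _|k x y Vx Vy I FI]; have [[I0 IS] _ _ _ _] := ideal_setP I => //.
  by apply: IS; [exact: Vx|exact: Vy].
- by move=> a b Vb I FI; apply: (ideal_mull (ideal_setP I)); exact: Vb.
- by move=> a b Va I FI; apply: (ideal_mulr (ideal_setP I)); exact: Va.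
- by move=> a Va I FI; apply: (ideal_star (ideal_setP I)); exact: Va.
- by apply: closed_bigI => I _; exact: (ideal_closed (ideal_setP I)).
Qed.

Definition ideal_inf F : closed_ideal A :=
  ClosedIdeal (is_closed_ideal_bigcap F).

(** The algebraic sum of the members of [F]: all finite sums of elements of
    members; it is [[set 0]] for [F = set0]. *)
Definition ideal_sum F : set A :=
  [set a | exists2 s : seq A,
     (forall x, x \in s -> exists2 I, F I & ideal_set I x) & a = \sum_(x <- s) x].

Lemma closure_stable (g : A -> A) (S : set A) : continuous g ->
  (forall x, S x -> S (g x)) -> forall x, closure S x -> closure S (g x).
Proof.
move=> gc gS x Sx B /gc /Sx [y [Sy By]].
by exists (g y); split => //; exact: gS.
Qed.

Lemma ideal_sum_stable F (g : A -> A) :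
  g 0 = 0 -> {morph g : x y / x + y} ->
  (forall I x, ideal_set I x -> ideal_set I (g x)) -> forall x, ideal_sum F x -> ideal_sum F (g x).
Proof.
move=> g0 gD gI _ [s sF ->]; exists (map g s).
  by move=> _ /mapP[x /sF [I FI Ix] ->]; exists I => //; exact: gI.
by rewrite big_map (big_morph g gD g0).
Qed.

Lemma is_closed_ideal_sup F : is_closed_ideal (closure (ideal_sum F)).
Proof.
have sD x y : ideal_sum F x -> ideal_sum F y -> ideal_sum F (x + y).
  move=> [s sF ->] [t tF ->]; exists (s ++ t); last by rewrite big_cat.
  by move=> z; rewrite mem_cat => /orP[/sF|/tF].
split.
- split=> [|k x y Sx Sy].
    by apply: subset_closure; exists [::]; rewrite ?big_nil.
  have {}Sx : closure (ideal_sum F) (k *: x).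
    apply: (@closure_stable ( *:%R k)) => //; first exact: scaler_continuous.
    apply: ideal_sum_stable; [exact: scaler0|exact: scalerDr|].
    move=> I z Iz; have [[I0 IS] _ _ _ _] := ideal_setP I.
    by rewrite -[_ *: _]addr0; exact: IS.
  move=> B; have /= addc := @add_continuous A (k *: x, y).
  move=> /addc [[C D] /= [/Sx [u [Su Cu]] /Sy [v [Sv Dv]]] CDB].
  by exists (u + v); split; [exact: sD|exact: (CDB (u, v))].
- move=> a; apply: closure_stable; first exact: cmull_continuous.
  apply: ideal_sum_stable; [exact: cmul0r|exact: cmulDr|].
  by move=> I; exact: (ideal_mull (ideal_setP I)).
- move=> b a; move: b; apply: (@closure_stable (cmul^~ a)).
    exact: cmulr_continuous.
  apply: ideal_sum_stable; [exact: cmul0l|by move=> x y; exact: cmulDl|].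
  by move=> I x; exact: (ideal_mulr (ideal_setP I)).
- apply: closure_stable; first exact: cstar_continuous.
  apply: ideal_sum_stable; [exact: cstar0|exact: cstarD|].
  by move=> I; exact: (ideal_star (ideal_setP I)).
- exact: closed_closure.
Qed.

Definition ideal_sup F : closed_ideal A := ClosedIdeal (is_closed_ideal_sup F).

Lemma ideal_infP F J : (J `<=` ideal_inf F) <-> forall I, F I -> J `<=` I.
Proof.
split=> [JF I FI x /JF|JF x Jx I FI]; first exact.
exact: (JF I FI).
Qed.

Lemma ideal_supP F J : (ideal_sup F `<=` J) <-> forall I, F I -> I `<=` J.
Proof.
split=> [FJ I FI x Ix|FJ].
  apply: FJ; apply: subset_closure; exists [:: x]; last by rewrite big_seq1.
  by move=> y; rewrite inE => /eqP ->; exists I.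
have [[J0 JS] _ _ _ Jc] := ideal_setP J.
suff /closure_subset sJ : ideal_sum F `<=` J.
  by apply: (subset_trans sJ); rewrite -(iffLR (closure_id _) Jc).
move=> _ [s sF ->]; elim: s sF => [|x s IHs] sF; first by rewrite big_nil.
rewrite big_cons -[x]scale1r; apply: JS.
  by have [I FI Ix] := sF x (mem_head _ _); exact: (FJ I).
by apply: IHs => y ys; apply: sF; rewrite inE ys orbT.
Qed.

End ClosedIdeals.

(** Kernels of *-representations are automatically closed *-ideals, so that
    restricting to [closed_ideal A] loses nothing. *)
Definition primitive (R : realType) (A : cstarAlgType R) (I : closed_ideal A) :=
  exists (H : hilbertType R) (pi : A -> H -> H),
    [/\ is_star_rep pi, irreducible_rep pi & I = rep_kernel pi :> set A].

Record prim (R : realType) (A : cstarAlgType R) := Prim {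
  prim_ideal :> closed_ideal A ;
  primP : primitive prim_ideal
}.

HB.instance Definition _ (R : realType) (A : cstarAlgType R) :=
  gen_eqMixin (prim A).
HB.instance Definition _ (R : realType) (A : cstarAlgType R) :=
  gen_choiceMixin (prim A).

Section PrimitiveIdealSpace.
Context {R : realType} {A : cstarAlgType R}.

Definition hull (S : set A) : set (prim A) := [set p | S `<=` p].

(** The closed sets of the hull-kernel topology are the hulls. *)
Definition hk_open (U : set (prim A)) := exists S : set A, U = ~` hull S.

Lemma inner0r (H : hilbertType R) (x : H) : inner x 0 = 0.
Proof. exact: linear0r. Qed.

Lemma inner_eq0 (H : hilbertType R) (x : H) : inner x x = 0 -> x = 0.
Proof. by rewrite innerE => /eqP; rewrite sqrf_eq0 normr_eq0 => /eqP. Qed.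

Section RepLemmas.
Context (H : hilbertType R) (pi : A -> H -> H) (piP : is_star_rep pi).

Lemma star_rep0r (a : A) : pi a 0 = 0.
Proof.
have := star_rep_linear piP a (-1) 0 0.
by rewrite scaleN1r oppr0 addr0 scaleN1r addNr.
Qed.

Lemma closed_rep_ann (T : set A) :
  closed [set x : H | forall a, T a -> pi a x = 0].
Proof.
have -> : [set x : H | forall a, T a -> pi a x = 0] =
          \bigcap_(a in T) (pi a @^-1` [set 0]) by [].
apply: closed_bigI => a _; apply: preimage_closed; first by move=> x _; exact: star_rep_continuous piP a x.
exact/accessible_closed_set1/hausdorff_accessible/norm_hausdorff.
Qed.

Lemma rep_ann_subspace (T : set A) :
  linear_subspace [set x : H | forall a, T a -> pi a x = 0].
Proof.
split=> [a _|k x y Vx Vy a Ta]; first exact: star_rep0r.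
by rewrite (star_rep_linear piP) Vx // Vy // scaler0 addr0.
Qed.

Hypothesis piI : irreducible_rep pi.

Lemma irreducible_ann0 (x : H) : (forall a, pi a x = 0) -> x = 0.
Proof.
move=> xN; have [[b [y pby]] irr] := piI.
have [] := irr [set x : H | forall a, setT a -> pi a x = 0].
- exact: rep_ann_subspace.
- exact: closed_rep_ann.
- by move=> a z zN c _; rewrite (zN a) // star_rep0r.
- by move=> E; have : [set 0 : H] x by rewrite -E => a _; exact: xN.
- move=> E; have : [set: H] y by [].
  by rewrite -E => /(_ b I) /pby.
Qed.

Lemma irreducible_prime (s t : A) :
  (forall a x, pi (cmul (cmul s a) t) x = 0) ->
  rep_kernel pi s \/ rep_kernel pi t.
Proof.
move=> st0; have [_ irr] := piI.
pose T := [set b | exists a, b = cmul s a].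
have [] := irr [set x : H | forall b, T b -> pi b x = 0].
- exact: rep_ann_subspace.
- exact: closed_rep_ann.
- move=> a x xN _ [c ->]; rewrite -(star_repM piP) -cmulA.
  by apply: xN; exists (cmul c a).
- move=> E; right=> x; have /= : [set 0 : H] (pi t x).
    by rewrite -E => _ [a ->]; rewrite -(star_repM piP).
  exact.
- move=> E; left=> x.
  have sN y : pi (cstar s) y = 0.
    apply: irreducible_ann0 => a; rewrite -(star_repM piP).
    apply: inner_eq0; rewrite (star_rep_adj piP) cstarM cstarK.
    have : [set: H] (pi (cmul a (cstar s)) y) by [].
    rewrite -E => -> //; first exact: inner0r.
    by exists (cstar a).
  by apply: inner_eq0; rewrite (star_rep_adj piP) sN inner0r.
Qed.

End RepLemmas.

Lemma hk_openT : hk_open setT.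
Proof.
exists setT; apply/seteqP; split => // p _ /= Sp.
have [H [pi [_ [[a [x pax]] _] pE]]] := primP p.
have : (p : set A) a by exact: Sp.
by rewrite pE => /(_ x).
Qed.

Lemma hk_openI : setI_closed hk_open.
Proof.
move=> _ _ [S ->] [T ->].
exists [set b | exists s a t, [/\ S s, T t & b = cmul (cmul s a) t]].
apply/seteqP; split=> p /=; last first.
  move=> nST; split=> Sp; apply: nST => _ [s [a [t [Ss Tt ->]]]].
    apply: (ideal_mulr (ideal_setP p)); apply: (ideal_mulr (ideal_setP p)).
    exact: Sp.
  by apply: (ideal_mull (ideal_setP p)); exact: Sp.
move=> [Sp Tp] ST.
have [H [pi [piP piI pE]]] := primP p.
apply: Sp => s Ss; apply: contrapT => ps; apply: Tp => t Tt.
have [|/=|/=] := @irreducible_prime H pi piP piI s t; last 2 first.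
- by rewrite -pE.
- by rewrite -pE.
move=> a x; have : (p : set A) (cmul (cmul s a) t).
  by apply: ST; exists s, a, t.
by rewrite pE; exact.
Qed.

Lemma hk_open_bigU (I : Type) (f : I -> set (prim A)) :
  (forall i, hk_open (f i)) -> hk_open (\bigcup_i f i).
Proof.
move=> /choice[S fS]; exists (\bigcup_i S i).
apply/seteqP; split=> p /=.
  by move=> [i _]; rewrite fS => nSp Sp; apply: nSp => a Sa; apply: Sp; exists i.
move=> nSp; apply: contrapT => nfp; apply: nSp => a [i _ Sa].
apply: contrapT => pa; apply: nfp; exists i => //; rewrite fS => /(_ _ Sa).
exact: pa.
Qed.

End PrimitiveIdealSpace.

HB.instance Definition _ (R : realType) (A : cstarAlgType R) :=
  isOpenTopological.Build (prim A) hk_openT hk_openI (@hk_open_bigU R A).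

Record open_set (X : topologicalType) := OpenSet {
  open_set_set :> set X ;
  open_setP : open open_set_set
}.

HB.instance Definition _ (X : topologicalType) := gen_eqMixin (open_set X).
HB.instance Definition _ (X : topologicalType) := gen_choiceMixin (open_set X).

Section OpenSets.
Context {X : topologicalType}.
Implicit Types F : set (open_set X).

Lemma open_set_eq (U V : open_set X) : U = V :> set X -> U = V.
Proof.
case: U V => [U Up] [V Vp] /= UV; case: _ / UV Vp => Vp.
by congr OpenSet; exact: Prop_irrelevance.
Qed.

Lemma open_set_bigcup F : open (\bigcup_(U in F) (U : set X)).
Proof. by apply: bigcup_open => U _; exact: open_setP. Qed.

Definition open_sup F : open_set X := OpenSet (open_set_bigcup F).

Lemma open_set_bigcap F : finite_set F ->
  open (\bigcap_(U in F) (U : set X)).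
Proof.
move=> /finite_seqP[s ->]; rewrite bigcap_seq.
by apply: (big_ind open) => [||U _]; [exact: openT|exact: openI|exact: open_setP].
Qed.

Definition open_inf F (finF : finite_set F) : open_set X :=
  OpenSet (open_set_bigcap finF).

Definition irreducible_closed (C : set X) :=
  [/\ closed C, C !=set0 &
    forall C1 C2 : set X, closed C1 -> closed C2 ->
      C1 `<` C -> C2 `<` C -> C <> C1 `|` C2].

End OpenSets.

Definition sober (X : topologicalType) :=
  forall C : set X, irreducible_closed C -> exists! x, closure [set x] = C.

Lemma open_set_preimage (X Y : topologicalType) (psi : continuousType X Y)
  (U : open_set Y) : open (psi @^-1` U).
Proof. by move/continuousP: (@cts_fun _ _ psi); apply; exact: open_setP. Qed.

Definition open_preimage (X Y : topologicalType) (psi : continuousType X Y)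
    (U : open_set Y) : open_set X :=
  OpenSet (open_set_preimage psi U).

Section Maps.
Context {R : realType} {A : cstarAlgType R} {X : topologicalType}.

(** The identification of [O(Prim A)] with [I(A)], sending [U] to the
    intersection of the primitive ideals outside [U]. *)
Definition ideal_of_open (U : open_set (prim A)) : closed_ideal A :=
  ideal_inf [set (p : closed_ideal A) | p in ~` (U : set (prim A))].

Definition pullback (psi : continuousType (prim A) X) (U : open_set X) :
    closed_ideal A :=
  ideal_of_open (open_preimage psi U).

(** The family [F] may be empty, here and below; thus [f] maps the empty set
    to the zero ideal and [X] to [A]. *)
Definition commutes_with_sups (f : open_set X -> closed_ideal A) :=
  forall F : set (open_set X), f (open_sup F) = ideal_sup (f @` F).

Definition commutes_with_finite_infs (f : open_set X -> closed_ideal A) :=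
  forall (F : set (open_set X)) (finF : finite_set F),
    f (open_inf finF) = ideal_inf (f @` F).

End Maps.

(* Main.v *)
(** The analytic input is that a closed ideal [I] of a C*-algebra is the
    intersection of the primitive ideals containing it.  Given this, a point [p]
    and a lattice map [f] yield the largest open set [W] with [f W] contained in
    [p]; as [p] is prime, the complement of [W] is irreducible, and its generic
    point is the value at [p] of the continuous map that induces [f].

    To separate [I] from [a], adjoin a unit and consider the cone generated by
    the elements [x^* x], by [I], and by the skew-adjoint elements.  If
    [e - a^* a] lies in this cone for every [e > 0], then an approximate unit of
    [I] shows that [a] is in [I]; this uses that [x^* x] is positive, which is
    proved by Kaplansky's argument with square roots and Neumann series in place
    of spectral theory.  Otherwise a pure state of the order unit space defined
    by the cone is nonzero at [a^* a], and its GNS representation is irreducible,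
    kills [I] and does not kill [a].  The pure state is the only state that is
    nonnegative on a maximal facial cone, so that no compactness is needed. *)

Require Import Defs.
From HB Require Import structures.
From mathcomp Require Import all_boot all_order all_algebra.
From mathcomp Require Import complex sesquilinear ring lra.
From mathcomp Require Import all_classical all_reals.
From mathcomp Require Import topology normedtype sequences.
From Stdlib Require Ncring Ncring_tac.

Set Implicit Arguments.
Unset Strict Implicit.
Unset Printing Implicit Defensive.

Import Order.TTheory GRing.Theory Num.Theory.
Import numFieldNormedType.Exports.

Local Open Scope classical_set_scope.
Local Open Scope ring_scope.

(** * Pure states of order unit spaces *)

Section OrderUnit.
Variables (R : realType) (V : lmodType R).
Implicit Types (K M : set V) (e u v b : V) (f g : V -> R).

(** Without a spectrum, positivity has to be controlled by the norm. Each fact about positive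
    elements is obtained for a perturbation [h + d] with [d > 0], where a square root or an inverse
    exists, and then [d] tends to [0].

    Skew-adjoint elements belong to the cone so that the whole unitization, as a real vector space,
    is an order unit space with unit [1].

    Purity is used in the form that a functional [g] with [0 <= g <= f] is a multiple of [f]. This
    is what irreducibility asks for, since an invariant closed subspace splits the cyclic vector and
    thereby the state. Facial cones are made to yield it: a summand of a state that is nonnegative
    on a facial cone is again nonnegative there.

    Separation enters the lattice part twice: for preservation of suprema by [pullback psi], and for
    the equality of [pullback psi] with the given map. Sobriety also enters twice: generic points
    exist, which gives surjectivity, and they are unique, which gives injectivity. *)

Definition cone K :=
  [/\ K 0, forall u v, K u -> K v -> K (u + v) &
      forall (r : R) v, 0 <= r -> K v -> K (r *: v)].

Definition order_unit K e := K e /\ forall v, exists t : R, K (t *: e - v).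

Definition positive_on K f := forall v, K v -> 0 <= f v.

Definition cone_add K b : set V :=
  [set v | exists2 u, K u & exists2 r : R, 0 <= r & v = u + r *: b].

Lemma scalar0 f : scalar f -> f 0 = 0.
Proof.
move=> fS; have := fS 1 0 0; rewrite scaler0 addr0 mul1r.
by move=> /eqP; rewrite -subr_eq0 opprD addNKr oppr_eq0 => /eqP.
Qed.

Lemma scalarD f u v : scalar f -> f (u + v) = f u + f v.
Proof. by move=> fS; rewrite -[in LHS](scale1r u) fS mul1r. Qed.

Lemma scalarM f (r : R) v : scalar f -> f (r *: v) = r * f v.
Proof. by move=> fS; rewrite -[in LHS](addr0 (r *: v)) fS scalar0 ?addr0. Qed.

Lemma scalarN f v : scalar f -> f (- v) = - f v.
Proof. by move=> fS; rewrite -scaleN1r scalarM // mulN1r. Qed.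

Lemma scalarB f u v : scalar f -> f (u - v) = f u - f v.
Proof. by move=> fS; rewrite scalarD // scalarN. Qed.

Lemma sub_cone_add K b : K `<=` cone_add K b.
Proof. by move=> u Ku; exists u => //; exists 0; rewrite // scale0r addr0. Qed.

Lemma cone_add_mem K b : cone K -> cone_add K b b.
Proof. by move=> [K0 _ _]; exists 0 => //; exists 1; rewrite // scale1r add0r. Qed.

Lemma cone_cone_add K b : cone K -> cone (cone_add K b).
Proof.
move=> [K0 KD KZ]; split.
- exact: sub_cone_add.
- move=> _ _ [u Ku [r r0 ->]] [v Kv [s s0 ->]]; exists (u + v); first exact: KD.
  by exists (r + s); [exact: addr_ge0|rewrite scalerDl addrACA].
- move=> r _ r0 [u Ku [s s0 ->]]; exists (r *: u); first exact: KZ.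
  by exists (r * s); [exact: mulr_ge0|rewrite scalerDr scalerA].
Qed.

Lemma order_unitS K M e : K `<=` M -> order_unit K e -> order_unit M e.
Proof.
by move=> KM [Ke Ku]; split=> [|v]; [|have [t ?] := Ku v; exists t]; exact: KM.
Qed.

Lemma order_unit_proper K e v : cone K -> order_unit K e ->
  K (- e) -> K v.
Proof.
move=> [K0 KD KZ] [Ke Ku] KNe; have [s Ks] := Ku (- v).
have Kr (r : R) : K (r *: e).
  case: (leP 0 r) => r0; first exact: KZ.
  by rewrite -[r]opprK scaleNr -scalerN; apply: KZ => //; rewrite oppr_ge0 ltW.
by rewrite -[v]opprK -[- - v](addKr (s *: e)) -scaleNr; apply: KD.
Qed.

(* A chain of cones containing [K] may be empty, which is why the families
   considered by Zorn's lemma are joined with [K]. *)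
Lemma cone_chain K (F : set (set V)) :
  cone K -> (forall X, F X -> cone (K `|` X)) -> total_on F subset ->
  cone (K `|` \bigcup_(X in F) X).
Proof.
move=> Kc Fc Ft.
have sub X : F X -> K `|` X `<=` K `|` \bigcup_(X in F) X.
  by move=> FX u [Ku|Xu]; [left|right; exists X].
have one u : (K `|` \bigcup_(X in F) X) u -> K u \/ exists2 X, F X & (K `|` X) u.
  by move=> [Ku|[X FX Xu]]; [left|right; exists X => //; right].
have two u v : (K `|` \bigcup_(X in F) X) u -> (K `|` \bigcup_(X in F) X) v ->
    (K u /\ K v) \/ exists2 X, F X & (K `|` X) u /\ (K `|` X) v.
  move=> [Ku|[X FX Xu]] [Kv|[Y FY Yv]]; first by left.
  - by right; exists Y => //; split; [left|right].
  - by right; exists X => //; split; [right|left].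
  - have [XY|YX] := Ft _ _ FX FY.
      by right; exists Y => //; split; right=> //; exact: XY.
    by right; exists X => //; split; right=> //; exact: YX.
have [K0 KD KZ] := Kc; split; first by left.
- move=> u v /two/[apply] -[[Ku Kv]|[X FX [Xu Xv]]]; first by left; exact: KD.
  by apply: (sub X) => //; have [_ XD _] := Fc X FX; exact: XD.
- move=> r v r0 /one[Kv|[X FX Xv]]; first by left; exact: KZ.
  by apply: (sub X) => //; have [_ _ XZ] := Fc X FX; exact: XZ.
Qed.

Lemma maximal_cone (Q : set (set V)) K : cone K -> Q K ->
  (forall F : set (set V), F !=set0 -> (forall X, F X -> [/\ K `<=` X, cone X & Q X]) ->
    total_on F subset -> Q (\bigcup_(X in F) X)) ->
  exists M, [/\ K `<=` M, cone M, Q M &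
    forall M', M `<=` M' -> cone M' -> Q M' -> M' `<=` M].
Proof.
move=> Kc QK Qc.
have [F FP Ft|A [[Ac QA] Amax]] :=
    @Zorn_bigcup V [set X | cone (K `|` X) /\ Q (K `|` X)].
  split; first by apply: cone_chain => // X /FP[].
  have [[X0 FX0]|/nonemptyPn ->] := pselect (F !=set0); last first.
    by rewrite bigcup_set0 setU0.
  rewrite (_ : _ `|` _ = \bigcup_(X in [set K `|` X | X in F]) X); last first.
    rewrite bigcup_image; apply/seteqP; split=> u.
      by move=> [Ku|[X FX Xu]]; [exists X0 => //; left|exists X => //; right].
    by move=> [X FX [Ku|Xu]]; [left|right; exists X].
  apply: Qc; first by exists (K `|` X0), X0.
    by move=> _ [X /FP[Xc QX] <-]; split=> // u; left.
  move=> _ _ [X FX <-] [Y FY <-].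
  by have [XY|YX] := Ft _ _ FX FY; [left|right]; exact: setUS.
exists (K `|` A); split=> // M' AM' M'c QM'.
apply: contrapT => nM'.
have KM' : K `|` M' = M' by apply/setUidPr => u Ku; apply: AM'; left.
apply: (Amax M'); last by rewrite /= KM'.
split=> [u Au|M'A]; first by apply: AM'; right.
by apply: nM' => u /M'A; right.
Qed.

(** A cone [M] maximal among those that contain [K] and miss [- e] contains [v] or [- v] for every
    [v], so it cuts each line [v - s e] at one number. This Dedekind cut is the functional. *)
Lemma positive_functional_exists K e : cone K -> order_unit K e ->
  ~ K (- e) -> exists f, [/\ scalar f, positive_on K f & f e = 1].
Proof.
move=> Kc Ke KNe.
have [F [X0 FX0] FP Ft|M [KM Mc MNe Mmax]] :=
    @maximal_cone [set X | ~ X (- e)] K Kc KNe.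
  by move=> [X /FP[_ _]].
have [M0 MD MZ] := Mc; have [Me Mu] := order_unitS KM Ke.
(* If [v] is not in [M], maximality gives [- e = u + r v] with [u] in [M] and [r > 0], whence
   [- v = (u + e) / r]. *)
have total v : M v \/ M (- v).
  have [Mv|nMv] := pselect (M v); [by left|right].
  have : cone_add M v (- e).
    apply: contrapT => nMe; apply: nMv.
    apply: (Mmax (cone_add M v)) => //; last exact: cone_add_mem.
      exact: sub_cone_add.
    exact: cone_cone_add.
  move=> [u Mu' [r r0 uE]].
  have [r00|rn0] := eqVneq r 0.
    by case: MNe; rewrite uE r00 scale0r addr0.
  have -> : - v = r^-1 *: (u + e).
    apply: (scalerI rn0); rewrite scalerA divff // scale1r.
    by rewrite -[e]opprK uE opprD addNKr scalerN.
  by apply: MZ; [rewrite invr_ge0|exact: MD].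
pose S v := [set s : R | M (v - s *: e)].
have le_st v (s t : R) : M (v - s *: e) -> M (t *: e - v) -> s <= t.
  move=> Ms Mt; rewrite leNgt; apply/negP => ts; apply: MNe.
  have := MD _ _ Ms Mt; rewrite addrC addrA subrK -scalerBl => Mts.
  have -> : - e = (s - t)^-1 *: ((t - s) *: e).
    by rewrite scalerA -(opprB s t) mulrN mulVf ?scaleN1r // subr_eq0 gt_eqF.
  by apply: MZ => //; rewrite invr_ge0 subr_ge0 ltW.
have S0 v : S v !=set0.
  have [t Mt] := Mu (- v); exists (- t).
  by rewrite /S /= scaleNr opprK addrC -[v]opprK.
have Sub v : has_ubound (S v).
  by have [t Mt] := Mu v; exists t => s Ss; exact: le_st Ss Mt.
have Ssup v : has_sup (S v) by split.
pose f v := sup (S v).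
have fge v (s : R) : M (v - s *: e) -> s <= f v by move=> Ms; apply: ub_le_sup.
have fle v (t : R) : M (t *: e - v) -> f v <= t.
  by move=> Mt; apply: ge_sup => // s Ss; exact: le_st Ss Mt.
have fltM v (t : R) : f v < t -> M (t *: e - v).
  move=> ft; have [Mt|] := total (t *: e - v) => //.
  by rewrite opprB => /fge; rewrite leNgt ft.
have fgtM v (s : R) : s < f v -> M (v - s *: e).
  move=> fs; have [Mt|] := total (v - s *: e) => //.
  by rewrite opprB => /fle; rewrite leNgt fs.
(* Oddness, which rests on [total], turns the one-sided bounds [fD_le] and [fZ_le] into
   equalities. *)
have fN v : f (- v) = - f v.
  apply/eqP; rewrite eq_le; apply/andP; split; apply/ler_addgt0Pl => d d0.
    apply: fle; rewrite opprK.
    have /fgtM : f v - d < f v by rewrite ltrBlDr ltrDl.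
    by rewrite -scaleNr opprB addrC.
  rewrite -lerBlDl; apply: fge; rewrite -scaleNr opprD !opprK addrC.
  by apply: fltM; rewrite ltrDl.
have fD_le u v : f u + f v <= f (u + v).
  apply/ler_addgt0Pl => d d0; rewrite -lerBlDl; apply: fge.
  have d20 : 0 < d / 2 by rewrite divr_gt0.
  have /fgtM Mu' : f u - d / 2 < f u by rewrite ltrBlDr ltrDl.
  have /fgtM Mv' : f v - d / 2 < f v by rewrite ltrBlDr ltrDl.
  have -> : f u + f v - d = (f u - d / 2) + (f v - d / 2) by lra.
  by rewrite scalerDl opprD addrACA; exact: MD.
have fD u v : f (u + v) = f u + f v.
  apply/eqP; rewrite eq_le fD_le andbT.
  by rewrite -[f (u + v)]opprK -fN opprD lerNl opprD -!fN fD_le.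
have fZ_le (r : R) v : 0 < r -> r * f v <= f (r *: v).
  move=> r0; apply/ler_addgt0Pl => d d0; rewrite -lerBlDl; apply: fge.
  have /fgtM Mv' : f v - d / r < f v by rewrite ltrBlDr ltrDl divr_gt0.
  have -> : r * f v - d = r * (f v - d / r).
    by rewrite mulrBr mulrCA divff ?gt_eqF // mulr1.
  by rewrite -scalerA -scalerBr; apply: MZ => //; exact: ltW.
have fZ_pos (r : R) v : 0 < r -> f (r *: v) = r * f v.
  move=> r0; apply/eqP; rewrite eq_le fZ_le // andbT.
  by rewrite -[f (r *: v)]opprK -fN -scalerN lerNl -mulrN -fN fZ_le.
have f0 : f 0 = 0 by apply: (addrI (f 0)); rewrite -fD !addr0.
exists f; split.
- move=> r u v; rewrite fD; congr (_ + _).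
  have [r0|r0|->] := ltgtP r 0; last by rewrite scale0r f0 mul0r.
    by rewrite -[r]opprK scaleNr fN fZ_pos ?oppr_gt0 // !mulNr.
  exact: fZ_pos.
- by move=> v Kv; apply: fge; rewrite scale0r subr0; exact: KM.
- apply/eqP; rewrite eq_le; apply/andP; split.
    by apply: fle; rewrite scale1r subrr.
  by apply: fge; rewrite scale1r subrr.
Qed.

(** When [K] misses [- e], this is the maximum of [b] over the states of [K]; [upper_value_proper]
    is the reason why it is attained. *)
Definition upper_value K e b := inf [set t : R | K (t *: e - b)].

Lemma has_inf_upper K e b : cone K -> order_unit K e -> ~ K (- e) ->
  has_inf [set t : R | K (t *: e - b)].
Proof.
move=> Kc Ke KNe; split; first by case: Ke => _ /(_ b).
have [f [fS fK fe]] := positive_functional_exists Kc Ke KNe.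
exists (f b) => t /fK.
by rewrite scalarB // scalarM // fe mulr1 subr_ge0.
Qed.

Lemma upper_value_bound K e b f : cone K -> order_unit K e -> ~ K (- e) ->
  scalar f -> positive_on K f -> f b <= upper_value K e b * f e.
Proof.
move=> Kc Ke KNe fS fK.
have [S0 Slb] := has_inf_upper b Kc Ke KNe.
have fe0 : 0 <= f e by apply: fK; case: Ke.
have [fe00|fen0] := eqVneq (f e) 0.
  have [t /fK] := S0; rewrite scalarB // scalarM // fe00 !mulr0 sub0r.
  by rewrite oppr_ge0.
have fep : 0 < f e by rewrite lt_def fen0.
rewrite -ler_pdivrMr //; apply: lb_le_inf => // t /fK.
by rewrite scalarB // scalarM // subr_ge0 ler_pdivrMr.
Qed.

(** If [- e = u + r (b - m e)] with [u] in [K] and [r > 0], dividing by [r] puts [(m - r^-1) e - b]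
    in [K], below the infimum [m]. So the enlarged cone still has states, and these take [b] to its
    maximum. *)
Lemma upper_value_proper K e b : cone K -> order_unit K e -> ~ K (- e) ->
  ~ cone_add K (b - upper_value K e b *: e) (- e).
Proof.
move=> Kc Ke KNe [u Ku [r r0 uE]]; have [K0 KD KZ] := Kc.
have [r00|rn0] := eqVneq r 0.
  by apply: KNe; rewrite uE r00 scale0r addr0.
have rp : 0 < r by rewrite lt_def rn0.
set m := upper_value K e b in uE.
have : K ((m - r^-1) *: e - b).
  have -> : (m - r^-1) *: e - b = r^-1 *: u.
    apply: (scalerI rn0); rewrite [RHS]scalerA divff // scale1r.
    rewrite scalerBr scalerA mulrBr divff // scalerBl scale1r.
    rewrite -[u](addrK (r *: (b - m *: e))) -uE scalerBr scalerA opprB.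
    by rewrite -addrA [RHS]addrCA addrC -addrA.
  by apply: KZ => //; rewrite invr_ge0.
have [_ Slb] := has_inf_upper b Kc Ke KNe.
move=> /(ge_inf Slb); rewrite -/(upper_value K e b) -/m.
by rewrite lerBrDl gerDr leNgt invr_gt0 rp.
Qed.

(* The states of [K] that are nonnegative on [M] form a face. *)
Definition facial K M := forall f g, scalar f -> scalar g ->
  positive_on K f -> positive_on K g ->
  positive_on M (fun v => f v + g v) -> positive_on M f.

(** At [b] the summands are at most [m f e] and [m g e]. If [f + g] reaches [m (f e + g e)] there,
    each summand must reach its own bound. *)
Lemma facial_upper K M e b : cone M -> order_unit M e -> ~ M (- e) ->
  facial K M -> facial K (cone_add M (b - upper_value M e b *: e)).
Proof.
move=> Mc Me MNe MF f g fS gS fK gK fgM.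
have fgM' : positive_on M (fun v => f v + g v).
  by move=> v Mv; apply: fgM; exact: sub_cone_add.
have fM : positive_on M f by exact: MF fgM'.
have gM : positive_on M g.
  by apply: (MF g f) => // v Mv; rewrite addrC; exact: fgM'.
have := fgM _ (cone_add_mem _ Mc).
have := upper_value_bound b Mc Me MNe fS fM.
have := upper_value_bound b Mc Me MNe gS gM.
set m := upper_value M e b; rewrite !scalarB // !scalarM // => gm fm fgm.
move=> _ [u Mu [r r0 ->]]; rewrite scalarD // scalarM // scalarB // scalarM //.
by rewrite addr_ge0 ?fM // mulr_ge0 //; lra.
Qed.

(** Enlarging [K] by [b - upper_value K e b *: e] before a maximal facial cone is chosen forces the
    resulting state to take [b] to its maximum over [K], which is at least [t]. *)
Lemma pure_state_exists K e b (t : R) : cone K -> order_unit K e ->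
  ~ K (t *: e - b) ->
  exists f, [/\ scalar f, positive_on K f, f e = 1, t <= f b &
    forall g, scalar g -> positive_on K g ->
      positive_on K (fun v => f v - g v) -> forall v, g v = g e * f v].
Proof.
move=> Kc Ke Ktb.
have KNe : ~ K (- e) by move=> KNe; apply: Ktb; exact: order_unit_proper Ke KNe.
pose K1 := cone_add K (b - upper_value K e b *: e).
have K1c : cone K1 by exact: cone_cone_add.
have KK1 : K `<=` K1 by exact: sub_cone_add.
have QK1 : ~ K1 (- e) /\ facial K K1.
  split; first exact: upper_value_proper.
  by apply: facial_upper => // f g.
have [F [X0 FX0] FP Ft|M [K1M Mc [MNe MF] Mmax]] :=
    @maximal_cone [set X | ~ X (- e) /\ facial K X] K1 K1c QK1.
  split; first by move=> [X /FP[_ _ []]].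
  move=> f g fS gS fK gK fgF v [X FX Xv].
  have [_ _ [_ XF]] := FP X FX.
  by apply: (XF f g) => // w Xw; apply: fgF; exists X.
have KM : K `<=` M by exact: subset_trans K1M.
have Me : order_unit M e by exact: order_unitS Ke.
(* By maximality [M] already contains every [v - upper_value M e v *: e], so the upper bound on
   [f v] is also a lower bound: a positive functional is determined by its value at [e]. *)
have val f : scalar f -> positive_on M f ->
    forall v, f v = upper_value M e v * f e.
  move=> fS fM v; apply/eqP; rewrite eq_le upper_value_bound //=.
  have Mv : M (v - upper_value M e v *: e).
    apply: (Mmax (cone_add M (v - upper_value M e v *: e))).
    - exact: sub_cone_add.
    - exact: cone_cone_add.
    - by split; [exact: upper_value_proper|exact: facial_upper].
    - exact: cone_add_mem.
  by have := fM _ Mv; rewrite scalarB // scalarM // subr_ge0.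
have [f [fS fM fe]] := positive_functional_exists Mc Me MNe.
exists f; split=> //.
- by move=> v /KM/fM.
- have : 0 <= f (b - upper_value K e b *: e).
    by apply/fM/K1M; exact: cone_add_mem.
  rewrite scalarB // scalarM // fe mulr1 subr_ge0; apply: le_trans.
  have [S0 _] := has_inf_upper b Kc Ke KNe.
  apply: lb_le_inf => // s Ks; rewrite leNgt; apply/negP => st; apply: Ktb.
  have [_ KD KZ] := Kc; rewrite -(subrK s t) scalerDl -addrA; apply: KD => //.
  by apply: KZ; [rewrite subr_ge0 ltW|case: Ke].
(* Faciality makes the summand [g] of [f] nonnegative on [M]; [val] applies to both, so they are
   proportional. *)
- move=> g gS gK fgK v.
  have gM : positive_on M g.
    apply: (MF g (fun w => f w - g w)) => //.
      move=> r u w; rewrite fS gS; ring.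
    by move=> w Mw; rewrite addrC subrK; exact: fM.
  by rewrite (val g) // (val f fS fM v) fe mulr1 mulrC.
Qed.

End OrderUnit.

(** * Positivity in unital C*-algebras *)

#[local] Instance nzRing_ncring_ops (B : nzRingType) :
  @Ncring.Ring_ops B 0 1 +%R *%R (fun x y => x - y) -%R eq := {}.

#[local] Instance nzRing_ncring (B : nzRingType) :
  Ncring.Ring (Ro := nzRing_ncring_ops B).
Proof.
split; try by repeat intro; subst.
all: try solve [exact: RelationClasses.eq_equivalence|exact: add0r|exact: addrC
  |exact: addrA|exact: mul1r|exact: mulr1|exact: mulrA|exact: mulrDl|exact: addrN].
all: first [by move=> *; apply: mulrDr
  | by intros ? ? H1 ? ? H2; hnf in H1, H2; subst
  | by intros ? ? H1; hnf in H1; subst].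
Qed.

(** The scalars [sc r] are ordinary elements for this tactic. Identities that use their centrality,
    or other commutation relations, are therefore stated with explicit commutators, which are then
    rewritten to zero. *)
Ltac ncring := intros; Ncring_tac.non_commutative_ring.

Lemma geometric_le0 (R : realType) (q c x : R) : 0 <= q < 1 ->
  (forall n, x <= c * q ^+ n) -> x <= 0.
Proof.
move=> /andP[q0 q1] xle.
have cx : (fun=> x) @ \oo --> x by exact: cvg_cst.
have c0 : (fun n => c * q ^+ n) @ \oo --> (0 : R).
  by rewrite -[0 in X in _ --> X](mulr0 c); apply: cvgMr;
    apply: cvg_expr; rewrite ger0_norm.
by apply: (ler_cvg_to cx c0); exact: nearW.
Qed.

Lemma geometric_small (R : realType) (q c d : R) : 0 <= q < 1 -> 0 < d ->
  exists n, c * q ^+ n <= d.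
Proof.
move=> q01 d0; apply: contrapT => /forallNP nk.
suff : d <= 0 by rewrite leNgt d0.
by apply: (@geometric_le0 _ q c) => // k; apply: ltW; rewrite ltNge; apply/negP/nk.
Qed.

Section UnitalCStar.
Variables (R : realType) (B : algType R[i]).

(** Completeness is asked only of sequences with geometric increments and returns a geometric rate:
    the iterations for square roots and inverses are of this kind, and equations for their limits
    then follow from explicit estimates. *)
Record cstar_norm (st : B -> B) (N : B -> R) : Prop := CStarNorm {
  st_add : {morph st : a b / a + b} ;
  st_scale : forall (k : R[i]) a, st (k *: a) = k^* *: st a ;
  st_mul : forall a b, st (a * b) = st b * st a ;
  st_inv : involutive st ;
  nrm_ge0 : forall a, 0 <= N a ;
  nrm_add : forall a b, N (a + b) <= N a + N b ;
  nrm_scale : forall (k : R[i]) a, N (k *: a) = complex.Re `|k| * N a ;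
  nrm_eq0 : forall a, N a = 0 -> a = 0 ;
  nrm_mul : forall a b, N (a * b) <= N a * N b ;
  nrm_st_mul : forall a, N (st a * a) = N a ^+ 2 ;
  nrm_complete : forall (u : nat -> B) (c q : R), 0 <= q < 1 ->
    (forall n, N (u n.+1 - u n) <= c * q ^+ n) ->
    exists l d, forall n, N (l - u n) <= d * q ^+ n
}.

Variables (st : B -> B) (N : B -> R).
Hypothesis BN : cstar_norm st N.
Implicit Types (a b h k x y z : B) (r t d e : R).

Let stD := st_add BN.
Let stM := st_mul BN.
Let stK := st_inv BN.
Let N_ge0 := nrm_ge0 BN.
Let ND := nrm_add BN.
Let NM := nrm_mul BN.

Definition sc r : B := (r%:C)%C *: 1.

Lemma scD r t : sc (r + t) = sc r + sc t.
Proof. by rewrite /sc rmorphD scalerDl. Qed.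

Lemma sc0 : sc 0 = 0. Proof. by rewrite /sc rmorph0 scale0r. Qed.

Lemma sc1 : sc 1 = 1. Proof. by rewrite /sc rmorph1 scale1r. Qed.

Lemma scN r : sc (- r) = - sc r.
Proof. by rewrite /sc rmorphN scaleNr. Qed.

Lemma scB r t : sc (r - t) = sc r - sc t.
Proof. by rewrite scD scN. Qed.

Lemma scE r x : sc r * x = (r%:C)%C *: x.
Proof. by rewrite /sc -scalerAl mul1r. Qed.

Lemma scC r x : x * sc r = sc r * x.
Proof. by rewrite scE /sc -scalerAr mulr1. Qed.

Lemma scM r t : sc (r * t) = sc r * sc t.
Proof. by rewrite scE /sc rmorphM scalerA. Qed.

Lemma scK r x : r != 0 -> sc r^-1 * (sc r * x) = x.
Proof. by move=> r0; rewrite mulrA -scM mulVf // sc1 mul1r. Qed.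

Lemma sc_double r : sc (2 * r) = sc r + sc r.
Proof. by rewrite mulr_natl mulr2n scD. Qed.

Lemma sc_half x : sc (1 / 2) * (x + x) = x.
Proof. by rewrite mulrDr -mulrDl -scD -splitr sc1 mul1r. Qed.

Lemma scKV r x : r != 0 -> sc r * (sc r^-1 * x) = x.
Proof. by move=> r0; rewrite mulrA -scM mulfV // sc1 mul1r. Qed.

Lemma st0 : st 0 = 0.
Proof. by rewrite -(scale0r (0 : B)) (st_scale BN) conjC0 !scale0r. Qed.

Lemma stN a : st (- a) = - st a.
Proof. by rewrite -scaleN1r (st_scale BN) rmorphN1 scaleN1r. Qed.

Lemma stB a b : st (a - b) = st a - st b.
Proof. by rewrite stD stN. Qed.

Lemma st1 : st 1 = 1.
Proof. by rewrite -[RHS]stK -[X in _ = st X]mul1r stM stK mul1r. Qed.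

Lemma st_sc r : st (sc r) = sc r.
Proof. by rewrite (st_scale BN) st1 conj_Creal //; apply/complex_realP; exists r. Qed.

Lemma N0 : N 0 = 0.
Proof. by rewrite -(scale0r (0 : B)) (nrm_scale BN) normr0 mul0r. Qed.

Lemma NN a : N (- a) = N a.
Proof. by rewrite -scaleN1r (nrm_scale BN) normrN1 mul1r. Qed.

Lemma NB a b : N (a - b) <= N a + N b.
Proof. by rewrite (le_trans (ND _ _)) // NN. Qed.

Lemma Nst a : N (st a) = N a.
Proof.
have le x : N x <= N (st x).
  have [->|x0] := eqVneq x 0; first by rewrite N0.
  have Nx0 : 0 < N x.
    by rewrite lt_def N_ge0 andbT; apply: contraNneq x0 => /(nrm_eq0 BN)->.
  by rewrite -(ler_pM2r Nx0) -expr2 -(nrm_st_mul BN) NM.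
by apply: le_anti; rewrite le andbT -[X in _ <= N X]stK le.
Qed.

Lemma N1 : N 1 = 1.
Proof.
have /eqP := nrm_st_mul BN 1; rewrite st1 mulr1 expr2 -subr_eq0.
rewrite -[X in X - _]mulr1 -mulrBr mulf_eq0 => /orP[/eqP /(nrm_eq0 BN)/eqP|].
  by rewrite oner_eq0.
by rewrite subr_eq0 => /eqP.
Qed.

Lemma Nsc_mul r x : N (sc r * x) = `|r| * N x.
Proof. by rewrite scE (nrm_scale BN) normc_def /= expr0n addr0 sqrtr_sqr. Qed.

Lemma Nsc r : N (sc r) = `|r|.
Proof. by rewrite -[sc r]mulr1 Nsc_mul N1 mulr1. Qed.

Lemma nrm_geometric_eq0 (c q : R) x : 0 <= q < 1 ->
  (forall n, N x <= c * q ^+ n) -> x = 0.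
Proof.
move=> q01 xle; apply: (nrm_eq0 BN); apply/eqP; rewrite eq_le N_ge0 andbT.
exact: geometric_le0 xle.
Qed.

(* The solution is the limit of the iteration [g := (h + g * g) / 2]; it makes
   [1 - g] a square root of [1 - h]. *)
Lemma sqrt_exists (q : R) h : 0 < q < 1 -> N h <= 2 * q - q ^+ 2 ->
  exists g, [/\ N g <= q, g + g = h + g * g, st h = h -> st g = g &
    forall z, z * h = h * z -> z * g = g * z].
Proof.
move=> /andP[q0 q1] hq.
have q01 : 0 <= q < 1 by rewrite ltW.
pose u := fix u n := if n is m.+1 then sc (1 / 2) * (h + u m * u m) else 0.
have uS n : u n.+1 = sc (1 / 2) * (h + u n * u n) by [].
have half2 x : sc (1 / 2) * x + sc (1 / 2) * x = x.
  by rewrite -mulrDl -scD -splitr sc1 mul1r.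
have halfN : `|1 / 2 : R| = 1 / 2 by rewrite ger0_norm // divr_ge0.
(* The hypothesis on [N h] keeps the iteration in the ball of radius [q]:
   [(2 q - q^2 + q^2) / 2 = q]. *)
have uq n : N (u n) <= q.
  elim: n => [|n IHn]; first by rewrite N0 ltW.
  rewrite uS Nsc_mul halfN.
  have := ND h (u n * u n); have := NM (u n) (u n).
  by have := ler_pM (N_ge0 _) (N_ge0 _) IHn IHn; lra.
have uC z n : z * h = h * z -> z * u n = u n * z.
  move=> zh; elim: n => [|n IHn]; first by rewrite mulr0 mul0r.
  rewrite uS mulrA scC -!mulrA; congr (_ * _).
  by rewrite mulrDr mulrDl zh mulrA IHn -mulrA IHn mulrA.
have uCC m n : u m * u n = u n * u m by apply: (uC (u m)); rewrite (uC h m).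
(* Iterates commute, so each increment is half the previous one times [u n.+1 + u n], of norm at
   most [2 q]. *)
have uG n : N (u n.+1 - u n) <= q * q ^+ n.
  elim: n => [|n IHn]; first by rewrite subr0 mulr1.
  have -> : u n.+2 - u n.+1 = sc (1 / 2) * ((u n.+1 - u n) * (u n.+1 + u n)).
    rewrite (uS n.+1) [in X in _ - X](uS n) -mulrBr; congr (_ * _).
    have e : u n * u n.+1 = u n.+1 * u n by exact: uCC.
    have -> : (u n.+1 - u n) * (u n.+1 + u n)
      = u n.+1 * u n.+1 - u n * u n + (u n.+1 * u n - u n * u n.+1) by ncring.
    by rewrite e subrr addr0 opprD addrACA subrr add0r.
  rewrite Nsc_mul halfN (exprS q n).
  have le1 := NM (u n.+1 - u n) (u n.+1 + u n).
  have le2 : N (u n.+1 + u n) <= q + q.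
    by rewrite (le_trans (ND _ _)) // lerD.
  have := ler_pM (N_ge0 _) (N_ge0 _) IHn le2.
  by move: (q ^+ n) => w; lra.
have [l [c lu]] := nrm_complete BN q01 uG.
have cq0 n : 0 <= c * q ^+ n by exact: le_trans (N_ge0 _) (lu n).
have lq : N l <= q.
  rewrite -subr_le0; apply: (@geometric_le0 _ q c) => // n.
  have := ND (l - u n) (u n); rewrite subrK.
  by have := uq n; have := lu n; lra.
exists l; split=> //.
- apply/eqP; rewrite -subr_eq0; apply/eqP.
  apply: (@nrm_geometric_eq0 (4 * c) q) => // n.
  have -> : l + l - (h + l * l) = (l - u n.+1) + (l - u n.+1) - (l - u n) * l -
      u n * (l - u n).
    have -> : (l - u n.+1) + (l - u n.+1) = l + l - (u n.+1 + u n.+1) by ncring.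
    by rewrite uS half2; ncring.
  have e1 : N (l - u n.+1) <= c * q ^+ n.
    apply: (le_trans (lu n.+1)); rewrite exprS.
    by have := cq0 n; move: (q ^+ n) => w; nra.
  have := NB ((l - u n.+1) + (l - u n.+1) - (l - u n) * l) (u n * (l - u n)).
  have := NB ((l - u n.+1) + (l - u n.+1)) ((l - u n) * l).
  have := ND (l - u n.+1) (l - u n.+1).
  have := NM (l - u n) l; have := NM (u n) (l - u n).
  have := ler_pM (N_ge0 _) (N_ge0 _) (lu n) (le_trans lq (ltW q1)).
  have := ler_pM (N_ge0 _) (N_ge0 _) (le_trans (uq n) (ltW q1)) (lu n).
  by move: (q ^+ n) e1 (cq0 n) => w; lra.
- move=> sth; apply/eqP; rewrite -subr_eq0; apply/eqP.
  apply: (@nrm_geometric_eq0 (2 * c) q) => // n.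
  have stu : st (u n) = u n.
    elim: n => [|n IHn]; first exact: st0.
    by rewrite uS stM st_sc scC stD sth stM IHn.
  have -> : st l - l = st (l - u n) - (l - u n) by rewrite stB stu; ncring.
  by have := NB (st (l - u n)) (l - u n); rewrite Nst; have := lu n; lra.
- move=> z zh; apply/eqP; rewrite -subr_eq0; apply/eqP.
  apply: (@nrm_geometric_eq0 (2 * N z * c) q) => // n.
  have -> : z * l - l * z = z * (l - u n) - (l - u n) * z.
    have -> : z * (l - u n) - (l - u n) * z = z * l - l * z - (z * u n - u n * z).
      by ncring.
    by rewrite (uC z n zh) subrr subr0.
  have := NB (z * (l - u n)) ((l - u n) * z).
  have := NM z (l - u n); have := NM (l - u n) z.
  have := ler_pM (N_ge0 _) (N_ge0 _) (lexx (N z)) (lu n).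
  by move: (q ^+ n) => w; lra.
Qed.

Definition invertible x := exists y, x * y = 1 /\ y * x = 1.

Lemma invertible_lr x y z : x * y = 1 -> z * x = 1 -> invertible x.
Proof.
move=> xy zx; exists y; split=> //.
by rewrite -[y]mul1r -zx -(mulrA z x y) xy mulr1 zx.
Qed.

Lemma invertible_sc r : r != 0 -> invertible (sc r).
Proof. by move=> r0; exists (sc r^-1); rewrite -!scM mulfV // mulVf // sc1. Qed.

Lemma invertibleM x y : invertible x -> invertible y -> invertible (x * y).
Proof.
move=> [x' [xx x'x]] [y' [yy y'y]]; exists (y' * x').
by rewrite !mulrA -(mulrA x) yy mulr1 xx -(mulrA y') x'x mulr1 y'y.
Qed.

Lemma invertible_factor x y : x * y = y * x -> invertible (x * y) -> invertible x.
Proof.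
move=> xy [w [xyw wxy]]; apply: (@invertible_lr x (y * w) (w * y)).
  by rewrite mulrA.
by rewrite -mulrA -xy.
Qed.

Lemma invertible_1B x : N x < 1 -> invertible (1 - x).
Proof.
move=> x1; have x01 : 0 <= N x < 1 by rewrite N_ge0.
pose u := fix u n := if n is m.+1 then 1 + x * u m else 0.
have uG n : N (u n.+1 - u n) <= 1 * N x ^+ n.
  elim: n => [|n IHn]; first by rewrite /= mulr0 addr0 subr0 N1 mulr1.
  have -> : u n.+2 - u n.+1 = x * (u n.+1 - u n) by rewrite /=; ncring.
  by rewrite exprS mulrCA (le_trans (NM _ _)) // ler_wpM2l.
have uC n : x * u n = u n * x.
  elim: n => [|n IHn]; first by rewrite mulr0 mul0r.
  by rewrite /= mulrDr mulrDl mulr1 mul1r -mulrA -IHn.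
have [l [c lu]] := nrm_complete BN x01 uG.
have cq0 n : 0 <= c * N x ^+ n by exact: le_trans (N_ge0 _) (lu n).
have e1 n : N (l - u n.+1) <= c * N x ^+ n.
  by rewrite (le_trans (lu n.+1)) // exprS mulrCA ler_piMl // ltW.
have e2 n : N (x * (l - u n)) <= c * N x ^+ n.
  by rewrite (le_trans (NM _ _)) // (le_trans _ (lu n)) // ler_piMl // ltW.
have e3 n : N ((l - u n) * x) <= c * N x ^+ n.
  by rewrite (le_trans (NM _ _)) // (le_trans _ (lu n)) // ler_piMr // ltW.
have xl : x * l - l * x = 0.
  apply: (@nrm_geometric_eq0 (2 * c) (N x)) => // n.
  have -> : x * l - l * x = x * (l - u n) - (l - u n) * x.
    have -> : x * (l - u n) - (l - u n) * x = x * l - l * x - (x * u n - u n * x).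
      by ncring.
    by rewrite uC subrr subr0.
  have := NB (x * (l - u n)) ((l - u n) * x).
  by have := e2 n; have := e3 n; lra.
have lE : l - 1 - x * l = 0.
  apply: (@nrm_geometric_eq0 (2 * c) (N x)) => // n.
  have -> : l - 1 - x * l = (l - u n.+1) - x * (l - u n) by rewrite /=; ncring.
  have := NB (l - u n.+1) (x * (l - u n)).
  by have := e2 n; have := e1 n; lra.
exists l; split.
  have -> : (1 - x) * l = 1 + (l - 1 - x * l) by ncring.
  by rewrite lE addr0.
have -> : l * (1 - x) = 1 + (l - 1 - x * l) + (x * l - l * x) by ncring.
by rewrite lE xl !addr0.
Qed.

Lemma sqrt_1B h : N h < 1 -> exists c, [/\ N (1 - c) <= 1, c * c = 1 - h,
  st h = h -> st c = c & forall z, z * h = h * z -> z * c = c * z].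
Proof.
move=> h1; have h0 := N_ge0 h.
(* As [2 q - q^2 = 1 - (1 - q)^2], what is required is [(1 - q)^2 <= 1 - N h]; here
   [1 - q = (1 - N h) / 2]. *)
have [|//|g [gq gE gst gC]] := @sqrt_exists ((1 + N h) / 2) h.
- by apply/andP; split; lra.
- by nra.
exists (1 - g); split.
- by rewrite opprB addrC subrK; lra.
- have -> : (1 - g) * (1 - g) = 1 - (g + g - g * g) by ncring.
  by rewrite gE addrK.
- by move=> /gst gg; rewrite stB st1 gg.
- by move=> z /gC zg; rewrite mulrBr mulrBl mulr1 mul1r zg.
Qed.

(* [c + i k] is a multiple of a unitary. *)
Lemma nrm_sum_sq c k r : st c = c -> st k = k -> c * k = k * c -> 0 <= r ->
  c * c + k * k = sc r -> N c ^+ 2 <= r.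
Proof.
move=> sc_ sk ck r0 E; pose u := c + 'i *: k.
have su : st u = c - 'i *: k.
  by rewrite /u stD (st_scale BN) conjCi sc_ sk scaleNr.
have uu : st u * u = sc r.
  rewrite su /u mulrBl !mulrDr -!scalerAl -!scalerAr scalerA -(expr2 'i) sqrCi -E.
  by rewrite ck scaleN1r opprD opprK addrA addrK.
have Nu : N u ^+ 2 = r by rewrite -(nrm_st_mul BN) uu Nsc ger0_norm.
have cE : c = sc (1 / 2) * (u + st u).
  by rewrite su /u addrACA subrr addr0 sc_half.
have cu : N c <= N u.
  rewrite cE Nsc_mul ger0_norm ?divr_ge0 //.
  by have := ND u (st u); rewrite Nst; lra.
by rewrite -Nu; have := N_ge0 c; move: cu; nra.
Qed.

(** If [c] is the root of [1 - k^2 / r], the squares of [c] and [k / sqrt r] add up to [1], so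
    [N c <= 1] by [nrm_sum_sq]; and [r - k^2 = r c^2]. This is why squares are positive. *)
Lemma nrm_sub_sq k r : st k = k -> N k ^+ 2 < r -> N (sc r - k * k) <= r.
Proof.
move=> sk kr; have r0 : 0 < r by apply: le_lt_trans kr; exact: sqr_ge0.
have rn0 : r != 0 by rewrite gt_eqF.
set h := sc r^-1 * (k * k).
have h1 : N h < 1.
  rewrite Nsc_mul gtr0_norm ?invr_gt0 // mulrC ltr_pdivrMr // mul1r.
  by rewrite -{1}sk (nrm_st_mul BN).
have sh : st h = h by rewrite stM st_sc scC stM sk.
have [c [_ cc /(_ sh) sc_ cC]] := sqrt_1B h1.
pose w := sc (Num.sqrt r^-1) * k.
have sw : st w = w by rewrite stM st_sc scC sk.
have ww : w * w = h.
  rewrite /w mulrA -(mulrA _ k) scC mulrA -scM -expr2 sqr_sqrtr ?invr_ge0 ?ltW //.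
  by rewrite -mulrA.
have wc : w * c = c * w by apply: cC; rewrite -ww mulrA.
have := @nrm_sum_sq c w 1 sc_ sw (esym wc) ler01.
rewrite cc ww subrK sc1 => /(_ erefl) c1.
have -> : sc r - k * k = sc r * (c * c).
  by rewrite cc mulrBr mulr1 /h scKV.
rewrite Nsc_mul gtr0_norm // -[leRHS]mulr1.
apply: ler_wpM2l; first exact: ltW.
by rewrite (le_trans (NM _ _)) // -expr2.
Qed.

(* This form of positivity makes the positive elements a convex cone at once;
   that they are the squares, up to [e], follows from [sqrt_exists]. *)
Definition psd h := st h = h /\ exists t, N (sc t - h) <= t.

Lemma psd_st h : psd h -> st h = h. Proof. by case. Qed.

Lemma psdD h k : psd h -> psd k -> psd (h + k).
Proof.
move=> [sh [t ht]] [sk [r kr]]; split; first by rewrite stD sh sk.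
exists (t + r); rewrite scD opprD addrACA.
by rewrite (le_trans (ND _ _)) // lerD.
Qed.

Lemma psdZ r h : 0 <= r -> psd h -> psd (sc r * h).
Proof.
move=> r0 [sh [t ht]]; split; first by rewrite stM st_sc scC sh.
by exists (r * t); rewrite scM -mulrBr Nsc_mul ger0_norm // ler_wpM2l.
Qed.

Lemma psd_nrm_le h r : st h = h -> N h <= r -> psd (sc r - h).
Proof.
move=> sh hr; split; first by rewrite stB st_sc sh.
by exists r; rewrite opprB addrC subrK.
Qed.

Lemma psd_sc r : 0 <= r -> psd (sc r).
Proof. by move=> r0; rewrite -[sc r]subr0; apply: psd_nrm_le; rewrite ?st0 ?N0. Qed.

Lemma psd_sq k : st k = k -> psd (k * k).
Proof.
move=> sk; split; first by rewrite stM sk.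
by exists (N k ^+ 2 + 1); apply: nrm_sub_sq => //; rewrite ltrDl.
Qed.

(** One has [h + d = (t + d) (1 - x)] with [x = (t - h) / (t + d)]; the shift by [d] makes
    [N x < 1], as [sqrt_1B] requires. *)
Lemma psd_sqrt h d : psd h -> 0 < d -> exists k, [/\ st k = k, psd k,
  k * k = h + sc d & forall z, z * h = h * z -> z * k = k * z].
Proof.
move=> [sh [t ht]] d0; have t0 : 0 <= t by exact: le_trans (N_ge0 _) ht.
have T0 : 0 < t + d by rewrite ltr_wpDl.
set x := sc (t + d)^-1 * (sc t - h).
have x1 : N x < 1.
  rewrite Nsc_mul gtr0_norm ?invr_gt0 // mulrC ltr_pdivrMr // mul1r.
  by rewrite (le_lt_trans ht) // ltrDl.
have sx : st x = x by rewrite stM st_sc scC stB st_sc sh.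
have [c [c1 cc /(_ sx) sc_ cC]] := sqrt_1B x1.
set T := Num.sqrt (t + d).
have TT : T * T = t + d by rewrite -expr2 sqr_sqrtr // ltW.
have sk : st (sc T * c) = sc T * c by rewrite stM st_sc scC sc_.
exists (sc T * c); split=> //.
- split=> //; exists T; rewrite -{1}[sc T]mulr1 -mulrBr Nsc_mul.
  by rewrite ger0_norm ?sqrtr_ge0 // -[leRHS]mulr1 ler_wpM2l ?sqrtr_ge0.
- rewrite mulrA -(mulrA _ c) scC mulrA -scM TT -mulrA cc mulrBr mulr1.
  rewrite /x scKV ?gt_eqF // opprB scD.
  by rewrite addrC addrA subrK addrC.
- move=> z zh; rewrite mulrA scC -!mulrA; congr (_ * _).
  apply: cC; rewrite /x mulrA scC -!mulrA; congr (_ * _).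
  by rewrite mulrBr mulrBl scC zh.
Qed.

(** Positivity provides this bound for a single [t]. Since [h + d] is a square, [nrm_sub_sq] extends
    it to every [t] from the norm on, up to multiples of [d = e / 3]. *)
Lemma psd_nrm h t : psd h -> N h <= t -> N (sc t - h) <= t.
Proof.
move=> hp ht; apply/ler_addgt0Pr => e e0.
have d0 : 0 < e / 3 by rewrite divr_gt0.
have [k [sk _ kk _]] := psd_sqrt hp d0.
have Nk : N k ^+ 2 < t + 2 * (e / 3).
  rewrite -(nrm_st_mul BN) sk kk (le_lt_trans (ND _ _)) // Nsc gtr0_norm //.
  by lra.
have := nrm_sub_sq sk Nk; rewrite kk => le1.
have -> : sc t - h = (sc (t + 2 * (e / 3)) - (h + sc (e / 3))) - sc (e / 3).
  by rewrite scD sc_double; ncring.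
by have := NB (sc (t + 2 * (e / 3)) - (h + sc (e / 3))) (sc (e / 3));
  rewrite Nsc gtr0_norm //; lra.
Qed.

(** By [psd_nrm] the witness for [h + d] can be [N h + d]; the shifts cancel in the difference,
    which leaves [N (N h - h) <= N h + d] for all [d > 0]. *)
Lemma psd_closed h : (forall d, 0 < d -> psd (h + sc d)) -> psd h.
Proof.
move=> hp; split.
  have [] := hp 1 ltr01; rewrite stD st_sc => /addIr sh _; exact: sh.
exists (N h); apply/ler_addgt0Pr => d d0.
have := @psd_nrm (h + sc d) (N h + d) (hp d d0).
rewrite scD opprD addrACA subrr addr0; apply.
by rewrite (le_trans (ND _ _)) // Nsc gtr0_norm.
Qed.

Lemma psdM h k : psd h -> psd k -> h * k = k * h -> psd (h * k).
Proof.
move=> hp kp hk; apply: psd_closed => e e0.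
pose c := N h + N k + 1; have Nh := N_ge0 h; have Nk := N_ge0 k.
have c0 : 0 < c by rewrite ltr_wpDl // addr_ge0.
(* Chosen so that [d <= 1] and [d * c <= e]: the error in [(h + d) (k + d) = h k + d (h + k + d)]
   then has norm at most [e]. *)
pose d := e / (c + e).
have ce0 : 0 < c + e by rewrite addr_gt0.
have d0 : 0 < d by rewrite divr_gt0.
have d1 : d <= 1 by rewrite ler_pdivrMr // mul1r lerDr ltW.
have dc : d * c <= e.
  by rewrite /d mulrAC ler_pdivrMr // ler_wpM2l ?(ltW e0) ?(ltW d0) // lerDl
      ?ler01 ?(ltW e0).
have [x [sx _ xx xC]] := psd_sqrt hp d0.
have [y [sy _ yy yC]] := psd_sqrt kp d0.
have xy : x * y = y * x by apply: yC; rewrite -(xC k).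
have sxy : st (x * y) = x * y by rewrite stM sx sy.
have := psd_sq sxy.
have -> : x * y * (x * y) = (h + sc d) * (k + sc d).
  by rewrite -xx -yy -!mulrA; congr (_ * _); rewrite !mulrA xy.
set w := sc d * (h + k + sc d).
have -> : (h + sc d) * (k + sc d) = h * k + w.
  by rewrite /w !mulrDl !mulrDr scC; ncring.
move=> hkw; have -> : h * k + sc e = h * k + w + (sc e - w).
  by rewrite [sc e - w]addrC addrA addrK.
apply: psdD => //; apply: psd_nrm_le.
  rewrite /w stM st_sc scC !stD st_sc; congr (_ * (_ + _ + _)).
  - exact: psd_st.
  - exact: psd_st.
rewrite Nsc_mul gtr0_norm //; apply: le_trans dc; apply: ler_wpM2l; first exact: ltW.
rewrite (le_trans (ND _ _)) // Nsc gtr0_norm //.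
by have := ND h k; rewrite /c; lra.
Qed.

(** With [k^2 = h + d] and [m^2 = e - h + d], the identity [(h - e/2)^2 + (k m)^2 = (e/2 + d)^2] and
    [nrm_sum_sq] bound the distance from [h] to [e/2]. *)
Lemma nrm_le_psd h e : 0 <= e -> psd h -> psd (sc e - h) -> N h <= e.
Proof.
move=> e0 hp hep; apply/ler_addgt0Pr => d d0.
have [k [sk _ kk kC]] := psd_sqrt hp d0.
have [m [sm _ mm mC]] := psd_sqrt hep d0.
have hm : h * m = m * h by apply: mC; rewrite mulrBr mulrBl scC.
have km : k * m = m * k by rewrite (kC m).
have hk : h * k = k * h by exact: kC.
pose E := sc (e / 2); pose g := h - E.
have gk : g * k = k * g by rewrite mulrBl mulrBr scC hk.
have gm : g * m = m * g by rewrite mulrBl mulrBr scC hm.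
have EE : sc e = E + E by rewrite -scD -splitr.
have sg : st g = g by rewrite stB st_sc (psd_st hp).
have skm : st (k * m) = k * m by rewrite stM sk sm.
have r0 : 0 <= e / 2 + d by rewrite addr_ge0 ?divr_ge0 // ltW.
have gkm : g * (k * m) = k * m * g by rewrite mulrA gk -mulrA gm mulrA.
have sum : g * g + k * m * (k * m) = sc ((e / 2 + d) ^+ 2).
  have -> : k * m * (k * m) = (k * k) * (m * m).
    by rewrite -!mulrA; congr (_ * _); rewrite !mulrA km.
  rewrite kk mm EE expr2 scM scD -/E.
  transitivity ((E + sc d) * (E + sc d) + (h * E - E * h) + (h * sc d - sc d * h)
    + (sc d * E - E * sc d)); first by rewrite /g; ncring.
  have -> : h * E = E * h by exact: scC.
  have -> : sc d * E = E * sc d by exact: scC.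
  by rewrite [h * sc d]scC !subrr !addr0.
have := nrm_sum_sq sg skm gkm (sqr_ge0 _) sum.
rewrite ler_pXn2r // ?nnegrE // => Ng.
have -> : h = g + E by rewrite subrK.
rewrite (le_trans (ND _ _)) // Nsc ger0_norm ?divr_ge0 //.
by lra.
Qed.

Lemma psd_invertible h r : psd h -> 0 < r -> invertible (h + sc r).
Proof.
move=> [sh [t ht]] r0; have t0 : 0 <= t by exact: le_trans (N_ge0 _) ht.
have T0 : 0 < t + r by rewrite ltr_wpDl.
have -> : h + sc r = sc (t + r) * (1 - sc (t + r)^-1 * (sc t - h)).
  rewrite mulrBr scKV ?gt_eqF // mulr1 opprB scD.
  by ncring.
apply: invertibleM; first by apply: invertible_sc; rewrite gt_eqF.
apply: invertible_1B.
rewrite Nsc_mul gtr0_norm ?invr_gt0 // mulrC ltr_pdivrMr // mul1r.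
by rewrite (le_lt_trans ht) // ltrDl.
Qed.

(** The inverse [c] is positive, because [c + d' c^2] is the square of [k c] when [k^2 = b + d'].
    Hence the product [b (N c + 1 - c) = (N c + 1) b - 1] is positive, and [e = (N c + 1)^-1]
    does. *)
Lemma psd_invertible_sub b : psd b -> invertible b ->
  exists2 e, 0 < e & psd (b - sc e).
Proof.
move=> bp [c [bc cb]].
have scc : st c = c.
  have scb : st c * b = 1 by rewrite -{1}(psd_st bp) -stM bc st1.
  by rewrite -[LHS]mulr1 -bc mulrA scb mul1r.
have cp : psd c.
  apply: psd_closed => d d0.
  pose d' := d / (N c ^+ 2 + 1).
  have c0 : 0 < N c ^+ 2 + 1 by rewrite ltr_wpDl // sqr_ge0.
  have d'0 : 0 < d' by rewrite divr_gt0.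
  have d'c : d' * N c ^+ 2 <= d.
    by rewrite /d' mulrAC ler_pdivrMr // ler_wpM2l ?(ltW e0) ?(ltW d0) // lerDl
      ?ler01 ?(ltW e0).
  have [k [sk _ kk kC]] := psd_sqrt bp d'0.
  have ck : c * k = k * c by apply: kC; rewrite cb bc.
  have skc : st (k * c) = k * c by rewrite stM scc sk ck.
  have := psd_sq skc.
  have -> : k * c * (k * c) = c + sc d' * (c * c).
    rewrite -{1}ck -mulrA (mulrA k k) kk mulrDl bc mulrDr mulr1 !mulrA.
    by rewrite scC.
  move=> kcp; have -> : c + sc d = (c + sc d' * (c * c)) + (sc d - sc d' * (c * c)).
    by rewrite addrA addrAC addrK.
  apply: psdD => //; apply: psd_nrm_le; first by rewrite stM st_sc scC stM scc.
  rewrite Nsc_mul gtr0_norm //; apply: le_trans d'c; apply: ler_wpM2l; first exact: ltW.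
  by rewrite (le_trans (NM _ _)).
have M0 : 0 < N c + 1 by rewrite ltr_wpDl.
have := @psdM b (sc (N c + 1) - c) bp.
rewrite mulrBr mulrBl bc cb scC => /(_ _ erefl) Mp.
exists (N c + 1)^-1; first by rewrite invr_gt0.
have -> : b - sc (N c + 1)^-1 = sc (N c + 1)^-1 * (sc (N c + 1) * b - 1).
  by rewrite mulrBr scK ?gt_eqF // mulr1.
apply: psdZ; first by rewrite invr_ge0 ltW.
by apply: Mp; apply: psd_nrm_le => //; rewrite lerDl.
Qed.

(* The least [m >= 0] with [h + m] positive is [0]: otherwise [h + m] would be
   positive and invertible, so that a smaller [m] would do. *)
Lemma psd_of_invertible h : st h = h -> (forall r, 0 < r -> invertible (h + sc r)) ->
  psd h.
Proof.
move=> sh hinv.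
pose S := [set r : R | 0 <= r /\ psd (h + sc r)].
have up r t : r <= t -> psd (h + sc r) -> psd (h + sc t).
  move=> rt hr; have -> : h + sc t = h + sc r + sc (t - r).
    by rewrite -addrA -scD subrKC.
  by apply: psdD => //; apply: psd_sc; rewrite subr_ge0.
have S0 : S !=set0.
  exists (N h); split; first exact: N_ge0.
  by rewrite addrC -[h]opprK; apply: psd_nrm_le; rewrite ?stN ?sh ?NN.
have Slb : lbound S 0 by move=> r [].
have Sinf : has_inf S by split=> //; exists 0.
have m0 : 0 <= inf S by exact: lb_le_inf.
have mp : psd (h + sc (inf S)).
  apply: psd_closed => d d0.
  have [r [_ hr] rd] := inf_adherent d0 Sinf.
  by rewrite -addrA -scD; apply: up hr; exact: ltW.
have [m00|mn0] := eqVneq (inf S) 0.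
  by move: mp; rewrite m00 sc0 addr0.
have mgt0 : 0 < inf S by rewrite lt_def mn0.
have [e e0 hme] := psd_invertible_sub mp (hinv _ mgt0).
have : S (Num.max 0 (inf S - e)).
  split; first by rewrite le_max lexx.
  apply: (@up (inf S - e)); first by rewrite le_max lexx orbT.
  by rewrite scB addrA.
move=> /(ge_inf (ex_intro _ 0 Slb)); rewrite le_max leNgt mgt0 /=.
by rewrite lerBrDl gerDr leNgt e0.
Qed.

(** If [c] inverts [r + x y], then [r^-1 (1 - y c x)] inverts [r + y x]: the algebraic reason why
    [x y] and [y x] have the same nonzero spectrum. *)
Lemma invertible_swap x y r : r != 0 -> invertible (sc r + x * y) ->
  invertible (sc r + y * x).
Proof.
move=> r0 [c [cr rc]].
have -> : sc r + y * x = sc r * (1 + sc r^-1 * (y * x)).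
  by rewrite mulrDr mulr1 scKV.
apply: invertibleM; first exact: invertible_sc.
have E : 1 + sc r^-1 * (y * x) = sc r^-1 * (sc r + y * x).
  by rewrite mulrDr -scM mulVf // sc1.
exists (1 - y * c * x); split.
- rewrite E -mulrA.
  have -> : (sc r + y * x) * (1 - y * c * x) =
      sc r - (sc r * y - y * sc r) * c * x + y * x - y * ((sc r + x * y) * c) * x.
    by ncring.
  by rewrite cr scC subrr !mul0r subr0 mulr1 addrK -scM mulVf // sc1.
- have -> : (1 - y * c * x) * (1 + sc r^-1 * (y * x)) =
      sc r^-1 * ((1 - y * c * x) * (sc r + y * x)).
    by rewrite E !mulrA scC.
  have -> : (1 - y * c * x) * (sc r + y * x) =
      sc r - y * c * (x * sc r - sc r * x) + y * x - y * (c * (sc r + x * y)) * x.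
    by ncring.
  by rewrite rc scC subrr !mulr0 subr0 mulr1 addrK -scM mulVf // sc1.
Qed.

(** [psd_of_invertible] reduces the claim to invertibility of [r + d - y y^*] for [d > 0], which
    [invertible_swap] transfers from [y^* y]. *)
Lemma psd_swap y r : 0 <= r -> psd (sc r - st y * y) -> psd (sc r - y * st y).
Proof.
move=> r0 yp; apply: psd_of_invertible.
  by rewrite stB st_sc stM stK.
move=> d d0; have -> : sc r - y * st y + sc d = sc (r + d) + y * (- st y).
  by rewrite mulrN addrAC scD.
apply: invertible_swap; first by rewrite gt_eqF // ltr_wpDl.
by rewrite mulNr scD addrAC; exact: psd_invertible.
Qed.

(* [m] stands for the absolute value [|h|], up to [e]. *)
Lemma psd_abs h e : st h = h -> 0 < e -> exists m,
  [/\ psd m, h * m = m * h, m * m = h * h + sc (e ^+ 2) & psd (m - h)].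
Proof.
move=> sh e0; have e20 : 0 < e ^+ 2 by rewrite exprn_gt0.
have [m [sm mp mm mC]] := psd_sqrt (psd_sq sh) e20.
have hm : h * m = m * h by apply: mC; rewrite mulrA.
exists m; split=> //; apply: psd_of_invertible; first by rewrite stB sm sh.
move=> r r0.
(* The product is [(m + r)^2 - h^2 = 2 r m + e^2 + r^2], hence invertible; so is its first factor,
   as the factors commute. *)
have E : (m - h + sc r) * (m + h + sc r) =
    sc (2 * r) * (m + sc ((e ^+ 2 + r ^+ 2) / (2 * r))).
  rewrite [RHS]mulrDr -scM mulrCA divff ?mulr1; last by rewrite gt_eqF // mulr_gt0.
  transitivity (m * m - h * h + sc r * sc r + sc r * m + sc r * m +
     (m * h - h * m) - (h * sc r - sc r * h) + (m * sc r - sc r * m)); first by ncring.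
  rewrite mm hm (scC r h) (scC r m) !subrr !addr0 subr0.
  by rewrite sc_double scD !expr2 !scM; ncring.
have c : (m - h + sc r) * (m + h + sc r) = (m + h + sc r) * (m - h + sc r).
  apply/eqP; rewrite -subr_eq0; apply/eqP.
  transitivity ((m * h - h * m) + (m * h - h * m) + (sc r * h - h * sc r) +
    (sc r * h - h * sc r)); first by ncring.
  by rewrite hm (scC r h) !subrr !addr0.
apply: (invertible_factor c); rewrite E; apply: invertibleM.
  by apply: invertible_sc; rewrite gt_eqF // mulr_gt0.
apply: psd_invertible => //; rewrite divr_gt0 ?mulr_gt0 //.
by rewrite addr_gt0 // exprn_gt0.
Qed.

Lemma commuteM x y z : x * y = y * x -> x * z = z * x -> x * (y * z) = y * z * x.
Proof. by move=> xy xz; rewrite mulrA xy -mulrA xz mulrA. Qed.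

Lemma commuteB x y z : x * y = y * x -> x * z = z * x -> x * (y - z) = (y - z) * x.
Proof. by move=> xy xz; rewrite mulrBr mulrBl xy xz. Qed.

(* Kaplansky's argument: with [n] the negative part of [h = x^* x], up to [e],
   and [y = x n], the element [y^* y] is nearly negative, hence so is [y y^*];
   as their sum is positive, [y^* y], and with it [n], is nearly zero. *)
Lemma psd_st_mul x : psd (st x * x).
Proof.
set h := st x * x; have sh : st h = h by rewrite /h stM stK.
apply: psd_closed => eta eta0.
(* The bound by [1] gives [f = e^2 <= e]. If [N n > eta], the final estimate
   [N n ^ 3 <= f (4 N n + 3)] would then give [N n ^ 3 <= eta^2 N n / 2 + eta^3 / 2 < N n ^ 3]. *)
pose e := Num.min 1 (Num.min (eta ^+ 2 / 8) (eta ^+ 3 / 6)).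
have e0 : 0 < e by rewrite !lt_min ltr01 !divr_gt0 // exprn_gt0.
have e1 : e <= 1 by rewrite ge_min lexx.
have e8 : e <= eta ^+ 2 / 8 by rewrite !ge_min lexx orbT.
have e6 : e <= eta ^+ 3 / 6 by rewrite !ge_min lexx !orbT.
have ee : e ^+ 2 <= e by rewrite expr2 ler_piMl // ltW.
clearbody e; have e20 : 0 < e ^+ 2 by rewrite exprn_gt0.
move: (e ^+ 2) (psd_abs sh e0) ee e20 => f [m [mp hm mm mhp]] fe f0.
set n := m - h in mhp.
have sn : st n = n by exact: psd_st.
have hn : h * n = n * h by exact: commuteB.
have nE : n * n + (n * h + n * h) = sc f.
  transitivity (m * m - h * h - (h * m - m * h)).
    by rewrite /n; ncring.
  by rewrite hm mm subrr subr0 addrAC subrr add0r.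
pose y := x * n.
have yy : st y * y = n * h * n by rewrite /y stM sn /h !mulrA.
have yyE : st y * y + st y * y = sc f * n - n * n * n.
  by rewrite yy -nE; ncring.
have Nn := N_ge0 n.
(* By [yyE], twice this element is [f (N n + 1 - n) + n^3], a sum of positive elements. *)
have cp : psd (sc (f * (N n + 1) / 2) - st y * y).
  have -> : sc (f * (N n + 1) / 2) - st y * y =
      sc (1 / 2) * (sc f * (sc (N n + 1) - n) + n * n * n).
    have -> : sc f * (sc (N n + 1) - n) + n * n * n =
        sc f * sc (N n + 1) - (sc f * n - n * n * n) by ncring.
    by rewrite -yyE [RHS]mulrBr sc_half -!scM; congr (sc _ - _); field.
  apply: psdZ; first by rewrite divr_ge0.
  apply: psdD; first by apply: psdZ; [exact: ltW|apply: psd_nrm_le => //; rewrite lerDl].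
  apply: psdM => //; last by rewrite mulrA.
  exact: psd_sq.
set c := f * (N n + 1) / 2 in cp.
have c0 : 0 <= c by rewrite divr_ge0 // mulr_ge0 ?(ltW f0) // addr_ge0.
have cp' := psd_swap c0 cp.
have sump : psd (st y * y + y * st y).
  have -> : st y * y + y * st y = sc (1 / 2) *
      ((y + st y) * (y + st y) + 'i *: (y - st y) * ('i *: (y - st y))).
    have -> (w : B) : 'i *: w * ('i *: w) = - (w * w).
      by rewrite -scalerAl -scalerAr scalerA -(expr2 'i) sqrCi scaleN1r.
    have -> : (y + st y) * (y + st y) - (y - st y) * (y - st y) =
      (st y * y + y * st y) + (st y * y + y * st y) by ncring.
    by rewrite sc_half.
  apply: psdZ; first by rewrite divr_ge0.
  apply: psdD; apply: psd_sq.
    by rewrite stD stK addrC.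
  by rewrite (st_scale BN) conjCi stB stK scaleNr -scalerN opprB.
have N3 : N (st y * y + sc c) <= c + c.
  apply: nrm_le_psd; first exact: addr_ge0.
    have -> : st y * y + sc c = (st y * y + y * st y) + (sc c - y * st y).
      by rewrite -addrA subrKC.
    exact: psdD.
  by rewrite scD opprD addrACA subrr addr0.
have Ny : N (st y * y) <= 3 * c.
  have := NB (st y * y + sc c) (sc c); rewrite addrK Nsc ger0_norm //.
  by lra.
have Nn3 : N (n * n * n) <= f * (4 * N n + 3).
  have -> : n * n * n = sc f * n - (st y * y + st y * y) by rewrite yyE subKr.
  have := NB (sc f * n) (st y * y + st y * y); have := ND (st y * y) (st y * y).
  rewrite Nsc_mul gtr0_norm //; move: Ny; rewrite /c; lra.
have Nn2 : N (n * n) = N n ^+ 2 by rewrite -{1}sn (nrm_st_mul BN).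
(* As [n] is self-adjoint, [N n ^ 4] is the norm of [n^4]; dividing by [N n] will bound
   [N n ^ 3]. *)
have Nn4 : N n ^+ 4 <= N n * N (n * n * n).
  rewrite (exprM _ 2 2) -Nn2 -(nrm_st_mul BN) stM sn -!mulrA.
  exact: NM.
have neta : N n <= eta.
  rewrite leNgt; apply/negP => etan.
  have n0 : 0 < N n by exact: lt_trans etan.
  have n3 : N n ^+ 3 <= f * (4 * N n + 3).
    rewrite -(ler_pM2l n0) -exprS (le_trans Nn4) //.
    by rewrite ler_wpM2l.
  have h1 : eta ^+ 2 < N n ^+ 2 by rewrite ltr_pXn2r // nnegrE ltW.
  have h2 : eta ^+ 3 < N n ^+ 3 by rewrite ltr_pXn2r // nnegrE ltW.
  have h3 : f * N n <= eta ^+ 2 / 8 * N n by rewrite ler_wpM2r // (le_trans fe).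
  have h4 : eta ^+ 2 * N n < N n ^+ 3 by rewrite [ltRHS]exprSr ltr_pM2r.
  by move: (le_trans fe e6); lra.
have -> : h + sc eta = m + (sc eta - n) by rewrite /n; ncring.
by apply: psdD => //; apply: psd_nrm_le.
Qed.

Lemma psd_sum (s : seq B) : psd (\sum_(x <- s) st x * x).
Proof.
elim: s => [|x s IHs]; first by rewrite big_nil -sc0; exact: psd_sc.
by rewrite big_cons; apply: psdD => //; exact: psd_st_mul.
Qed.

Lemma nrm_le_sum a z (s : seq B) : st a * a + \sum_(x <- s) st x * x = z ->
  N a ^+ 2 <= N z.
Proof.
move=> zE; rewrite -(nrm_st_mul BN); apply: nrm_le_psd => //.
  exact: psd_st_mul.
have -> : sc (N z) - st a * a = (sc (N z) - z) + \sum_(x <- s) st x * x.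
  by rewrite -zE opprD addrA subrK.
apply: psdD; last exact: psd_sum.
apply: psd_nrm_le => //; rewrite -zE stD stM stK.
by rewrite (psd_st (psd_sum s)).
Qed.

Record nrm_closed_ideal (J : set B) : Prop := NrmClosedIdeal {
  nci0 : J 0 ;
  nci_add : forall x y, J x -> J y -> J (x + y) ;
  nci_mull : forall x y, J y -> J (x * y) ;
  nci_mulr : forall x y, J x -> J (x * y) ;
  nci_st : forall x, J x -> J (st x) ;
  nci_closed : forall x, (forall e, 0 < e -> exists2 y, J y & N (x - y) <= e) -> J x
}.

(** * Approximate units and membership in closed ideals *)

Section Ideal.
Variable J : set B.
Hypothesis JI : nrm_closed_ideal J.

(* [u = (1 - w ^ 2) ^ n] for [w] a small multiple of [j]; the bound comes from
   [q ^ n * (1 + n * (1 - q)) <= 1], where [q = 1 - w ^ 2]. *)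
Lemma approximate_unit j e : J j -> st j = j -> 0 < e ->
  exists u, [/\ J (1 - u), st u = u, N u <= 1 & N (u * j * u) <= e].
Proof.
move=> Jj sj e0; pose T := N j + 1.
have T0 : 0 < T by rewrite ltr_wpDl.
pose w := sc T^-1 * j.
have Nw : N w < 1.
  by rewrite Nsc_mul gtr0_norm ?invr_gt0 // mulrC ltr_pdivrMr // mul1r ltrDl.
have sw : st w = w by rewrite stM st_sc scC sj.
have Jw : J w by exact: nci_mull.
have jE : j = sc T * w by rewrite /w scKV // gt_eqF.
clearbody w.
pose p := w * w; pose q := 1 - p.
have pp : psd p by exact: psd_sq.
have Np : N p <= 1.
  by rewrite (le_trans (NM _ _)) // -expr2 expr_le1 // ltW.
have sq_ : st q = q by rewrite stB st1 (psd_st pp).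
have qp : psd q by rewrite /q -sc1; apply: psd_nrm_le => //; exact: psd_st.
have Nq : N q <= 1.
  by rewrite /q -sc1; apply: nrm_sub_sq => //; rewrite expr_lt1.
have pq : p * q = q * p by rewrite mulrBl mulrBr mulr1 mul1r.
have wq : w * q = q * w by rewrite mulrBl mulrBr mulr1 mul1r mulrA.
have wqn n : w * q ^+ n = q ^+ n * w by exact: commrX.
have pqn n : p * q ^+ n = q ^+ n * p by exact: commrX.
have sqn n : st (q ^+ n) = q ^+ n.
  by elim: n => [|n IHn]; [exact: st1|rewrite exprS stM sq_ IHn -exprSr exprS].
have qnp n : psd (q ^+ n).
  elim: n => [|n IHn]; first by rewrite expr0 -sc1; exact: psd_sc.
  by rewrite exprS; apply: psdM => //; rewrite -exprS exprSr.
have Nqn n : N (q ^+ n) <= 1.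
  elim: n => [|n IHn]; first by rewrite N1.
  by rewrite exprS (le_trans (NM _ _)) // mulr_ile1.
have Jqn n : J (1 - q ^+ n).
  elim: n => [|n IHn].
    by rewrite subrr -[0](mul0r w); exact: nci_mull.
  have -> : 1 - q ^+ n.+1 = (1 - q ^+ n) + w * w * q ^+ n.
    by rewrite exprS /q /p; ncring.
  by apply: nci_add => //; apply: nci_mulr => //; exact: nci_mull.
(* Passing from [n] to [n.+1] adds the positive element [(n + 1) q^n p^2]. *)
have Dp n : psd (1 - q ^+ n * (1 + sc n%:R * p)).
  elim: n => [|n IHn].
    by rewrite sc0 mul0r addr0 mulr1 subrr -sc0; exact: psd_sc.
  have -> : 1 - q ^+ n.+1 * (1 + sc n.+1%:R * p) =
      1 - q ^+ n * (1 + sc n%:R * p) + sc n.+1%:R * (q ^+ n * (p * p)).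
    have sE : sc n.+1%:R = sc n%:R + 1 by rewrite -addn1 natrD scD sc1.
    rewrite (mulrA (sc _) (q ^+ n)) -[sc n.+1%:R * q ^+ n]scC sE exprSr.
    have c : p * sc n%:R = sc n%:R * p by exact: scC.
    rewrite /q; move: (sc n%:R) c ((1 - p) ^+ n) => z c v.
    transitivity (1 - v * (1 + z * p) + v * (z + 1) * (p * p) +
      v * (p * z - z * p) * p); first by ncring.
    by rewrite c subrr mulr0 mul0r addr0.
  apply: psdD => //; apply: psdZ => //; apply: psdM => //.
    by apply: psd_sq; exact: psd_st.
  by apply: commuteM; rewrite pqn.
(* The left side is the norm of [q^(2 n) p], which [Dp] at [2 n] bounds. *)
have bound n : (0 < n)%N -> N (w * q ^+ n) ^+ 2 <= (n + n)%:R^-1.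
  move=> n0; have nn0 : 0 < (n + n)%:R :> R by rewrite ltr0n addn_gt0 n0.
  have -> : N (w * q ^+ n) ^+ 2 = N (q ^+ (n + n) * p).
    rewrite -(nrm_st_mul BN) stM sw sqn exprD wqn; congr (N _).
    by rewrite -!mulrA; congr (_ * _); rewrite (mulrA w) wqn -mulrA.
  apply: nrm_le_psd; first by rewrite invr_ge0 ltW.
    by apply: psdM => //; rewrite pqn.
  have -> : sc (n + n)%:R^-1 - q ^+ (n + n) * p = sc (n + n)%:R^-1 *
      (1 - q ^+ (n + n) * (1 + sc (n + n)%:R * p) + q ^+ (n + n)).
    rewrite [q ^+ _ * (1 + _)]mulrDr mulr1 opprD addrA addrAC subrK.
    rewrite mulrBr mulr1; congr (_ - _).
    by rewrite (mulrA (q ^+ (n + n)) (sc _)) scC -mulrA scK // gt_eqF.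
  by apply: psdZ; [rewrite invr_ge0 ltW|exact: psdD].
have [n n0 nT] : exists2 n, (0 < n)%N & (T / e) ^+ 2 <= (n + n)%:R.
  exists (Num.trunc ((T / e) ^+ 2)).+1 => //.
  apply: ltW; apply: (lt_le_trans (truncnS_gt _)).
  by rewrite ler_nat leq_addr.
exists (q ^+ n); split=> //.
have -> : q ^+ n * j * q ^+ n = sc T * (q ^+ n * (w * q ^+ n)).
  by rewrite jE [q ^+ n * (_ * _)]mulrA scC !mulrA.
rewrite Nsc_mul gtr0_norm // mulrC -ler_pdivlMr //.
apply: (le_trans (NM _ _)); apply: (@le_trans _ _ (N (w * q ^+ n))).
  by rewrite ler_piMl.
have eT : 0 < e / T by rewrite divr_gt0.
rewrite -(@ler_pXn2r _ 2) ?nnegrE // ?(ltW eT) // (le_trans (bound _ n0)) //.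
rewrite -[e / T]invrK invf_div exprVn lef_pV2 // posrE.
  by rewrite ltr0n addn_gt0 n0.
by rewrite exprn_gt0 // divr_gt0.
Qed.

(* Functionals that are nonnegative on this cone vanish on [J] and on the
   skew-adjoint elements, and so are real parts of hermitian functionals. *)
Definition ideal_cone : set B := [set v | exists (s : seq B) (j z : B),
  J j /\ v = \sum_(x <- s) st x * x + j + (z - st z)].

(** Taking hermitian parts removes [z - z^*] and leaves [a^* a + S = e - i] with [i] in [J] and [S]
    a sum of elements [x^* x]. Multiplying by [u] on both sides makes [u i u] small, hence [a u]; so
    [a (1 - u)] is an element of [J] close to [a]. *)
Lemma mem_of_ideal_cone a : (forall e, 0 < e -> ideal_cone (sc e - st a * a)) -> J a.
Proof.
move=> aK; apply: (nci_closed JI) => d d0.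
(* One half of [d^2] is spent on [e u^2], the other on [u i u]. *)
pose e := d ^+ 2 / 2; have e0 : 0 < e by rewrite divr_gt0 // exprn_gt0.
have [s [j [z [Jj E]]]] := aK e e0.
pose i := sc (1 / 2) * (j + st j).
have Ji : J i by apply: (nci_mull JI); apply: (nci_add JI) => //; exact: nci_st.
have si : st i = i by rewrite stM st_sc scC stD stK addrC.
have {}E : st a * a + \sum_(x <- s) st x * x = sc e - i.
  set S := \sum_(x <- s) _ in E *; have sS : st S = S := psd_st (psd_sum s).
  have sE : sc e - st a * a = S + st j + (st z - z).
    have := congr1 st E; rewrite !stD !stN st_sc stM !stK sS; exact.
  have E2 : sc e - st a * a = S + i.
    rewrite -[LHS]sc_half {1}E sE -[S in RHS]sc_half -mulrDr; congr (_ * _).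
    by ncring.
  by rewrite -[S](addrK i) -E2; ncring.
have [u [Ju su Nu Nuiu]] := approximate_unit Ji si e0.
exists (a * (1 - u)); first exact: nci_mull.
have -> : a - a * (1 - u) = a * u by ncring.
have E3 : st (a * u) * (a * u) + \sum_(x <- [seq y * u | y <- s]) st x * x =
    sc e * (u * u) - u * i * u.
  rewrite big_map.
  have -> : \sum_(y <- s) st (y * u) * (y * u) =
      u * (\sum_(x <- s) st x * x) * u.
    rewrite mulr_sumr mulr_suml; apply: eq_bigr => y _.
    by rewrite stM su !mulrA.
  rewrite stM su; set S := \sum_(x <- s) _ in E *.
  transitivity (u * (st a * a + S) * u); first by ncring.
  by rewrite E mulrBr mulrBl [u * sc e]scC -(mulrA (sc e)).
have := nrm_le_sum E3 => le1.
have le2 : N (sc e * (u * u) - u * i * u) <= d ^+ 2.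
  apply: (le_trans (NB _ _)); rewrite Nsc_mul gtr0_norm //.
  have : N (u * u) <= 1 by rewrite (le_trans (NM _ _)) // mulr_ile1.
  by rewrite -(ler_pM2l e0) mulr1; move: Nuiu; rewrite /e; lra.
by rewrite -(@ler_pXn2r _ 2) ?nnegrE ?(ltW d0) // (le_trans le1).
Qed.

End Ideal.
End UnitalCStar.

(** * Completion of a semi-inner product space *)

Import ComplexField.Normc.

Section Normc.
Variable R : realType.
Implicit Types y z : R[i].

Lemma norm_normc z : `|z| = ((normc z)%:C)%C.
Proof. by case: z. Qed.

Lemma normc_ge0 z : 0 <= normc z.
Proof. by case: z => a b; exact: sqrtr_ge0. Qed.

Lemma ler_normc_add y z : normc (y + z) <= normc y + normc z.
Proof. by rewrite -lecR rmorphD /= -!norm_normc ler_normD. Qed.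

Lemma normc_opp z : normc (- z) = normc z.
Proof. by apply: complexI; rewrite -!norm_normc normrN. Qed.

Lemma normc_conj z : normc (z^*) = normc z.
Proof. by apply: complexI; rewrite -!norm_normc norm_conjC. Qed.

Lemma normc_le z : normc z <= `|complex.Re z| + `|complex.Im z|.
Proof.
case: z => a b /=; rewrite -(@ler_pXn2r _ 2) ?nnegrE ?sqrtr_ge0 ?addr_ge0 //.
rewrite sqr_sqrtr ?addr_ge0 ?sqr_ge0 // sqrrD !real_normK ?num_real //.
by rewrite lerD2r lerDl mulrn_wge0 // mulr_ge0.
Qed.

Lemma Im_le_normc z : `|complex.Im z| <= normc z.
Proof.
case: z => a b /=; rewrite -sqrtr_sqr ler_wsqrtr //.
by rewrite lerDr sqr_ge0.
Qed.

Lemma Re_le_normc z : `|complex.Re z| <= normc z.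
Proof.
case: z => a b /=; rewrite -sqrtr_sqr ler_wsqrtr //.
by rewrite lerDl sqr_ge0.
Qed.

End Normc.

(** * Semi-inner products and the Cauchy-Schwarz inequality *)

Section SemiInner.
Variables (R : realType) (V : lmodType R[i]).

Record semi_inner (s : V -> V -> R[i]) : Prop := SemiInner {
  semi_innerl : forall (k : R[i]) x y z, s (k *: x + y) z = k * s x z + s y z ;
  semi_inner_herm : forall x y, s y x = (s x y)^* ;
  semi_inner_ge0 : forall x, 0 <= s x x
}.

Variable s : V -> V -> R[i].
Hypothesis sS : semi_inner s.
Implicit Types (x y z : V) (k : R[i]).

Lemma semi_innerDl x y z : s (x + y) z = s x z + s y z.
Proof. by rewrite -[in LHS](scale1r x) (semi_innerl sS) mul1r. Qed.

Lemma semi_inner0l z : s 0 z = 0.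
Proof. by apply: (addrI (s 0 z)); rewrite -semi_innerDl !addr0. Qed.

Lemma semi_innerZl k x z : s (k *: x) z = k * s x z.
Proof. by rewrite -[in LHS](addr0 (k *: x)) (semi_innerl sS) semi_inner0l addr0. Qed.

Lemma semi_innerNl x z : s (- x) z = - s x z.
Proof. by rewrite -scaleN1r semi_innerZl mulN1r. Qed.

Lemma semi_innerBl x y z : s (x - y) z = s x z - s y z.
Proof. by rewrite semi_innerDl semi_innerNl. Qed.

Lemma semi_innerDr x y z : s x (y + z) = s x y + s x z.
Proof. by rewrite !(fun t => semi_inner_herm sS t x) semi_innerDl rmorphD. Qed.

Lemma semi_innerZr k x z : s x (k *: z) = k^* * s x z.
Proof. by rewrite !(fun t => semi_inner_herm sS t x) semi_innerZl rmorphM. Qed.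

Lemma semi_innerNr x z : s x (- z) = - s x z.
Proof. by rewrite -scaleN1r semi_innerZr rmorphN1 mulN1r. Qed.

Lemma semi_innerBr x y z : s x (y - z) = s x y - s x z.
Proof. by rewrite semi_innerDr semi_innerNr. Qed.

Definition semi_norm x : R := Num.sqrt (complex.Re (s x x)).
Local Notation ns := semi_norm.

Lemma semi_norm_ge0 x : 0 <= ns x. Proof. exact: sqrtr_ge0. Qed.

Lemma Re_semi_inner_ge0 x : 0 <= complex.Re (s x x).
Proof. by have := semi_inner_ge0 sS x; rewrite lecE => /andP[]. Qed.

Lemma semi_innerxx x : s x x = ((ns x ^+ 2)%:C)%C.
Proof.
rewrite sqr_sqrtr ?Re_semi_inner_ge0 //.
by rewrite RRe_real // ger0_real // (semi_inner_ge0 sS).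
Qed.

Lemma semi_norm_eq x r : 0 <= r -> s x x = ((r ^+ 2)%:C)%C -> ns x = r.
Proof. by move=> r0 E; rewrite /ns E /= sqrtr_sqr ger0_norm. Qed.

Lemma semi_normZ k x : ns (k *: x) = normc k * ns x.
Proof.
apply: semi_norm_eq; first by rewrite mulr_ge0 ?semi_norm_ge0 // normc_ge0.
rewrite semi_innerZl semi_innerZr mulrA -normCK norm_normc semi_innerxx.
by rewrite exprMn !expr2 !rmorphM.
Qed.

Lemma semi_inner_CS x y : normc (s x y) <= ns x * ns y.
Proof.
set c := s x y; set a := ns x; set b := ns y; set p := normc c.
have a0 : 0 <= a by exact: semi_norm_ge0.
have b0 : 0 <= b by exact: semi_norm_ge0.
have p0 : 0 <= p by rewrite normc_ge0.
(* The squared seminorm of [x - t c y] as a polynomial in [t]. *)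
have quad (t : R) : 0 <= a ^+ 2 - 2 * t * p ^+ 2 + t ^+ 2 * p ^+ 2 * b ^+ 2.
  set z : R[i] := (t%:C)%C * c.
  have zE : z^* = (t%:C)%C * c^*.
    rewrite /z rmorphM; congr (_ * _).
    by apply: conj_Creal; apply/complex_realP; exists t.
  have cc : c * c^* = ((p ^+ 2)%:C)%C by rewrite -normCK norm_normc rmorphXn.
  have := semi_inner_ge0 sS (x - z *: y).
  have -> : s (x - z *: y) (x - z *: y) =
     ((a ^+ 2 - 2 * t * p ^+ 2 + t ^+ 2 * p ^+ 2 * b ^+ 2)%:C)%C.
    rewrite semi_innerBl !semi_innerBr !semi_innerZl !semi_innerZr !semi_innerxx.
    rewrite [s y x](semi_inner_herm sS) -/c -/a -/b zE.
    have -> : ((a ^+ 2 - 2 * t * p ^+ 2 + t ^+ 2 * p ^+ 2 * b ^+ 2)%:C)%C =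
      ((a ^+ 2)%:C - (t%:C * (p ^+ 2)%:C + t%:C * (p ^+ 2)%:C) +
       t%:C * t%:C * (p ^+ 2)%:C * (b ^+ 2)%:C)%C :> R[i].
      by rewrite -!(rmorphD, rmorphN, rmorphM) /=; congr (_%:C)%C; ring.
    by rewrite -cc /z; ring.
  by rewrite ler0c.
rewrite leNgt; apply/negP => abp.
have pgt0 : 0 < p by rewrite (le_lt_trans _ abp) // mulr_ge0.
have p20 : 0 < p ^+ 2 by rewrite exprn_gt0.
have [b00|bn0] := eqVneq b 0.
  (* For [b = 0] the polynomial is affine, and its value here is [- a^2 - 2]. *)
  have := quad ((a ^+ 2 + 1) / p ^+ 2).
  rewrite b00 expr0n /= mulr0 addr0 -mulrA -(mulrA (a ^+ 2 + 1)) mulVf ?gt_eqF //.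
  by have := sqr_ge0 a; lra.
have bgt0 : 0 < b by rewrite lt_def bn0.
have b20 : 0 < b ^+ 2 by rewrite exprn_gt0.
have := quad ((b ^+ 2)^-1).
have -> : a ^+ 2 - 2 * (b ^+ 2)^-1 * p ^+ 2 + (b ^+ 2)^-1 ^+ 2 * p ^+ 2 * b ^+ 2 =
  (a ^+ 2 * b ^+ 2 - p ^+ 2) / b ^+ 2 by field.
rewrite pmulr_lge0 ?invr_gt0 // subr_ge0 -exprMn leNgt => /negP; apply.
by rewrite ltr_pXn2r // nnegrE ?mulr_ge0 // ltW.
Qed.

Lemma semi_normD x y : ns (x + y) <= ns x + ns y.
Proof.
have := @addr_ge0 _ _ _ (semi_norm_ge0 x) (semi_norm_ge0 y) => xy0.
rewrite -(@ler_pXn2r _ 2) ?nnegrE ?semi_norm_ge0 //.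
have E : ((ns (x + y) ^+ 2)%:C)%C = ((ns x ^+ 2 + ns y ^+ 2)%:C)%C +
    (s x y + (s x y)^*).
  rewrite -semi_innerxx semi_innerDl !semi_innerDr !semi_innerxx.
  by rewrite [s y x](semi_inner_herm sS) rmorphD /=; ring.
have Re_le : complex.Re (s x y) <= normc (s x y).
  by rewrite (le_trans _ (Re_le_normc _)) // ler_norm.
have := semi_inner_CS x y.
move: (congr1 (@complex.Re R) E); case: (s x y) Re_le => u v /= uv E' CS.
by rewrite E'; lra.
Qed.

Lemma semi_normN x : ns (- x) = ns x.
Proof. by rewrite /ns semi_innerNl semi_innerNr opprK. Qed.

Lemma semi_normB x y : ns (x - y) = ns (y - x).
Proof. by rewrite -semi_normN opprB. Qed.

Lemma semi_norm0 : ns 0 = 0.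
Proof. by rewrite /ns semi_inner0l sqrtr0. Qed.

Lemma semi_norm_le_add x y z : ns (x - z) <= ns (x - y) + ns (y - z).
Proof. by rewrite -{1}(subrK y x) -addrA semi_normD. Qed.

End SemiInner.

(** * Sequences that converge at a geometric rate *)

Section FastLimits.
Variable R : realType.

Definition hpow (n : nat) : R := (1 / 2) ^+ n.

Lemma hpow_gt0 n : 0 < hpow n.
Proof. by rewrite exprn_gt0 // divr_gt0. Qed.

Lemma hpow_le1 n : hpow n <= 1.
Proof. by rewrite exprn_ile1 ?divr_ge0 // ler_pdivrMr // mul1r ler1n. Qed.

Lemma hpowS n : hpow n = hpow n.+1 + hpow n.+1.
Proof. by rewrite /hpow exprS; move: (_ ^+ n) => w; lra. Qed.

Lemma half01 : 0 <= (1 / 2 : R) < 1.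
Proof. by rewrite divr_ge0 //= ltr_pdivrMr // mul1r ltr1n. Qed.

Lemma fast_le0 (c x : R) : (forall n, x <= c * hpow n) -> x <= 0.
Proof. by move=> xle; exact: geometric_le0 half01 xle. Qed.

Lemma hpow_small (c d : R) : 0 < d -> exists n, c * hpow n <= d.
Proof. by move=> d0; exact: geometric_small half01 d0. Qed.

(** With [C = c / (1 - q)] the bounds on the increments telescope to [C (q^n - q^m)], so every
    [u n - C q^n] lies below every [u m + C q^m]; the limit is the supremum of the lower ends. *)
Lemma geometric_cauchy_real (u : nat -> R) (c q : R) : 0 <= q < 1 ->
  (forall n, `|u n.+1 - u n| <= c * q ^+ n) ->
  exists l, forall n, `|l - u n| <= c / (1 - q) * q ^+ n.
Proof.
move=> /andP[q0 q1] uc; have c0 : 0 <= c.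
  by have := le_trans (normr_ge0 _) (uc 0); rewrite mulr1.
have cE : c = c / (1 - q) * (1 - q) by rewrite divfK // subr_eq0 gt_eqF.
have C0 : 0 <= c / (1 - q) by rewrite divr_ge0 // subr_ge0 ltW.
move: (c / (1 - q)) cE C0 => C cE C0.
have dec n m : (n <= m)%N -> `|u m - u n| <= C * (q ^+ n - q ^+ m).
  move=> /subnK <-; elim: (m - n)%N => [|k IHk]; first by rewrite !subrr mulr0 normr0.
  have := ler_normD (u (k + n).+1 - u (k + n)) (u (k + n) - u n); rewrite subrKA.
  rewrite addSn; have := uc (k + n)%N; move: IHk; rewrite exprS cE.
  by move: (q ^+ (k + n)) => w; lra.
pose S := [set u n - C * q ^+ n | n in setT].
have up n m : u n - C * q ^+ n <= u m + C * q ^+ m.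
  have cn k : 0 <= C * q ^+ k by rewrite mulr_ge0 // exprn_ge0.
  have := cn n; have := cn m.
  by have [/dec|/ltnW/dec] := leqP n m; rewrite ler_norml => /andP[]; lra.
have S0 : S !=set0 by exists (u 0 - C * q ^+ 0), 0.
have Sub n : ubound S (u n + C * q ^+ n) by move=> _ [m _ <-].
exists (sup S) => n; rewrite ler_distl; apply/andP; split.
  by apply: ub_le_sup; [exists (u 0 + C * q ^+ 0)|exists n].
exact: ge_sup.
Qed.

Lemma geometric_cauchy_complex (z : nat -> R[i]) (c q : R) : 0 <= q < 1 ->
  (forall n, normc (z n.+1 - z n) <= c * q ^+ n) ->
  exists l, forall n, normc (l - z n) <= 2 * (c / (1 - q)) * q ^+ n.
Proof.
move=> q01 zc.
have [n|a ale] := @geometric_cauchy_real (fun n => complex.Re (z n)) c q q01.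
  by rewrite -raddfB (le_trans (Re_le_normc _)).
have [n|b ble] := @geometric_cauchy_real (fun n => complex.Im (z n)) c q q01.
  by rewrite -raddfB (le_trans (Im_le_normc _)).
exists (a +i* b)%C => n; apply: (le_trans (normc_le _)).
have := ale n; have := ble n; case: (z n) => u v /=.
by move: (c / _) (q ^+ n) => C w; lra.
Qed.

Lemma fast_cauchy_complex (z : nat -> R[i]) (c : R) :
  (forall n, normc (z n.+1 - z n) <= c * hpow n) ->
  exists l, forall n, normc (l - z n) <= 4 * c * hpow n.
Proof.
move=> /(geometric_cauchy_complex half01)[l ll]; exists l => n.
by rewrite (le_trans (ll n)) // (_ : 2 * (c / (1 - 1 / 2)) = 4 * c) //; field.
Qed.

Definition fast_cvg (z : nat -> R[i]) (l : R[i]) :=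
  exists c, forall n, normc (l - z n) <= c * hpow n.

Lemma fast_cvg_unique z l l' : fast_cvg z l -> fast_cvg z l' -> l = l'.
Proof.
move=> [c lc] [d ld]; apply/eqP; rewrite -subr_eq0; apply/eqP/eq0_normc.
apply/eqP; rewrite eq_le; apply/andP; split; last by rewrite normc_ge0.
apply: (@fast_le0 (c + d)) => n.
have := ler_normc_add (l - z n) (- (l' - z n)); rewrite normc_opp opprB addrA subrK.
by have := lc n; have := ld n; lra.
Qed.

Lemma fast_cvgD y z l m : fast_cvg y l -> fast_cvg z m ->
  fast_cvg (fun n => y n + z n) (l + m).
Proof.
move=> [c lc] [d ld]; exists (c + d) => n; rewrite opprD addrACA mulrDl.
by rewrite (le_trans (ler_normc_add _ _)) // lerD.
Qed.

Lemma fast_cvgZ k z l : fast_cvg z l -> fast_cvg (fun n => k * z n) (k * l).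
Proof.
move=> [c lc]; exists (normc k * c) => n; rewrite -mulrBr normcM -mulrA.
by rewrite ler_wpM2l // normc_ge0.
Qed.

Lemma fast_cvg_conj z l : fast_cvg z l -> fast_cvg (fun n => (z n)^*) (l^*).
Proof. by move=> [c lc]; exists c => n; rewrite -rmorphB normc_conj. Qed.

End FastLimits.
Arguments hpow {R} n.

Section HilbertCompletion.
Variables (R : realType) (V : lmodType R[i]).

Record semiInnerForm := SemiInnerForm {
  si_form :> V -> V -> R[i] ;
  si_formP : semi_inner si_form
}.

Variable s : semiInnerForm.
Let sS := si_formP s.
Local Notation ns := (semi_norm s).
Implicit Types (x y : nat -> V) (l m : V -> R[i]) (u v w : V).

(** The dual norm of [l - s u] is at most [a]. Nonnegativity of [a] is stated separately because it
    does not follow when the seminorm vanishes identically. *)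
Definition near_form l u (a : R) :=
  0 <= a /\ forall v, normc (l v - s u v) <= a * ns v.

Definition approx l x := exists c, forall n, near_form l (x n) (c * hpow n).

Lemma near_form_dist l u v a b : near_form l u a -> near_form l v b ->
  ns (u - v) <= a + b.
Proof.
move=> [a0 la] [b0 lb]; set w := u - v.
have : ns w * ns w <= (a + b) * ns w.
  have -> : ns w * ns w = normc (s w w).
    by rewrite semi_innerxx //= expr0n addr0 sqrtr_sqr ger0_norm ?sqr_ge0.
  rewrite {1}/w semi_innerBl // mulrDl.
  have -> : s u w - s v w = (l w - s v w) - (l w - s u w) by ring.
  rewrite (le_trans (ler_normc_add _ _)) // normc_opp addrC lerD //.
have [->|w0] := eqVneq (ns w) 0; first by rewrite addr_ge0.
by rewrite ler_pM2r // lt_def w0 semi_norm_ge0.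
Qed.

Lemma approx_bounded l x : approx l x -> exists2 M, 0 <= M & forall n, ns (x n) <= M.
Proof.
move=> [c lx]; exists (ns (x 0) + (c + c)).
  by have [+ _] := lx 0; rewrite mulr1 => c0; rewrite !addr_ge0 // semi_norm_ge0.
move=> n; have := semi_normD sS (x n - x 0) (x 0); rewrite subrK.
have := near_form_dist (lx n) (lx 0); rewrite mulr1.
have [+ _] := lx 0; rewrite mulr1 => c0.
have : c * hpow n <= c by rewrite ler_piMr // hpow_le1.
by lra.
Qed.

Lemma approx_dist l x y : approx l x -> approx l y ->
  exists c, forall n, ns (x n - y n) <= c * hpow n.
Proof.
move=> [c lx] [d ly]; exists (c + d) => n; rewrite mulrDl.
exact: near_form_dist (lx n) (ly n).
Qed.

Lemma approx_cauchy l x : approx l x ->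
  exists c, forall n, ns (x n.+1 - x n) <= c * hpow n.
Proof.
move=> [c lx]; exists (2 * c) => n.
have := near_form_dist (lx n.+1) (lx n); have [c0 _] := lx n.+1.
by rewrite (hpowS _ n); move: c0; lra.
Qed.

Lemma si_form_dist u v u' v' :
  normc (s u v - s u' v') <= ns (u - u') * ns v + ns u' * ns (v - v').
Proof.
have -> : s u v - s u' v' = s (u - u') v + s u' (v - v').
  by rewrite semi_innerBl // semi_innerBr //; ring.
by rewrite (le_trans (ler_normc_add _ _)) // lerD // semi_inner_CS.
Qed.

Lemma fast_dist_si_form x y x' y' (M c d : R) :
  (forall n, ns (y n) <= M) -> (forall n, ns (x' n) <= M) ->
  (forall n, ns (x n - x' n) <= c * hpow n) ->
  (forall n, ns (y n - y' n) <= d * hpow n) ->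
  forall n, normc (s (x n) (y n) - s (x' n) (y' n)) <= M * (c + d) * hpow n.
Proof.
move=> yM x'M xx yy n; apply: (le_trans (si_form_dist _ _ _ _)).
have h1 : ns (x n - x' n) * ns (y n) <= c * hpow n * M.
  by rewrite ler_pM // semi_norm_ge0.
have h2 : ns (x' n) * ns (y n - y' n) <= M * (d * hpow n).
  by rewrite ler_pM // semi_norm_ge0.
by lra.
Qed.

Lemma fast_cvg_near (z z' : nat -> R[i]) (L : R[i]) (c : R) : fast_cvg z L ->
  (forall n, normc (z n - z' n) <= c * hpow n) -> fast_cvg z' L.
Proof.
move=> [d zL] zz; exists (d + c) => n.
have -> : L - z' n = (L - z n) + (z n - z' n) by ring.
by rewrite (le_trans (ler_normc_add _ _)) // mulrDl lerD.
Qed.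

Lemma approx_form_cvg l m x0 y0 : approx l x0 -> approx m y0 ->
  exists L, forall x y, approx l x -> approx m y ->
    fast_cvg (fun n => s (x n) (y n)) L.
Proof.
move=> lx0 my0.
have [M1 M10 xM] := approx_bounded lx0; have [M2 M20 yM] := approx_bounded my0.
have [c xc] := approx_cauchy lx0; have [d yd] := approx_cauchy my0.
have [n|L Ln] := @fast_cauchy_complex R (fun n => s (x0 n) (y0 n))
    ((M1 + M2) * (c + d)).
  apply: (@fast_dist_si_form (fun n => x0 n.+1) (fun n => y0 n.+1) x0 y0) => // k.
    by rewrite (le_trans (yM _)) // lerDr.
  by rewrite (le_trans (xM _)) // lerDl.
have {}Ln : fast_cvg (fun n => s (x0 n) (y0 n)) L.
  by exists (4 * ((M1 + M2) * (c + d))).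
exists L => x y lx my.
have [M3 M30 xM3] := approx_bounded lx.
have [c' xc'] := approx_dist lx0 lx; have [d' yd'] := approx_dist my0 my.
apply: fast_cvg_near Ln _ => n.
apply: (@fast_dist_si_form x0 y0 x y (M2 + M3) c' d') => // k.
  by rewrite (le_trans (yM _)) // lerDl.
by rewrite (le_trans (xM3 _)) // lerDr.
Qed.

(* The Hilbert space is realized as the space of those functionals on [V] which
   are limits, uniformly on the unit ball, of the functionals [s u]. *)
Record completion := Completion {
  cfun :> V -> R[i] ;
  cfunP : exists x, approx cfun x
}.

Implicit Types f g h : completion.

Lemma completion_eq f g : (forall v, f v = g v) -> f = g.
Proof.
case: f g => [f Pf] [g Pg] /= /funext fg; case: _ / fg Pg => Pg.
by congr Completion; exact: Prop_irrelevance.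
Qed.

HB.instance Definition _ := gen_eqMixin completion.
HB.instance Definition _ := gen_choiceMixin completion.

Lemma approx_cst u : approx (s u) (fun=> u).
Proof.
by exists 0 => n; split=> [|v]; rewrite mul0r // subrr normc0 mul0r.
Qed.

Lemma approxZD (k : R[i]) l m x y : approx l x -> approx m y ->
  approx (fun v => k * l v + m v) (fun n => k *: x n + y n).
Proof.
move=> [c lx] [d my]; exists (normc k * c + d) => n.
have [c0 cl] := lx n; have [d0 dl] := my n; split.
  by rewrite mulrDl -mulrA addr_ge0 // mulr_ge0 ?normc_ge0.
move=> v; rewrite (semi_innerl sS) opprD addrACA -mulrBr !mulrDl.
rewrite (le_trans (ler_normc_add _ _)) // lerD // normcM -!mulrA.
by rewrite ler_wpM2l ?normc_ge0 // mulrA.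
Qed.

Lemma completionZD_subproof (k : R[i]) f g :
  exists x, approx (fun v => k * f v + g v) x.
Proof.
have [[x fx] [y gy]] := (cfunP f, cfunP g).
by exists (fun n => k *: x n + y n); exact: approxZD.
Qed.

Lemma completion0_subproof : exists x, approx (fun=> 0) x.
Proof.
by exists (fun=> 0) => /=; have := approx_cst 0; rewrite (_ : s 0 = fun=> 0) //;
  apply/funext => v; rewrite semi_inner0l.
Qed.

Definition completionZD k f g := Completion (completionZD_subproof k f g).
Definition completion0 := Completion completion0_subproof.
Definition completionD f g := completionZD 1 f g.
Definition completionN f := completionZD (-1) f completion0.
Definition completionZ k f := completionZD k f completion0.

Fact completionDA : associative completionD.
Proof. by move=> f g h; apply: completion_eq => v /=; ring. Qed.
Fact completionDC : commutative completionD.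
Proof. by move=> f g; apply: completion_eq => v /=; ring. Qed.
Fact completion0D : left_id completion0 completionD.
Proof. by move=> f; apply: completion_eq => v /=; ring. Qed.
Fact completionND : left_inverse completion0 completionN completionD.
Proof. by move=> f; apply: completion_eq => v /=; ring. Qed.

HB.instance Definition _ :=
  GRing.isZmodule.Build completion completionDA completionDC completion0D completionND.

Fact completionZA (a b : R[i]) f :
  completionZ a (completionZ b f) = completionZ (a * b) f.
Proof. by apply: completion_eq => v /=; ring. Qed.
Fact completion1Z : left_id 1 completionZ.
Proof. by move=> f; apply: completion_eq => v /=; ring. Qed.
Fact completionZDr : right_distributive completionZ +%R.
Proof. by move=> a f g; apply: completion_eq => v /=; ring. Qed.
Fact completionZDl f : {morph completionZ^~ f : a b / a + b}.
Proof. by move=> a b; apply: completion_eq => v /=; ring. Qed.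

HB.instance Definition _ := GRing.Zmodule_isLmodule.Build R[i] completion
  completionZA completion1Z completionZDr completionZDl.

Lemma cfunD f g v : (f + g) v = f v + g v.
Proof. by rewrite /= mul1r. Qed.

Lemma cfunZ (k : R[i]) f v : (k *: f) v = k * f v.
Proof. by rewrite /= addr0. Qed.

Lemma cfunN f v : (- f) v = - f v.
Proof. by rewrite /= addr0 mulN1r. Qed.

Lemma cfunB f g v : (f - g) v = f v - g v.
Proof. by rewrite cfunD cfunN. Qed.

Lemma approx_lin (k : R[i]) f g x y : approx f x -> approx g y ->
  approx (k *: f + g) (fun n => k *: x n + y n).
Proof.
move=> fx gy; rewrite (_ : cfun _ = fun v => k * f v + g v); first exact: approxZD.
by apply/funext => v; rewrite cfunD cfunZ.
Qed.

(** Quantifying over all approximating sequences makes the value independent of choices. Such an [L]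
    exists by [approx_form_cvg], so [xget] never falls back on its default. *)
Definition cip f g : R[i] := xget 0 [set L | forall x y,
  approx f x -> approx g y -> fast_cvg (fun n => s (x n) (y n)) L].

Lemma cipP f g x y : approx f x -> approx g y ->
  fast_cvg (fun n => s (x n) (y n)) (cip f g).
Proof.
move=> fx gy; have [L LP] := approx_form_cvg fx gy.
have := @xgetI _ 0 [set L | forall x y, approx f x -> approx g y ->
  fast_cvg (fun n => s (x n) (y n)) L] L LP.
exact.
Qed.

Lemma cip_semi_inner : semi_inner cip.
Proof.
split=> [k f g h|f g|f].
- have [x fx] := cfunP f; have [y gy] := cfunP g; have [z hz] := cfunP h.
  apply: (fast_cvg_unique (cipP (approx_lin k fx gy) hz)).
  rewrite (_ : (fun n => _) = fun n => k * s (x n) (z n) + s (y n) (z n)).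
    by apply: fast_cvgD; [apply: fast_cvgZ|]; exact: cipP.
  by apply/funext => n; rewrite (semi_innerl sS).
- have [[x fx] [y gy]] := (cfunP f, cfunP g).
  apply: (fast_cvg_unique (cipP gy fx)).
  rewrite (_ : (fun n => _) = fun n => (s (x n) (y n))^*).
    by apply: fast_cvg_conj; exact: cipP.
  by apply/funext => n; rewrite (semi_inner_herm sS).
- have [x fx] := cfunP f; have [c fc] := cipP fx fx.
  have E n : s (x n) (x n) = ((ns (x n) ^+ 2)%:C)%C by exact: semi_innerxx.
  have Im0 : `|complex.Im (cip f f)| <= 0.
    apply: (@fast_le0 _ c) => n; apply: le_trans (fc n).
    by rewrite (le_trans _ (Im_le_normc _)) // E raddfB /= subr0.
  have Re0 : - complex.Re (cip f f) <= 0.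
    apply: (@fast_le0 _ c) => n; apply: le_trans (fc n).
    rewrite (le_trans _ (Re_le_normc _)) // E raddfB /=.
    have := ler_norm (- (complex.Re (cip f f) - ns (x n) ^+ 2)).
    by rewrite normrN; have := sqr_ge0 (ns (x n)); lra.
  by rewrite lecE /= -oppr_le0 Re0 andbT -normr_le0.
Qed.

End HilbertCompletion.

Section CompletionHilbert.
Variables (R : realType) (V : lmodType R[i]) (s : semiInnerForm V).
Local Notation H := (completion s).
Local Notation ns := (semi_norm s).
Let sS := si_formP s.
Let cS := cip_semi_inner s.
Implicit Types (f g h : H) (x y : nat -> V) (u v : V).

Definition cnorm f : R := semi_norm (@cip R V s) f.

Definition cemb u : H := Completion (ex_intro _ _ (approx_cst s u)).

(** The reproducing property: it turns evaluation of a functional into an inner product, so that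
    Cauchy-Schwarz bounds the values, and a vector orthogonal to the image of [V] is zero. *)
Lemma cip_emb f u : cip f (cemb u) = f u.
Proof.
have [x fx] := cfunP f.
apply: (fast_cvg_unique (cipP fx (approx_cst s u : approx s (cemb u) _))).
have [c fc] := fx; exists (c * ns u) => n.
by have [_ /(_ u)] := fc n; rewrite mulrAC.
Qed.

Lemma cnorm_emb u : cnorm (cemb u) = ns u.
Proof. by rewrite /cnorm /semi_norm cip_emb. Qed.

Lemma cembB u v : cemb (u - v) = cemb u - cemb v.
Proof. by apply: completion_eq => w; rewrite cfunB /= semi_innerBl. Qed.

Lemma cnorm_le f x (M c : R) : 0 <= M -> approx s f x ->
  (forall n, ns (x n) <= M + c * hpow n) -> cnorm f <= M.
Proof.
move=> M0 fx xM; have [d fd] := cipP fx fx.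
rewrite -(@ler_pXn2r _ 2) ?nnegrE ?semi_norm_ge0 // -subr_le0.
apply: (@fast_le0 _ (2 * M * `|c| + c ^+ 2 + d)) => n.
have h0 := hpow_gt0 R n; have h1 := hpow_le1 R n.
have := fd n; rewrite (semi_innerxx sS) (semi_innerxx cS) -/(cnorm f) => le1.
have {}le1 : `|cnorm f ^+ 2 - ns (x n) ^+ 2| <= d * hpow n.
  by move: le1; rewrite -rmorphB /= expr0n addr0 sqrtr_sqr.
have le2 : ns (x n) ^+ 2 <= (M + `|c| * hpow n) ^+ 2.
  have a0 : 0 <= M + `|c| * hpow n by rewrite addr_ge0 // mulr_ge0 // ltW.
  rewrite ler_pXn2r ?nnegrE ?semi_norm_ge0 //.
  by rewrite (le_trans (xM n)) // lerD2l ler_wpM2r ?ler_norm // ltW.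
have le3 : `|c| ^+ 2 * hpow n ^+ 2 <= c ^+ 2 * hpow n.
  rewrite real_normK ?num_real // ler_wpM2l ?sqr_ge0 //.
  by rewrite expr2 ler_piMr // ltW.
move: le1; rewrite ler_norml => /andP[_ le1].
by move: le2; rewrite sqrrD exprMn; lra.
Qed.

Lemma cnorm_near f u (a : R) : near_form s f u a -> cnorm (f - cemb u) <= a.
Proof.
move=> fu; have [a0 _] := fu; have [x [c fx]] := cfunP f.
apply: (@cnorm_le _ (fun n => (-1) *: u + x n) _ c) => //.
  rewrite addrC -scaleN1r; apply: approx_lin; first exact: approx_cst.
  by exists c.
move=> n; rewrite scaleN1r addrC addrC [- u + _]addrC.
by have := near_form_dist (fx n) fu; lra.
Qed.

Lemma cnorm_distC f g : cnorm (f - g) = cnorm (g - f).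
Proof. exact: semi_normB. Qed.

Lemma cnorm_dist_le f g h : cnorm (f - h) <= cnorm (f - g) + cnorm (g - h).
Proof. exact: semi_norm_le_add. Qed.

Lemma cnorm_eq0 f : cnorm f = 0 -> f = 0.
Proof.
move=> f0; apply: completion_eq => v; rewrite -cip_emb.
apply/eq0_normc/eqP; rewrite eq_le normc_ge0 andbT.
by rewrite (le_trans (semi_inner_CS cS _ _)) // -/(cnorm f) f0 mul0r.
Qed.

Definition hnorm f : R[i] := ((cnorm f)%:C)%C.

Fact hnormD f g : hnorm (f + g) <= hnorm f + hnorm g.
Proof. by rewrite /hnorm -rmorphD lecR semi_normD. Qed.

Fact hnormZ (k : R[i]) f : hnorm (k *: f) = `|k| * hnorm f.
Proof. by rewrite /hnorm /cnorm semi_normZ // rmorphM norm_normc. Qed.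

Fact hnorm_eq0 f : hnorm f = 0 -> f = 0.
Proof. by move=> /complexI; exact: cnorm_eq0. Qed.

HB.instance Definition _ := @Lmodule_isNormed.Build R[i] H hnorm
  hnormD hnormZ hnorm_eq0.

Lemma completion_normE f : `|f| = ((cnorm f)%:C)%C. Proof. by []. Qed.

(** A diagonal argument: balls of radius [hpow n] in the filter have centres [l n], near which there
    are vectors [x n] of [V]; the pointwise limit of the functionals [s (x n)] is the limit of the
    filter. *)
Fact completion_complete (F : set_system H) : ProperFilter F -> cauchy F -> cvg F.
Proof.
move=> FF Fc.
have /choice[l Fl] : forall n : nat, exists l : H, F (ball l ((hpow n : R)%:C)%C).
  move=> n; have /cauchyP Fe := Fc; apply: Fe.
  by rewrite ltcR hpow_gt0.
have lu n : exists u, cnorm (l n - cemb u) <= hpow n.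
  have [x [c lx]] := cfunP (l n); have [c0 _] := lx 0%N; move: c0.
  rewrite mulr1 => c0.
  have [k ck] := hpow_small c (hpow_gt0 R n).
  by exists (x k); apply: le_trans ck; exact: cnorm_near.
have [x lx] := choice lu.
have ll n : cnorm (l n.+1 - l n) <= hpow n.+1 + hpow n.
  have [f [f1 f0]] := filter_ex (filterI (Fl n.+1) (Fl n)).
  move: f1 f0; rewrite -!ball_normE /= !completion_normE !ltcR => f1 f0.
  by have := cnorm_dist_le (l n.+1) f (l n); rewrite (cnorm_distC f (l n)); lra.
have xx n : ns (x n.+1 - x n) <= 4 * hpow n.
  rewrite -cnorm_emb cembB.
  have := cnorm_dist_le (cemb (x n.+1)) (l n.+1) (cemb (x n)).
  have := cnorm_dist_le (l n.+1) (l n) (cemb (x n)).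
  rewrite (cnorm_distC _ (l n.+1)).
  have := ll n; have := lx n; have := lx n.+1; have := hpowS R n.
  by have := hpow_gt0 R n.+1; lra.
have xc v n : normc (s (x n.+1) v - s (x n) v) <= (4 * ns v) * hpow n.
  rewrite -semi_innerBl // (le_trans (semi_inner_CS sS _ _)) //.
  by have := ler_wpM2r (semi_norm_ge0 s v) (xx n); lra.
have /choice[L LP] v := fast_cauchy_complex (xc v).
(* [16] is the [4] of [fast_cauchy_complex] times the [4] in [xc]; one more [hpow n] is lost from
   [x n] to [l n], and one from [l n] to the filter. *)
have Lx : approx s L x.
  exists 16 => n; split; first by rewrite mulr_ge0 // ltW // hpow_gt0.
  by move=> v; rewrite (le_trans (LP v n)) //; lra.
pose f : H := Completion (ex_intro _ x Lx).
have fl n : cnorm (f - l n) <= 17 * hpow n.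
  have fx : cnorm (f - cemb (x n)) <= 16 * hpow n.
    apply: cnorm_near; split; first by rewrite mulr_ge0 // ltW // hpow_gt0.
    by move=> v; rewrite (le_trans (LP v n)) //; lra.
  have := cnorm_dist_le f (cemb (x n)) (l n); rewrite (cnorm_distC (cemb _) (l n)).
  by have := lx n; lra.
apply/cvg_ex; exists f; apply/cvgrPdist_le => e e0.
have [eR Re0] : e = ((complex.Re e)%:C)%C /\ 0 < complex.Re e.
  by move: e0; case: (e) => a b; rewrite ltcE /= => /andP[/eqP -> ?].
have [k ck] := hpow_small 18 Re0.
apply: filterS (Fl k) => g; rewrite -ball_normE /= completion_normE ltcR => gl.
rewrite eR completion_normE lecR.
have := cnorm_dist_le f (l k) g.
by have := fl k; lra.
Qed.

HB.instance Definition _ := Uniform_isComplete.Build H completion_complete.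

Let cipl g : linear_for *%R (fun f => cip f g).
Proof. by move=> k f h; rewrite (semi_innerl cS). Qed.

Let cipr f : linear_for (Num.conj \; *%R) (cip f).
Proof. by move=> k g h; rewrite semi_innerDr // semi_innerZr. Qed.

Let cip_bil : bilinear_for *%R (Num.conj \; *%R) (@cip R V s) := (cipl, cipr).

HB.instance Definition _ := bilinear_isBilinear.Build R[i] H H R[i]
  *%R (Num.conj \; *%R) (@cip R V s) cip_bil.

Let cip_herm f g : cip f g = (-1) ^+ false * Num.conj (cip g f).
Proof. by rewrite expr0 mul1r; exact: (semi_inner_herm cS). Qed.

HB.instance Definition _ := isHermitianSesquilinear.Build R[i] H false Num.conj
  (@cip R V s) cip_herm.

Let cip_gt0 f : f != 0 -> 0 < cip f f.
Proof.
move=> f0; rewrite lt_def (semi_inner_ge0 cS) andbT.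
apply: contraNneq f0 => ff0; apply/eqP/cnorm_eq0.
by rewrite /cnorm /semi_norm ff0 sqrtr0.
Qed.

HB.instance Definition _ := isDotProduct.Build R[i] H (@cip R V s) cip_gt0.

Fact cip_norm f : (@cip R V s : {dot H for Num.conj}) f f = `|f| ^+ 2.
Proof. by rewrite completion_normE -rmorphXn; exact: (semi_innerxx cS). Qed.

HB.instance Definition _ := CompleteNormedModule_isHilbert.Build R H cip_norm.

End CompletionHilbert.

(** * Real-valued norms on complete normed modules *)

Section Normed.
Variables (R : realType) (E : completeNormedModType R[i]).
Implicit Types u v : E.

Definition rnorm u : R := complex.Re `|u|.

Lemma rnormE u : `|u| = ((rnorm u)%:C)%C.
Proof. by rewrite RRe_real // ger0_real. Qed.

Lemma rnorm_ge0 u : 0 <= rnorm u.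
Proof. by rewrite -ler0c -rnormE. Qed.

Lemma rnormD u v : rnorm (u + v) <= rnorm u + rnorm v.
Proof. by rewrite -lecR rmorphD /= -!rnormE ler_normD. Qed.

Lemma rnormZ (k : R[i]) u : rnorm (k *: u) = complex.Re `|k| * rnorm u.
Proof. by apply: complexI; rewrite -rnormE normrZ rnormE rmorphM norm_normc. Qed.

Lemma rnormN u : rnorm (- u) = rnorm u.
Proof. by rewrite /rnorm normrN. Qed.

Lemma rnorm_dist_le u v w : rnorm (u - w) <= rnorm (u - v) + rnorm (v - w).
Proof. by rewrite -{1}(subrK v u) -addrA rnormD. Qed.

Lemma rnorm_distC u v : rnorm (u - v) = rnorm (v - u).
Proof. by rewrite /rnorm distrC. Qed.

Lemma complex_gt0 (e : R[i]) : 0 < e -> e = ((complex.Re e)%:C)%C /\ 0 < complex.Re e.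
Proof. by case: e => a b; rewrite ltcE /= => /andP[/eqP -> ?]. Qed.

Lemma geometric_cauchy_cvg (u : nat -> E) (c q : R) : 0 <= q < 1 ->
  (forall n, rnorm (u n.+1 - u n) <= c * q ^+ n) ->
  exists l, u @ \oo --> l /\ forall n, rnorm (l - u n) <= c / (1 - q) * q ^+ n.
Proof.
move=> q01 uc; have /andP[q0 q1] := q01.
have cE : c = c / (1 - q) * (1 - q) by rewrite divfK // subr_eq0 gt_eqF.
move: (c / (1 - q)) cE => C cE.
have q10 : 0 < 1 - q by rewrite subr_gt0.
have C0 : 0 <= C.
  rewrite -(pmulr_lge0 _ q10) -cE.
  by have := le_trans (rnorm_ge0 _) (uc 0); rewrite mulr1.
have dec n m : (n <= m)%N -> rnorm (u m - u n) <= C * (q ^+ n - q ^+ m).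
  move=> /subnK <-; elim: (m - n)%N => [|k IHk].
    by rewrite !subrr mulr0 /rnorm normr0.
  have := rnorm_dist_le (u (k.+1 + n)) (u (k + n)) (u n).
  have := uc (k + n)%N; rewrite addSn exprS cE; move: IHk.
  by move: (q ^+ (k + n)) => w; lra.
have decn n m : (n <= m)%N -> rnorm (u m - u n) <= C * q ^+ n.
  move=> /dec /le_trans; apply; rewrite ler_wpM2l // lerBlDr lerDl.
  exact: exprn_ge0.
have uC : cauchy (u @ \oo).
  apply/cauchyP => e e0; have [eE re0] := complex_gt0 e0.
  have [n ne] := geometric_small C q01 (divr_gt0 re0 (ltr0n R 2)).
  exists (u n); suff : \forall m \near \oo, ball (u n) e (u m) by [].
  near=> m; rewrite -ball_normE /= rnormE eE ltcR rnorm_distC.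
  have nm : (n <= m)%N by near: m; exact: nbhs_infty_ge.
  apply: (le_lt_trans (decn n m nm)).
  by apply: (le_lt_trans ne); rewrite ltr_pdivrMr // ltr_pMr // ltr1n.
have /cvg_ex[l ul] : cvg (u @ \oo) by exact: cauchy_cvg.
exists l; split=> // n; apply/ler_addgt0Pr => e e0.
have e0c : 0 < (e%:C)%C :> R[i] by rewrite ltcR.
have : \forall m \near \oo, rnorm (l - u m) < e /\ (n <= m)%N.
  near=> m; split; last by near: m; exact: nbhs_infty_ge.
  rewrite -ltcR -rnormE; near: m.
  by move/cvgrPdist_lt : ul; exact.
move=> /filter_ex[m [lm nm]].
by have := rnorm_dist_le l (u m) (u n); have := decn n m nm; lra.
Unshelve. all: by end_near. Qed.

Lemma bounded_linear_continuous (T : E -> E) (c : R) : linear T -> 0 <= c ->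
  (forall u, rnorm (T u) <= c * rnorm u) -> continuous T.
Proof.
move=> TL c0 Tc f; apply/cvgrPdist_le => e e0; have [eE re0] := complex_gt0 e0.
have c1 : 0 < c + 1 by rewrite ltr_wpDl.
have d0 : 0 < ((complex.Re e / (c + 1))%:C)%C :> R[i] by rewrite ltcR divr_gt0.
near=> g; have : `|f - g| <= ((complex.Re e / (c + 1))%:C)%C.
  by near: g; apply: cvgr_dist_le => //; exact: cvg_id.
rewrite !rnormE lecR eE lecR => fg.
have -> : T f - T g = T (f - g).
  have := TL (-1) g f; rewrite !scaleN1r [- g + _]addrC => ->.
  by rewrite addrC.
apply: (le_trans (Tc _)); apply: (@le_trans _ _ ((c + 1) * rnorm (f - g))).
  by rewrite ler_wpM2r ?rnorm_ge0 // lerDl.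
by rewrite mulrC -ler_pdivlMr.
Unshelve. all: by end_near. Qed.

End Normed.

(** * Orthogonal projection onto a closed subspace *)

Section Projection.
Variables (R : realType) (H : hilbertType R).
Implicit Types u v w : H.

Lemma inner_semi_inner : semi_inner (inner : H -> H -> R[i]).
Proof.
split.
- by move=> k x y z; rewrite linearPl.
- by move=> x y; have := hermC (inner : {dot H for Num.conj}) y x;
    rewrite expr0 mul1r.
- by move=> x; rewrite innerE exprn_ge0.
Qed.
Let iS := inner_semi_inner.

Lemma parallelogram u v :
  rnorm (u + v) ^+ 2 + rnorm (u - v) ^+ 2 = 2 * rnorm u ^+ 2 + 2 * rnorm v ^+ 2.
Proof.
apply: complexI; rewrite !mulr_natl !mulr2n !rmorphD !rmorphXn /= -!rnormE -!innerE.
rewrite (semi_innerBl iS) !(semi_innerBr iS) (semi_innerDl iS) !(semi_innerDr iS).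
by ring.
Qed.

Lemma orthogonal_decomposition (W : set H) u : linear_subspace W -> closed W ->
  exists2 v, W v & forall w, W w -> inner w (u - v) = 0.
Proof.
move=> [W0 WL] Wc.
have WD x y : W x -> W y -> W (x + y).
  by move=> Wx Wy; rewrite -[x]scale1r; exact: WL.
have WZ (k : R[i]) x : W x -> W (k *: x).
  by move=> Wx; rewrite -[_ *: _]addr0; exact: WL.
pose S := [set rnorm (u - w) ^+ 2 | w in W].
have Slb : lbound S 0 by move=> _ [w _ <-]; exact: sqr_ge0.
have Sinf : has_inf S by split; [exists (rnorm (u - 0) ^+ 2), 0|exists 0].
pose d := inf S; have dle w : W w -> d <= rnorm (u - w) ^+ 2.
  by move=> Ww; apply: ge_inf; [exists 0|exists w].
(* With an excess of [hpow n ^ 2] over the infimum, the parallelogram law bounds the increments by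
   [2 hpow n]. *)
have /choice[x xP] n : exists w, W w /\ rnorm (u - w) ^+ 2 < d + hpow n ^+ 2.
  have hn : 0 < hpow n ^+ 2 :> R by rewrite exprn_gt0 // hpow_gt0.
  by have [_ [w Ww <-] ?] := inf_adherent hn Sinf; exists w.
have xx n : rnorm (x n.+1 - x n) <= 2 * hpow n.
  have [Wn un] := xP n; have [Wn1 un1] := xP n.+1.
  rewrite -(@ler_pXn2r _ 2) ?nnegrE ?rnorm_ge0 ?mulr_ge0 ?(ltW (hpow_gt0 _ _)) //.
  have := parallelogram (u - x n) (u - x n.+1).
  have -> : u - x n - (u - x n.+1) = x n.+1 - x n.
    by rewrite opprB addrC addrA subrK.
  have -> : u - x n + (u - x n.+1) = 2%:R *: (u - 2%:R^-1 *: (x n + x n.+1)).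
    rewrite scalerBr scalerA divff ?pnatr_eq0 // scale1r scaler_nat mulr2n.
    by rewrite opprD addrACA.
  rewrite rnormZ ger0_norm // (_ : complex.Re 2%:R = 2); last first.
    by rewrite -(rmorph_nat (real_complex R)).
  have := dle (2%:R^-1 *: (x n + x n.+1)) (WZ _ _ (WD _ _ Wn Wn1)).
  rewrite exprMn; have hh := hpowS R n; have h0 := hpow_gt0 R n.+1.
  have h2 : hpow n.+1 ^+ 2 <= hpow n ^+ 2 :> R.
    by rewrite ler_pXn2r ?nnegrE ?(ltW (hpow_gt0 _ _)) // hh lerDl ltW.
  by lra.
have [v [xv vx]] := geometric_cauchy_cvg (half01 R) xx.
have c4 : 2 / (1 - 1 / 2) = 4 :> R by field.
rewrite c4 in vx.
have Wv : W v.
  by apply: (closed_cvg _ Wc _ _ xv); apply: nearW => n; have [] := xP n.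
have vd w : W w -> rnorm (u - v) ^+ 2 <= rnorm (u - w) ^+ 2.
  move=> /dle; apply: le_trans.
  have ule : rnorm (u - v) <= Num.sqrt d.
    rewrite -subr_le0; apply: (@fast_le0 _ 5) => n.
    have [_ un] := xP n; have hn := hpow_gt0 R n.
    have d0 : 0 <= d by apply: lb_le_inf => //; case: Sinf.
    have un' : rnorm (u - x n) <= Num.sqrt d + hpow n.
      rewrite -(@ler_pXn2r _ 2) ?nnegrE ?rnorm_ge0 ?addr_ge0 ?sqrtr_ge0 ?(ltW hn) //.
      rewrite sqrrD sqr_sqrtr //.
      have : 0 <= Num.sqrt d * hpow n by rewrite mulr_ge0 ?sqrtr_ge0 // ltW.
      by rewrite -mulr_natr; move: un; lra.
    have := rnorm_dist_le u (x n) v; rewrite (rnorm_distC (x n)).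
    by have := vx n; rewrite -/(hpow n); lra.
  have d0 : 0 <= d by apply: lb_le_inf => //; case: Sinf.
  by rewrite -[leRHS](sqr_sqrtr d0) ler_pXn2r ?nnegrE ?rnorm_ge0 ?sqrtr_ge0.
exists v => // w Ww; set z := u - v.
have zle x' : W x' -> rnorm z ^+ 2 <= rnorm (z - x') ^+ 2.
  by move=> /(WD _ _ Wv)/vd; rewrite opprD addrA.
clearbody z.
set c := inner w z; set p := normc c.
have p0 : 0 <= p by exact: normc_ge0.
have zc : inner z w = c^* by rewrite (semi_inner_herm iS).
have cc : c * c^* = ((p ^+ 2)%:C)%C by rewrite -normCK norm_normc rmorphXn.
have ww : inner w w = ((rnorm w ^+ 2)%:C)%C by rewrite innerE rnormE rmorphXn.
(* Minimality of [z] against [z - t c^* w]. The value of [t] used below has [+ 1] in the denominator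
   so that [w = 0] is covered. *)
have quad (t : R) : 0 <= - (2 * t * p ^+ 2) + t ^+ 2 * p ^+ 2 * rnorm w ^+ 2.
  set k : R[i] := (t%:C)%C * c^*.
  have kE : k^* = (t%:C)%C * c.
    rewrite /k rmorphM /= conjCK; congr (_ * _).
    by apply: conj_Creal; apply/complex_realP; exists t.
  have := zle (k *: w) (WZ _ _ Ww).
  rewrite -subr_ge0 -ler0c rmorphB !rmorphXn /= -!rnormE -!innerE.
  rewrite (semi_innerBl iS) !(semi_innerBr iS) !(semi_innerZl iS) !(semi_innerZr iS).
  rewrite zc -/c kE ww.
  rewrite [X in 0 <= X](_ : _ =
      ((- (2 * t * p ^+ 2) + t ^+ 2 * p ^+ 2 * rnorm w ^+ 2)%:C)%C).
    by rewrite ler0c.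
  have -> : ((- (2 * t * p ^+ 2) + t ^+ 2 * p ^+ 2 * rnorm w ^+ 2)%:C)%C =
    (- (t%:C * (p ^+ 2)%:C + t%:C * (p ^+ 2)%:C) +
     t%:C * t%:C * (p ^+ 2)%:C * (rnorm w ^+ 2)%:C)%C :> R[i].
    by rewrite -!(rmorphD, rmorphN, rmorphM) /=; congr (_%:C)%C; ring.
  by rewrite -cc /k; ring.
have w0 := sqr_ge0 (rnorm w).
have W1 : 0 < rnorm w ^+ 2 + 1 by rewrite ltr_wpDl.
have := quad (rnorm w ^+ 2 + 1)^-1.
have -> : - (2 * (rnorm w ^+ 2 + 1)^-1 * p ^+ 2) +
    (rnorm w ^+ 2 + 1)^-1 ^+ 2 * p ^+ 2 * rnorm w ^+ 2 =
    - (p ^+ 2 * ((rnorm w ^+ 2 + 2) / (rnorm w ^+ 2 + 1) ^+ 2)).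
  by field; rewrite gt_eqF.
rewrite oppr_ge0 pmulr_lle0; last first.
  by rewrite divr_gt0 ?exprn_gt0 // ltr_wpDl.
move=> p20; apply: eq0_normc; apply/eqP; rewrite -/p -sqrf_eq0 eq_le p20.
exact: sqr_ge0.
Qed.

End Projection.

(** * Extension of adjointable operators to the completion *)

Section Adjointable.
Variables (R : realType) (V : lmodType R[i]) (s : semiInnerForm V).
Local Notation H := (completion s).
Local Notation ns := (semi_norm s).
Let sS := si_formP s.

Definition bounded_op (T : V -> V) := exists2 c, 0 <= c & forall v, ns (T v) <= c * ns v.

Definition adjoint_ops (T T' : V -> V) := forall u v, s (T u) v = s u (T' v).

Variables (T T' : V -> V).
Hypotheses (TT' : adjoint_ops T T') (T'b : bounded_op T').

Lemma approx_comp (l : V -> R[i]) x : approx s l x ->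
  approx s (fun v => l (T' v)) (fun n => T (x n)).
Proof.
move=> [c lx]; have [d d0 T'd] := T'b; exists (c * d) => n; have [c0 cn] := lx n.
split; first by rewrite mulrAC mulr_ge0.
move=> v; rewrite TT' (le_trans (cn _)) //.
by have := ler_wpM2l c0 (T'd v); lra.
Qed.

Lemma clift_subproof (f : H) : exists x, approx s (fun v => f (T' v)) x.
Proof. by have [x fx] := cfunP f; exists (fun n => T (x n)); exact: approx_comp. Qed.

(** A functional [f] stands for the inner product with a vector, so extending [T] means precomposing
    [f] with the adjoint [T']; boundedness of [T'] keeps the result in the completion. *)
Definition clift (f : H) : H := Completion (clift_subproof f).

Lemma clift_linear : linear clift.
Proof.
by move=> k f g; apply: completion_eq => v; rewrite cfunD cfunZ
  -[LHS]/((k *: f + g) (T' v)) cfunD cfunZ.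
Qed.

Lemma clift_cnorm (c : R) (f : H) : 0 <= c -> (forall v, ns (T' v) <= c * ns v) ->
  cnorm (clift f) <= c * cnorm f.
Proof.
move=> c0 T'c.
have fc : near_form s (clift f) 0 (c * cnorm f).
  split; first by rewrite mulr_ge0 // semi_norm_ge0.
  move=> v; rewrite semi_inner0l // subr0 /= -cip_emb.
  rewrite (le_trans (semi_inner_CS (cip_semi_inner s) _ _)) //.
  rewrite -!/(cnorm _) cnorm_emb.
  by have := ler_wpM2l (semi_norm_ge0 _ f : 0 <= cnorm f) (T'c v); lra.
have := cnorm_near fc; rewrite (_ : cemb s 0 = 0) ?subr0 //.
by apply: completion_eq => v; rewrite /= semi_inner0l.
Qed.

End Adjointable.

Lemma cip_clift (R : realType) (V : lmodType R[i]) (s : semiInnerForm V)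
    (T T' : V -> V) (TT' : adjoint_ops s T T') (T'T : adjoint_ops s T' T)
    (Tb : bounded_op s T) (T'b : bounded_op s T') (f g : completion s) :
  inner (clift TT' T'b f) g = inner f (clift T'T Tb g).
Proof.
have [x fx] := cfunP f; have [y gy] := cfunP g.
have fx' : approx s (clift TT' T'b f) (fun n => T (x n)) by exact: approx_comp.
have gy' : approx s (clift T'T Tb g) (fun n => T' (y n)) by exact: approx_comp.
apply: (fast_cvg_unique (cipP fx' gy)).
rewrite (_ : (fun n => _) = fun n => s (x n) (T' (y n))); first exact: cipP.
by apply/funext => n; rewrite TT'.
Qed.

(** * The GNS representation of a pure state *)

(** An alias that carries the real scalar action, so that the theory of order unit spaces applies to
    a complex algebra. *)
Definition realified (R : realType) (V : lmodType R[i]) : Type := V.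

Section Realified.
Variables (R : realType) (V : lmodType R[i]).
Local Notation W := (realified V).

HB.instance Definition _ := GRing.Zmodule.copy W V.

Definition real_scale (r : R) (v : W) : W := (r%:C)%C *: (v : V).

Fact real_scaleA (a b : R) v : real_scale a (real_scale b v) = real_scale (a * b) v.
Proof. by rewrite /real_scale scalerA rmorphM. Qed.
Fact real_scale1 : left_id 1 real_scale.
Proof. by move=> v; rewrite /real_scale rmorph1 scale1r. Qed.
Fact real_scaleDr : right_distributive real_scale +%R.
Proof. by move=> a u v; rewrite /real_scale scalerDr. Qed.
Fact real_scaleDl v : {morph real_scale^~ v : a b / a + b}.
Proof. by move=> a b; rewrite /real_scale rmorphD scalerDl. Qed.

HB.instance Definition _ := GRing.Zmodule_isLmodule.Build R W
  real_scaleA real_scale1 real_scaleDr real_scaleDl.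

Lemma realified_scaleE (r : R) (v : W) : r *: v = (r%:C)%C *: (v : V) :> V.
Proof. by []. Qed.

End Realified.

Section GNS.
Variables (R : realType) (B : algType R[i]) (st : B -> B) (N : B -> R).
Hypothesis BN : cstar_norm st N.
Variable J : set B.
Hypothesis JI : nrm_closed_ideal st N J.
Local Notation K := (ideal_cone st J : set (realified B)).
Implicit Types (x y z b : B).

Lemma ideal_cone_st_mul x : K (st x * x).
Proof.
exists [:: x], 0, 0; split; first exact: (nci0 JI).
by rewrite big_seq1 (st0 BN) subrr !addr0.
Qed.

Lemma ideal_cone_skew z : K (z - st z).
Proof.
by exists [::], 0, z; split; [exact: (nci0 JI)|rewrite big_nil !add0r].
Qed.

Lemma ideal_cone_ideal j : J j -> K j.
Proof.
by move=> Jj; exists [::], j, 0; split; rewrite // big_nil (st0 BN) subrr addr0 add0r.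
Qed.

Lemma cone_ideal_cone : cone K.
Proof.
split; first by apply: ideal_cone_ideal; exact: (nci0 JI).
- move=> _ _ [s [j [z [Jj ->]]]] [t [i [w [Ji ->]]]].
  exists (s ++ t), (j + i), (z + w); split; first exact: (nci_add JI).
  rewrite big_cat /= (st_add BN); set S := \sum_(x <- s) _; set T := \sum_(x <- t) _.
  rewrite -[LHS]/((S + j + (z - st z) + (T + i + (w - st w))) : B).
  by ncring.
- move=> r _ r0 [s [j [z [Jj ->]]]]; rewrite realified_scaleE -scE.
  have rr : r = Num.sqrt r * Num.sqrt r by rewrite -expr2 sqr_sqrtr.
  exists [seq sc B (Num.sqrt r) * x | x <- s], (sc B r * j), (sc B r * z).
  split; first exact: (nci_mull JI).
  rewrite !mulrDr big_map mulr_sumr; congr (_ + _ + (_ + _)).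
    apply: eq_bigr => x _; rewrite (st_mul BN) (st_sc BN) scC {1}rr scM -!mulrA.
    by congr (_ * _); rewrite (mulrA (st x)) scC -mulrA.
  by rewrite (st_mul BN) (st_sc BN) scC mulrN.
Qed.

(** [N h - h] is positive, and the slack [t - N h] is the shift after which [psd_sqrt] gives an
    exact square root. *)
Lemma ideal_cone_psd h t : st h = h -> N h < t -> K (sc B t - h).
Proof.
move=> sh ht; have hp := psd_nrm_le BN sh (lexx (N h)).
have d0 : 0 < t - N h by rewrite subr_gt0.
have [k [sk _ kk _]] := psd_sqrt BN hp d0.
have -> : sc B t - h = st k * k; last exact: ideal_cone_st_mul.
by rewrite sk kk scB; ncring.
Qed.

Lemma order_unit_ideal_cone : order_unit K (1 : B).
Proof.
split; first by rewrite -[X in K X]mulr1 -{1}(st1 BN); exact: ideal_cone_st_mul.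
move=> b; pose h := sc B (1 / 2) * (b + st b).
have sh : st h = h.
  by rewrite (st_mul BN) (st_sc BN) scC (st_add BN) (st_inv BN) addrC.
exists (N h + 1).
(* [b] differs from its hermitian part [h] by a skew-adjoint element, which the cone absorbs. *)
have -> : ((N h + 1) *: (1 : realified B) - b : realified B) =
    ((sc B (N h + 1) - h) + (sc B (1 / 2) * st b - st (sc B (1 / 2) * st b))) :> B.
  rewrite (st_mul BN) (st_sc BN) scC (st_inv BN).
  rewrite -[LHS]/(sc B (N h + 1) - (b : B)) -mulrBr.
  have -> : sc B (1 / 2) * (st b - b) = h - b.
    transitivity (sc B (1 / 2) * (b + st b) - sc B (1 / 2) * (b + b)).
      by rewrite -mulrBr; congr (_ * _); ncring.
    by rewrite sc_half.
  by rewrite addrA subrK.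
have [_ KD _] := cone_ideal_cone.
by apply: KD; [apply: ideal_cone_psd => //; rewrite ltrDl|exact: ideal_cone_skew].
Qed.

Variable f : realified B -> R.
Hypotheses (fS : scalar f) (fK : positive_on K f).

Lemma pos_functional_st x : f (st x) = f x.
Proof.
apply/eqP; rewrite eq_le -!(subr_ge0 (f _)) -!(scalarB _ _ fS).
have := fK (ideal_cone_skew (st x)); rewrite (st_inv BN) => ->.
by rewrite (fK (ideal_cone_skew x)).
Qed.

Lemma pos_functional_ideal j : J j -> f j = 0.
Proof.
move=> Jj; apply/eqP; rewrite eq_le (fK (ideal_cone_ideal Jj)) andbT.
rewrite -oppr_ge0 -(scalarN _ fS).
have Jn : J (- j) by rewrite -mulN1r; exact: (nci_mull JI).
exact: (fK (ideal_cone_ideal Jn)).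
Qed.

(** The complex-linear functional with real part [f]. *)
Definition complexify x : R[i] := (f x -i* f ('i *: x))%C.

Lemma complexifyD x y : complexify (x + y) = complexify x + complexify y.
Proof.
by rewrite /complexify scalerDr !(scalarD _ _ fS) opprD.
Qed.

Lemma complexifyZ (k : R[i]) x : complexify (k *: x) = k * complexify x.
Proof.
have fr (r : R) (z : B) : f ((r%:C)%C *: z) = r * f z.
  by rewrite -[X in f X]realified_scaleE (scalarM _ _ fS).
have cr (r : R) (z : B) : complexify ((r%:C)%C *: z) = (r%:C)%C * complexify z.
  have ir : 'i *: ((r%:C)%C *: z) = (r%:C)%C *: ('i *: z).
    by rewrite !scalerA mulrC.
  rewrite /complexify ir !fr.
  by apply/eqP; rewrite eq_complex /=; apply/andP; split; apply/eqP; ring.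
have ci (z : B) : complexify ('i *: z) = 'i * complexify z.
  rewrite /complexify scalerA -expr2 sqrCi scaleN1r (scalarN _ fS) -complexiE.
  by apply/eqP; rewrite eq_complex /=; apply/andP; split; apply/eqP; ring.
by rewrite [k]complexE complexiE scalerDl -scalerA complexifyD ci !cr mulrDl mulrA.
Qed.

Lemma complexify_st x : complexify (st x) = (complexify x)^*.
Proof.
rewrite /complexify pos_functional_st.
have -> : f ('i *: st x) = - f ('i *: x).
  rewrite -(pos_functional_st ('i *: x)) (st_scale BN) conjCi scaleNr.
  by rewrite (scalarN _ fS) opprK.
by [].
Qed.

Lemma complexify_ge0 x : 0 <= complexify (st x * x).
Proof.
rewrite lecE /= (fK (ideal_cone_st_mul x)) andbT oppr_eq0.
have := pos_functional_st ('i *: (st x * x)).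
rewrite (st_scale BN) conjCi scaleNr (scalarN _ fS) (st_mul BN) (st_inv BN).
by move=> E; apply/eqP; move: E; lra.
Qed.

Definition gns_form x y : R[i] := complexify (st y * x).

Lemma gns_semi_inner : semi_inner gns_form.
Proof.
split=> [k x y z|x y|x]; rewrite /gns_form.
- by rewrite mulrDr complexifyD -scalerAr complexifyZ.
- by rewrite -complexify_st (st_mul BN) (st_inv BN).
- exact: complexify_ge0.
Qed.

Definition gns := SemiInnerForm gns_semi_inner.

Lemma gns_adjoint b : adjoint_ops gns ( *%R b) ( *%R (st b)).
Proof. by move=> x y; rewrite /= /gns_form (st_mul BN) (st_inv BN) mulrA. Qed.

Lemma gns_adjoint_st b : adjoint_ops gns ( *%R (st b)) ( *%R b).
Proof. by have := gns_adjoint (st b); rewrite (st_inv BN). Qed.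

(** The map sending [v] to [x^* v x] preserves the cone. Applied to [t - b^* b] with [t] slightly
    above [N b ^ 2], it bounds [f (x^* b^* b x)] by [t f (x^* x)]. *)
Lemma gns_norm_mul b x : semi_norm gns (b * x) <= N b * semi_norm gns x.
Proof.
have ns2 y : semi_norm gns y ^+ 2 = f (st y * y).
  by rewrite sqr_sqrtr // Re_semi_inner_ge0 //; exact: gns_semi_inner.
have Nb := nrm_ge0 BN b.
rewrite -(@ler_pXn2r _ 2) ?nnegrE ?mulr_ge0 ?sqrtr_ge0 //.
rewrite exprMn !ns2; apply/ler_addgt0Pr => e e0.
pose t := N b ^+ 2 + e / (f (st x * x) + 1).
have fx : 0 <= f (st x * x) by rewrite -ns2 sqr_ge0.
have fx1 : 0 < f (st x * x) + 1 by rewrite ltr_wpDl.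
have d0 : 0 < e / (f (st x * x) + 1) by rewrite divr_gt0.
have := @ideal_cone_psd (st b * b) t.
rewrite (st_mul BN) (st_inv BN) (nrm_st_mul BN) ltrDl => /(_ erefl d0).
move=> [s [j [z [Jj E]]]].
have bt : f (st x * (st b * b) * x) <= t * f (st x * x).
  rewrite -subr_ge0 -(scalarM _ _ fS) -(scalarB _ _ fS).
  have -> : (t *: (st x * x : realified B) - st x * (st b * b) * x : realified B) =
      st x * (sc B t - st b * b) * x :> B.
    rewrite realified_scaleE -scE mulrBr mulrBl; congr (_ - _).
    by rewrite scC mulrA.
  rewrite E; apply: fK.
  exists [seq y * x | y <- s], (st x * j * x), (st x * z * x); split.
    by apply: (nci_mulr JI); exact: (nci_mull JI).
  have -> : \sum_(x0 <- [seq y * x | y <- s]) st x0 * x0 =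
      st x * (\sum_(y <- s) st y * y) * x.
    rewrite big_map mulr_sumr mulr_suml; apply: eq_bigr => y _.
    by rewrite (st_mul BN) !mulrA.
  by rewrite !(st_mul BN) (st_inv BN); ncring.
rewrite (st_mul BN) mulrA -[X in X * x]mulrA (le_trans bt) // mulrDl lerD2l.
by rewrite mulrAC ler_pdivrMr // ler_wpM2l ?(ltW e0) // lerDl.
Qed.

Lemma gns_bounded b : bounded_op gns ( *%R b).
Proof. by exists (N b); [exact: (nrm_ge0 BN)|exact: gns_norm_mul]. Qed.

Local Notation H := (completion gns).

Definition gns_rep b : H -> H := clift (gns_adjoint b) (gns_bounded (st b)).

Lemma gns_repE b (g : H) v : gns_rep b g v = g (st b * v).
Proof. by []. Qed.

Definition gns_vec : H := cemb gns 1.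

Lemma gns_rep_linear b : linear (gns_rep b). Proof. exact: clift_linear. Qed.

Lemma cfun_lin (g : H) (k : R[i]) u v : g (k *: u + v) = k^* * g u + g v.
Proof.
have cS := cip_semi_inner gns.
rewrite -!cip_emb.
have -> : cemb gns (k *: u + v) = k *: cemb gns u + cemb gns v.
  apply: completion_eq => w; rewrite cfunD cfunZ /=.
  exact: (semi_innerl gns_semi_inner).
by rewrite (semi_innerDr cS) (semi_innerZr cS).
Qed.

Lemma gns_repD a b (g : H) : gns_rep (a + b) g = gns_rep a g + gns_rep b g.
Proof.
apply: completion_eq => v; rewrite cfunD !gns_repE (st_add BN) mulrDl.
by rewrite -[st a * v]scale1r cfun_lin conjC1 mul1r scale1r.
Qed.

Lemma gns_repZ (k : R[i]) a (g : H) : gns_rep (k *: a) g = k *: gns_rep a g.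
Proof.
apply: completion_eq => v; rewrite cfunZ !gns_repE (st_scale BN) -scalerAl.
have g0 : g 0 = 0.
  by have := cfun_lin g (-1) 0 0; rewrite scaler0 addr0 rmorphN1 mulN1r addNr.
by rewrite -[_ *: _]addr0 cfun_lin conjCK g0 addr0.
Qed.

Lemma gns_repM a b (g : H) : gns_rep (a * b) g = gns_rep a (gns_rep b g).
Proof. by apply: completion_eq => v; rewrite !gns_repE (st_mul BN) mulrA. Qed.

Lemma gns_rep_adj a (g h : H) : inner (gns_rep a g) h = inner g (gns_rep (st a) h).
Proof.
have -> : gns_rep (st a) h = clift (gns_adjoint_st a) (gns_bounded a) h.
  by apply: completion_eq => v; rewrite gns_repE (st_inv BN).
exact: cip_clift.
Qed.

Lemma gns_rep1 (g : H) : gns_rep 1 g = g.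
Proof. by apply: completion_eq => v; rewrite gns_repE (st1 BN) mul1r. Qed.

Lemma gns_rep_norm b (g : H) : rnorm (gns_rep b g) <= N b * rnorm g.
Proof.
apply: clift_cnorm; first exact: (nrm_ge0 BN).
by move=> v; rewrite -(Nst BN b); exact: gns_norm_mul.
Qed.

Lemma gns_rep_vec b : gns_rep b gns_vec = cemb gns b.
Proof.
by apply: completion_eq => v; rewrite gns_repE /= /gns_form !(st_mul BN) mulr1
  (st_inv BN).
Qed.

(** Since [f] vanishes on [J], the vector [j^* v] has seminorm zero, and every functional of the
    completion vanishes on it. *)
Lemma gns_rep_ideal j (g : H) : J j -> gns_rep j g = 0.
Proof.
move=> Jj; apply: completion_eq => v; rewrite gns_repE.
have -> : (0 : H) v = 0 by [].
have e0 : semi_norm gns (st j * v) = 0.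
  rewrite /semi_norm /= pos_functional_ideal ?sqrtr0 //.
  rewrite (st_mul BN) (st_inv BN); apply: (nci_mulr JI); apply: (nci_mull JI) => //.
have := semi_inner_CS (cip_semi_inner gns) g (cemb gns (st j * v)).
rewrite cip_emb -/(cnorm (cemb gns _)) cnorm_emb e0 mulr0 => le0.
by apply: eq0_normc; apply/eqP; rewrite eq_le le0 normc_ge0.
Qed.

End GNS.

(** * Irreducibility of the GNS representation *)

Section GNSIrreducible.
Variables (R : realType) (B : algType R[i]) (st : B -> B) (N : B -> R).
Hypothesis BN : cstar_norm st N.
Variable J : set B.
Hypothesis JI : nrm_closed_ideal st N J.
Local Notation K := (ideal_cone st J : set (realified B)).
Variable f : realified B -> R.
Hypotheses (fS : scalar f) (fK : positive_on K f) (f1 : f (1 : B) = 1).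
Local Notation H := (completion (gns BN JI fS fK)).
Local Notation pi := (@gns_rep R B st N BN J JI f fS fK).
Local Notation xi := (gns_vec BN JI fS fK).
Let iS := inner_semi_inner H.
Implicit Types (x y z b : B) (u v w : H).

Definition vector_functional v : realified B -> R :=
  fun x => complex.Re (inner (pi x v) v).

Lemma vector_functional_scalar v : scalar (vector_functional v).
Proof.
move=> r x y; rewrite /vector_functional gns_repD realified_scaleE gns_repZ.
rewrite (semi_innerl iS) raddfD /=; congr (_ + _).
by case: (inner _ _) => a b; rewrite /= mul0r subr0.
Qed.

Lemma vector_functional_positive v : positive_on K (vector_functional v).
Proof.
have vS := vector_functional_scalar v.
move=> _ [s [j [z [Jj ->]]]].
have h1 (x y : B) : vector_functional v (x + y : B) =
    vector_functional v x + vector_functional v y.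
  exact: (scalarD _ _ vS).
have h2 (x y : B) : vector_functional v (x - y : B) =
    vector_functional v x - vector_functional v y.
  exact: (scalarB _ _ vS).
rewrite h1 h2 h1.
have -> : vector_functional v j = 0.
  by rewrite /vector_functional gns_rep_ideal // (semi_inner0l iS).
have -> : vector_functional v (st z) = vector_functional v z.
  rewrite /vector_functional gns_rep_adj (st_inv BN) (semi_inner_herm iS).
  by case: (inner _ _).
rewrite subrr !addr0; elim: s => [|x s IHs].
  by rewrite big_nil (scalar0 vS).
rewrite big_cons h1 addr_ge0 //.
rewrite /vector_functional gns_repM gns_rep_adj (st_inv BN).
exact: Re_semi_inner_ge0.
Qed.

Lemma inner_gns_vec x : inner (pi x xi) xi = complexify f x.
Proof.
by rewrite gns_rep_vec; rewrite -[LHS]/(cip _ _) cip_emb /= /gns_form (st1 BN) mul1r.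
Qed.

Hypothesis f_pure : forall g : realified B -> R, scalar g -> positive_on K g ->
  positive_on K (fun x => f x - g x) -> forall x, g x = g (1 : B) * f x.

(** Split [xi = v + w] along [W]; by invariance [f] is the sum of the vector functionals of [v] and
    [w]. Purity makes the first one [t f], whence [v = t xi]; orthogonality leaves [t = 0] or
    [t = 1], and [xi] is cyclic. *)
Lemma gns_irreducible (W : set H) : linear_subspace W -> closed W ->
  (forall b v, W v -> W (pi b v)) -> W = [set 0] \/ W = setT.
Proof.
move=> WL Wc Wpi; have [W0 WZD] := WL.
have [v Wv vort] := orthogonal_decomposition xi WL Wc.
set w := xi - v in vort.
have xiE : xi = v + w by rewrite subrKC.
clearbody w.
have wort u : W u -> inner w u = 0.
  by move=> /vort E; rewrite (semi_inner_herm iS) E conjC0.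
have crossvw x : inner (pi x v) w = 0 by apply: vort; exact: Wpi.
have crosswv x : inner (pi x w) v = 0.
  by rewrite gns_rep_adj; apply: wort; exact: Wpi.
have split_xi x : inner (pi x xi) xi = inner (pi x v) v + inner (pi x w) w.
  have -> : pi x xi = pi x v + pi x w.
    rewrite {1}xiE; have := @gns_rep_linear _ _ _ _ BN _ JI _ fS fK x 1 v w.
    by rewrite !scale1r.
  rewrite {1}xiE (semi_innerDl iS) !(semi_innerDr iS) crossvw crosswv.
  by rewrite addr0 add0r.
have fE x : f x = vector_functional v x + vector_functional w x.
  by rewrite /vector_functional -raddfD -split_xi inner_gns_vec.
have pv := f_pure (vector_functional_scalar v) (@vector_functional_positive v).
have {}pv : forall x, vector_functional v x = vector_functional v 1 * f x.
  apply: pv => x Kx; rewrite fE addrC addKr.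
  exact: vector_functional_positive.
set t := vector_functional v 1 in pv.
(* Purity concerns real parts; the imaginary part is read off at [i x]. *)
have pvC x : inner (pi x v) v = (t%:C)%C * inner (pi x xi) xi.
  have := pv ('i *: x); have := pv x; rewrite /vector_functional gns_repZ.
  rewrite (semi_innerZl iS) inner_gns_vec /complexify.
  rewrite -complexiE; case: (inner (pi x v) v) => a b /=.
  rewrite !mul0r !mul1r sub0r => -> bE.
  apply/eqP; rewrite eq_complex /=; apply/andP; split; apply/eqP; first by ring.
  by rewrite mulrN -bE; ring.
(* The difference is orthogonal to all [pi x xi], that is, to the image of [B] in the completion. *)
have vt : v = (t%:C)%C *: xi.
  apply/eqP; rewrite -subr_eq0; apply/eqP; apply: completion_eq => x.
  rewrite -cip_emb -[LHS]/(inner _ _) -(gns_rep_vec BN JI fS fK).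
  rewrite -[x in pi x](st_inv BN) -gns_rep_adj.
  have -> : (0 : H) x = 0 by [].
  have -> : pi (st x) (v - (t%:C)%C *: xi) = pi (st x) v - (t%:C)%C *: pi (st x) xi.
    have := @gns_rep_linear _ _ _ _ BN _ JI _ fS fK (st x) (- (t%:C)%C) xi v.
    by rewrite !scaleNr ![- _ + _]addrC.
  rewrite (semi_innerBl iS) (semi_innerZl iS) -pvC {1}xiE (semi_innerDr iS).
  by rewrite crossvw addr0 subrr.
have xixi : inner xi xi = 1.
  have pi1 : pi 1 xi = xi by exact: gns_rep1.
  rewrite -[X in inner X _]pi1 inner_gns_vec /complexify f1.
  have := pos_functional_st BN JI fS fK ('i *: (1 : B)).
  rewrite (st_scale BN) conjCi (st1 BN) scaleNr (scalarN _ fS) => E.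
  by have -> : f ('i *: (1 : B)) = 0; [lra|rewrite oppr0].
(* The inner product of [v = t xi] with [w = (1 - t) xi]. *)
have tt0 : (t%:C)%C * (1 - (t%:C)%C) = 0 :> R[i].
  have tc : ((t%:C)%C : R[i])^* = (t%:C)%C.
    by apply: conj_Creal; apply/complex_realP; exists t.
  have := vort _ Wv; rewrite (_ : w = xi - v); last by rewrite {1}xiE addrC addKr.
  rewrite vt (semi_innerBr iS) !(semi_innerZl iS).
  by rewrite (semi_innerZr iS) xixi tc => <-; ring.
move/eqP: tt0; rewrite mulf_eq0 subr_eq0 => /orP[/eqP t0|/eqP t1].
  left; apply/seteqP; split=> [u Wu|_ -> //].
  have v0 : v = 0 by rewrite vt t0 scale0r.
  rewrite /=; apply: completion_eq => x; rewrite -cip_emb -[LHS]/(inner _ _).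
  rewrite -(gns_rep_vec BN JI fS fK) -[x in pi x](st_inv BN) -gns_rep_adj.
  rewrite [xi]xiE v0 add0r; apply: vort; exact: Wpi.
right; apply/seteqP; split=> // u _.
have Wxi : W xi by rewrite -[xi]scale1r t1 -vt.
have [x [c ux]] := cfunP u.
have xu : (fun n => cemb _ (x n) : H) @ \oo --> u.
  apply/cvgrPdist_le => e e0; have [eE re0] := complex_gt0 e0.
  have [k ck] := geometric_small c (half01 R) re0.
  near=> n; rewrite completion_normE eE lecR.
  apply: (le_trans (cnorm_near (ux n))); apply: le_trans ck.
  have [c0 _] := ux 0%N; move: c0; rewrite mulr1 => c0.
  rewrite ler_wpM2l // /hpow ler_wiXn2l ?divr_ge0 //.
    by rewrite ler_pdivrMr // mul1r ler1n.
  by near: n; exact: nbhs_infty_ge.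
apply: (closed_cvg _ Wc _ _ xu); apply: nearW => n.
by rewrite -(gns_rep_vec BN JI fS fK); exact: Wpi.
Unshelve. all: by end_near. Qed.

End GNSIrreducible.

Lemma unital_separation (R : realType) (B : algType R[i]) (st : B -> B)
    (N : B -> R) (BN : cstar_norm st N) (J : set B)
    (JI : nrm_closed_ideal st N J) (a : B) : ~ J a ->
  exists (H : hilbertType R) (pi : B -> H -> H),
  [/\ [/\ forall b, linear (pi b), forall b x, rnorm (pi b x) <= N b * rnorm x,
      forall x, pi 1 x = x, forall b c x, pi (b + c) x = pi b x + pi c x &
      forall k b x, pi (k *: b) x = k *: pi b x],
      forall b c x, pi (b * c) x = pi b (pi c x),
      forall b x y, inner (pi b x) y = inner x (pi (st b) y),
      forall W : set H, linear_subspace W -> closed W ->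
        (forall b v, W v -> W (pi b v)) -> W = [set 0] \/ W = setT &
      (forall j x, J j -> pi j x = 0) /\ exists x, pi a x <> 0].
Proof.
move=> nJa.
have [e e0 nK] : exists2 e, 0 < e & ~ ideal_cone st J (sc B e - st a * a).
  apply: contrapT => nK; apply: nJa; apply: (mem_of_ideal_cone BN JI) => e e0.
  by apply: contrapT => eK; apply: nK; exists e.
have [f [fS fK f1 ef f_pure]] := pure_state_exists (cone_ideal_cone BN JI)
  (order_unit_ideal_cone BN JI)
  (nK : ~ (_ : set (realified B)) (e *: (1 : realified B) - (st a * a : B))).
exists (completion (gns BN JI fS fK)), (@gns_rep _ _ _ _ BN _ JI _ fS fK); split.
- split.
  + exact: gns_rep_linear.
  + by move=> b x; exact: gns_rep_norm.
  + by move=> x; exact: gns_rep1.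
  + by move=> b c x; exact: gns_repD.
  + by move=> k b x; exact: gns_repZ.
- by move=> b c x; exact: gns_repM.
- by move=> b x y; exact: gns_rep_adj.
- exact: gns_irreducible.
- split; first by move=> j x; exact: gns_rep_ideal.
  exists (gns_vec BN JI fS fK); rewrite gns_rep_vec => a0.
  have : cnorm (cemb (gns BN JI fS fK) a) = 0.
    by rewrite a0 /cnorm semi_norm0 //; exact: cip_semi_inner.
  (* The squared norm of [pi a xi] is [f (a^* a) >= e > 0]. *)
  rewrite cnorm_emb => /eqP; rewrite sqrtr_eq0 leNgt => /negP; apply.
  exact: lt_le_trans ef.
Qed.

(** * Unitization *)

Definition unitization (R : realType) (A : cstarAlgType R) : Type := (A * R[i]^o)%type.

Section Unitization.
Variables (R : realType) (A : cstarAlgType R).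
Local Notation B := (unitization A).
Implicit Types (a b u : A) (x y z : B).

HB.instance Definition _ := GRing.Lmodule.copy B (A * R[i]^o)%type.

Definition unit_mul x y : B :=
  (cmul x.1 y.1 + x.2 *: y.1 + y.2 *: x.1, x.2 * y.2).
Definition unit_one : B := (0, 1).

Definition unit_act x u : A := cmul x.1 u + x.2 *: u.

Lemma unitizationP x y : x.1 = y.1 -> x.2 = y.2 -> x = y.
Proof. by case: x y => [a k] [b l] /= -> ->. Qed.

Fact unit_mulA : associative unit_mul.
Proof.
move=> x y z; apply: unitizationP; rewrite /unit_mul /=; last by rewrite mulrA.
rewrite !(cmulDr, cmulDl, cmulZl, cmulZr, cmulA) !scalerDr !scalerA.
rewrite -!addrA [z.2 * x.2]mulrC [z.2 * y.2]mulrC; congr (_ + _).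
rewrite [RHS]addrCA; congr (_ + _); rewrite [LHS]addrCA; congr (_ + _).
by rewrite [LHS]addrCA.
Qed.

Fact unit_mul1 : left_id unit_one unit_mul.
Proof.
move=> x; apply: unitizationP; rewrite /unit_mul /= ?mul1r //.
by rewrite cmul0l add0r scale1r scaler0 addr0.
Qed.

Fact unit_1mul : right_id unit_one unit_mul.
Proof.
move=> x; apply: unitizationP; rewrite /unit_mul /= ?mulr1 //.
by rewrite cmul0r add0r scale1r scaler0 add0r.
Qed.

Fact unit_mulDl : left_distributive unit_mul +%R.
Proof.
move=> x y z; apply: unitizationP; rewrite /unit_mul /= ?mulrDl //.
rewrite cmulDl scalerDl scalerDr.
by rewrite [RHS]addrACA; congr (_ + _); rewrite addrACA.
Qed.

Fact unit_mulDr : right_distributive unit_mul +%R.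
Proof.
move=> x y z; apply: unitizationP; rewrite /unit_mul /= ?mulrDr //.
rewrite cmulDr scalerDl scalerDr.
by rewrite [RHS]addrACA; congr (_ + _); rewrite addrACA.
Qed.

Fact unit_one_neq0 : unit_one != 0.
Proof. by apply/eqP => /(congr1 snd) /= /eqP; rewrite oner_eq0. Qed.

HB.instance Definition _ := GRing.Zmodule_isNzRing.Build B
  unit_mulA unit_mul1 unit_1mul unit_mulDl unit_mulDr unit_one_neq0.

Fact unit_scaleAl (k : R[i]) x y : k *: (x * y) = k *: x * y.
Proof.
apply: unitizationP; rewrite /= /unit_mul /= ?mulrA //; last first.
  by rewrite /GRing.scale /= mulrA.
by rewrite !scalerDr cmulZl !scalerA [y.2 * k]mulrC.
Qed.

HB.instance Definition _ := GRing.Lmodule_isLalgebra.Build R[i] B unit_scaleAl.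

Fact unit_scaleAr (k : R[i]) x y : k *: (x * y) = x * (k *: y).
Proof.
apply: unitizationP; rewrite /= /unit_mul /=; last first.
  by rewrite /GRing.scale /= mulrCA.
by rewrite !scalerDr cmulZr !scalerA [k * x.2]mulrC.
Qed.

HB.instance Definition _ := GRing.Lalgebra_isAlgebra.Build R[i] B unit_scaleAr.

Definition unit_star x : B := (cstar x.1, x.2^*).

Lemma unit_act_mul x y u : unit_act (x * y) u = unit_act x (unit_act y u).
Proof.
rewrite /unit_act /= !(cmulDr, cmulDl, cmulZl, cmulZr, cmulA).
rewrite !scalerDr !scalerA -!addrA; congr (_ + _).
by rewrite addrCA.
Qed.

Lemma unit_actD x y u : unit_act (x + y) u = unit_act x u + unit_act y u.
Proof. by rewrite /unit_act /= cmulDl scalerDl addrACA. Qed.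

Lemma unit_actZ (k : R[i]) x u : unit_act (k *: x) u = k *: unit_act x u.
Proof. by rewrite /unit_act /= cmulZl scalerDr scalerA. Qed.

Lemma unit_actZr (k : R[i]) x u : unit_act x (k *: u) = k *: unit_act x u.
Proof. by rewrite /unit_act cmulZr scalerDr !scalerA mulrC. Qed.

Lemma cstar_unit_act x u w :
  cmul (cstar (unit_act x u)) w = cmul (cstar u) (unit_act (unit_star x) w).
Proof.
by rewrite /unit_act cstarD cstarM cstarZ cmulDl cmulDr -cmulA cmulZl cmulZr.
Qed.

Lemma rnormM a b : rnorm (cmul a b) <= rnorm a * rnorm b.
Proof. by rewrite -lecR rmorphM /= -!rnormE ler_normcM. Qed.

Lemma rnorm_cstar_mul a : rnorm (cmul (cstar a) a) = rnorm a ^+ 2.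
Proof. by apply: complexI; rewrite -rnormE normc_star rnormE rmorphXn. Qed.

Lemma rnorm_cstar a : rnorm (cstar a) = rnorm a.
Proof. by rewrite /rnorm norm_cstar. Qed.

Lemma rnormZc (k : R[i]) a : rnorm (k *: a) = normc k * rnorm a.
Proof. by rewrite rnormZ; case: k. Qed.

Definition act_norms x : set R :=
  [set rnorm (unit_act x u) | u in [set u | rnorm u <= 1]].
Definition act_norm x : R := sup (act_norms x).

Lemma act_le x u : rnorm (unit_act x u) <= (rnorm x.1 + normc x.2) * rnorm u.
Proof.
by rewrite (le_trans (rnormD _ _)) // mulrDl rnormZc lerD // rnormM.
Qed.

Lemma has_sup_act_norms x : has_sup (act_norms x).
Proof.
split; first by exists (rnorm (unit_act x 0)), 0; rewrite //= /rnorm normr0.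
exists (rnorm x.1 + normc x.2) => _ [u u1 <-]; rewrite (le_trans (act_le _ _)) //.
by rewrite ler_piMr // addr_ge0 ?rnorm_ge0 ?normc_ge0.
Qed.

Lemma act_norm_ge1 x u : rnorm u <= 1 -> rnorm (unit_act x u) <= act_norm x.
Proof. by move=> u1; apply: ub_le_sup; [have [] := has_sup_act_norms x|exists u]. Qed.

Lemma act_norm_le x (c : R) : (forall u, rnorm u <= 1 -> rnorm (unit_act x u) <= c) ->
  act_norm x <= c.
Proof.
by move=> xc; apply: ge_sup; [have [] := has_sup_act_norms x|move=> _ [u /xc ? <-]].
Qed.

Lemma act_norm_ge0 x : 0 <= act_norm x.
Proof.
apply: (le_trans (rnorm_ge0 (unit_act x 0))); apply: act_norm_ge1.
by rewrite /rnorm normr0.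
Qed.

Lemma act_norm_ge x u : rnorm (unit_act x u) <= act_norm x * rnorm u.
Proof.
have [u0|un0] := eqVneq (rnorm u) 0.
  by rewrite (le_trans (act_le x u)) // u0 !mulr0.
have up : 0 < rnorm u by rewrite lt_def un0 rnorm_ge0.
rewrite -ler_pdivrMr // mulrC.
have nr : normc (((rnorm u)^-1%:C)%C : R[i]) = (rnorm u)^-1.
  by rewrite /= expr0n addr0 sqrtr_sqr gtr0_norm // invr_gt0.
rewrite -{1}nr -rnormZc -unit_actZr; apply: act_norm_ge1.
by rewrite rnormZc nr mulVf.
Qed.

(** For [u] in the unit ball of [A], the element [x u] lies in [A], where the C*-identity gives
    [|x u|^2 = |u^* (x^* x u)| <= |x^* x u|]. *)
Lemma act_norm_star_mul_le x : act_norm x ^+ 2 <= act_norm (unit_star x * x).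
Proof.
set c := act_norm (unit_star x * x); have c0 : 0 <= c by exact: act_norm_ge0.
rewrite -[leRHS](sqr_sqrtr c0) ler_pXn2r ?nnegrE ?act_norm_ge0 ?sqrtr_ge0 //.
apply: act_norm_le => u u1.
rewrite -(@ler_pXn2r _ 2) ?nnegrE ?rnorm_ge0 ?sqrtr_ge0 // sqr_sqrtr //.
rewrite -rnorm_cstar_mul cstar_unit_act -unit_act_mul.
rewrite (le_trans (rnormM _ _)) // rnorm_cstar.
have h := act_norm_ge (unit_star x * x) u; rewrite -/c in h.
have h1 : rnorm (unit_act (unit_star x * x) u) <= c.
  by rewrite (le_trans h) // ler_piMr.
by rewrite -[leRHS]mul1r ler_pM ?rnorm_ge0.
Qed.

Lemma act_normM x y : act_norm (x * y) <= act_norm x * act_norm y.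
Proof.
apply: act_norm_le => u u1; rewrite unit_act_mul (le_trans (act_norm_ge _ _)) //.
by rewrite ler_wpM2l ?act_norm_ge0 // act_norm_ge1.
Qed.

Lemma unit_starK : involutive unit_star.
Proof. by move=> x; apply: unitizationP; rewrite /= ?cstarK ?conjCK. Qed.

Lemma act_norm_star_mul x : act_norm (unit_star x * x) = act_norm x ^+ 2.
Proof.
have le_star y : act_norm y <= act_norm (unit_star y).
  have [y0|yn0] := eqVneq (act_norm y) 0; first by rewrite y0 act_norm_ge0.
  have yp : 0 < act_norm y by rewrite lt_def yn0 act_norm_ge0.
  by rewrite -(ler_pM2r yp) -expr2 (le_trans (act_norm_star_mul_le y)) // act_normM.
have star_eq : act_norm (unit_star x) = act_norm x.
  by apply: le_anti; rewrite le_star -{2}(unit_starK x) le_star.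
apply: le_anti; rewrite act_norm_star_mul_le andbT.
by rewrite (le_trans (act_normM _ _)) // star_eq expr2.
Qed.

(* The operator norm [act_norm] alone is only a seminorm when [A] has a unit. *)
Definition unit_norm x : R := Num.max (act_norm x) (normc x.2).

Lemma unit_norm_ge_act x : act_norm x <= unit_norm x.
Proof. by rewrite le_max lexx. Qed.

Lemma unit_norm_ge0 x : 0 <= unit_norm x.
Proof. exact: le_trans (act_norm_ge0 x) (unit_norm_ge_act x). Qed.

Lemma unit_norm_ge_snd x : normc x.2 <= unit_norm x.
Proof. by rewrite le_max lexx orbT. Qed.

(** Acting on [x.1^*] gives [x.1 x.1^*] up to [x.2 x.1^*]. This makes the norm definite, and
    complete because both components are. *)
Lemma unit_norm_ge_fst x : rnorm x.1 <= 2 * unit_norm x.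
Proof.
have [a0|an0] := eqVneq (rnorm x.1) 0.
  by rewrite a0 mulr_ge0 // unit_norm_ge0.
have ap : 0 < rnorm x.1 by rewrite lt_def an0 rnorm_ge0.
rewrite -(ler_pM2r ap) -expr2 -rnorm_cstar -rnorm_cstar_mul cstarK.
have -> : cmul x.1 (cstar x.1) = unit_act x (cstar x.1) - x.2 *: cstar x.1.
  by rewrite /unit_act addrK.
have := rnormD (unit_act x (cstar x.1)) (- (x.2 *: cstar x.1)).
rewrite rnormN rnormZc.
have := act_norm_ge x (cstar x.1); rewrite rnorm_cstar.
have := ler_wpM2r (ltW ap) (unit_norm_ge_act x).
have := ler_wpM2r (ltW ap) (unit_norm_ge_snd x).
by lra.
Qed.

Lemma unit_norm_le x : unit_norm x <= rnorm x.1 + normc x.2.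
Proof.
rewrite ge_max lerDr rnorm_ge0 andbT; apply: act_norm_le => u u1.
rewrite (le_trans (act_le _ _)) // ler_piMr // addr_ge0 ?rnorm_ge0 ?normc_ge0 //.
Qed.

Lemma unit_normD x y : unit_norm (x + y) <= unit_norm x + unit_norm y.
Proof.
rewrite ge_max; apply/andP; split.
  apply: act_norm_le => u u1; rewrite unit_actD (le_trans (rnormD _ _)) // lerD //;
    by rewrite (le_trans _ (unit_norm_ge_act _)) // act_norm_ge1.
by rewrite (le_trans (ler_normc_add _ _)) // lerD // unit_norm_ge_snd.
Qed.

Lemma unit_normM x y : unit_norm (x * y) <= unit_norm x * unit_norm y.
Proof.
rewrite ge_max; apply/andP; split.
  rewrite (le_trans (act_normM _ _)) // ler_pM ?act_norm_ge0 ?unit_norm_ge_act //.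
by rewrite /= normcM ler_pM ?normc_ge0 ?unit_norm_ge_snd.
Qed.

Lemma unit_normZ (k : R[i]) x : unit_norm (k *: x) = complex.Re `|k| * unit_norm x.
Proof.
have le (l : R[i]) y : unit_norm (l *: y) <= normc l * unit_norm y.
  rewrite ge_max /= normcM ler_wpM2l ?normc_ge0 ?unit_norm_ge_snd // andbT.
  apply: act_norm_le => u u1; rewrite unit_actZ rnormZc ler_wpM2l ?normc_ge0 //.
  by rewrite (le_trans _ (unit_norm_ge_act _)) // act_norm_ge1.
have -> : complex.Re `|k| = normc k by case: k.
have [->|k0] := eqVneq k 0.
  apply: le_anti; rewrite le normc0 mul0r.
  exact: unit_norm_ge0.
apply: le_anti; rewrite le /=.
have nk : 0 < normc k.
  rewrite lt_def normc_ge0 andbT; apply: contraNneq k0 => /eq0_normc ->//.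
rewrite mulrC -ler_pdivlMr // mulrC -normcV.
by have := le k^-1 (k *: x); rewrite scalerA mulVf // scale1r.
Qed.

Lemma unit_norm_complete (u : nat -> B) (c q : R) : 0 <= q < 1 ->
  (forall n, unit_norm (u n.+1 - u n) <= c * q ^+ n) ->
  exists l d, forall n, unit_norm (l - u n) <= d * q ^+ n.
Proof.
move=> q01 uc.
have [n|l2 l2P] := @geometric_cauchy_complex R (fun n => (u n).2) c q q01.
  exact: le_trans (unit_norm_ge_snd (u n.+1 - u n)) (uc n).
have [n|l1 [_ l1P]] := @geometric_cauchy_cvg R A (fun n => (u n).1) (2 * c) q q01.
  rewrite (le_trans (unit_norm_ge_fst (u n.+1 - u n))) // -mulrA.
  by rewrite ler_pM2l.
exists (l1, l2), (2 * c / (1 - q) + 2 * (c / (1 - q))) => n.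
by rewrite (le_trans (unit_norm_le _)) // mulrDl lerD //= ?l1P ?l2P.
Qed.

(** The C*-identity passes to the maximum of two seminorms that satisfy it: the operator norm of the
    action and the modulus of the character [x.2]. *)
Lemma unit_cstar_norm : cstar_norm unit_star unit_norm.
Proof.
split.
- by move=> x y; apply: unitizationP; rewrite /= ?cstarD ?rmorphD.
- by move=> k x; apply: unitizationP; rewrite /= ?cstarZ // rmorphM.
- move=> x y; apply: unitizationP => /=; last by rewrite rmorphM mulrC.
  by rewrite !cstarD cstarM !cstarZ addrAC.
- exact: unit_starK.
- exact: unit_norm_ge0.
- exact: unit_normD.
- exact: unit_normZ.
- move=> x x0; have x20 : x.2 = 0.
    apply: eq0_normc; apply/eqP; rewrite eq_le normc_ge0 andbT -x0.
    exact: unit_norm_ge_snd.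
  apply: unitizationP => //=; apply/normr0_eq0; rewrite rnormE.
  have := unit_norm_ge_fst x; rewrite x0 mulr0 => x1.
  by congr (_%:C)%C; apply: le_anti; rewrite x1 rnorm_ge0.
- exact: unit_normM.
- move=> x; rewrite /unit_norm act_norm_star_mul /= normcM normc_conj -expr2.
  have [le|/ltW le] := leP (act_norm x) (normc x.2).
    rewrite max_r ?max_r // ler_pXn2r ?nnegrE ?act_norm_ge0 ?normc_ge0 //.
  by rewrite max_l ?max_l // ler_pXn2r ?nnegrE ?act_norm_ge0 ?normc_ge0.
- exact: unit_norm_complete.
Qed.

End Unitization.

(** * Separation of closed ideals by primitive ideals *)

Section Separation.
Variables (R : realType) (A : cstarAlgType R).
Local Notation B := (unitization A).
Local Notation N := (@unit_norm R A).
Local Notation st := (@unit_star R A).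
Implicit Types (I : closed_ideal A) (a b : A).

Definition unitize a : B := (a, 0).

Definition unitized_ideal I : set B := [set x | ideal_set I x.1 /\ x.2 = 0].

Lemma closed_ideal_approx I a :
  (forall e : R, 0 < e -> exists2 b, ideal_set I b & rnorm (a - b) <= e) -> ideal_set I a.
Proof.
move=> Ia; apply: (ideal_closed (ideal_setP I)) => U /nbhs_ballP[e /= e0 eU].
have [eE re0] := complex_gt0 e0.
have [|b Ib ab] := Ia (complex.Re e / 2); first by rewrite divr_gt0.
exists b; split=> //; apply: eU; rewrite -ball_normE /= rnormE eE ltcR.
by rewrite (le_lt_trans ab) // ltr_pdivrMr // ltr_pMr // ltr1n.
Qed.

Lemma unitized_ideal_closed I : nrm_closed_ideal st N (unitized_ideal I).
Proof.
have [[I0 IS] Il Ir Is _] := ideal_setP I.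
have ID a b : ideal_set I a -> ideal_set I b -> ideal_set I (a + b).
  by move=> Ia Ib; rewrite -[a]scale1r; exact: IS.
have IZ (k : R[i]) a : ideal_set I a -> ideal_set I (k *: a).
  by move=> Ia; rewrite -[_ *: _]addr0; exact: IS.
split.
- by split.
- by move=> x y [x1 x2] [y1 y2]; split=> /=; [exact: ID|rewrite x2 y2 addr0].
- move=> x y [y1 y2]; split; rewrite /= y2 ?mulr0 // scale0r addr0.
  by apply: ID; [exact: Il|exact: IZ].
- move=> x y [x1 x2]; split; rewrite /= x2 ?mul0r // scale0r addr0.
  by apply: ID; [exact: Ir|exact: IZ].
- by move=> x [x1 x2]; split=> /=; [exact: Is|rewrite x2 conjC0].
- move=> x xI; split.
    apply: closed_ideal_approx => e e0.
    have [y [Iy _] xy] := xI _ (divr_gt0 e0 (ltr0n R 2)).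
    exists y.1 => //; rewrite (le_trans (unit_norm_ge_fst (x - y))) //.
    by move: xy; rewrite ler_pdivlMr // mulrC.
  apply: eq0_normc; apply: le_anti; rewrite normc_ge0 andbT.
  apply/ler_addgt0Pr => e e0; rewrite add0r.
  have [y [_ y2] xy] := xI _ e0.
  have -> : x.2 = (x - y).2 by rewrite /= y2 subr0.
  exact: le_trans (unit_norm_ge_snd _) xy.
Qed.

Lemma unit_norm_unitize a : N (unitize a) <= rnorm a.
Proof.
have := unit_norm_le (unitize a).
by rewrite (_ : normc (unitize a).2 = 0) ?addr0 //; exact: normc0.
Qed.

Lemma rep_kernel_closed_ideal (H : hilbertType R) (pi : A -> H -> H) :
  is_star_rep pi -> (forall a x, rnorm (pi a x) <= rnorm a * rnorm x) ->
  is_closed_ideal (rep_kernel pi).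
Proof.
move=> piP pin; have [_ _ piD piZ piM piadj] := piP.
have pi0 x : pi 0 x = 0 by rewrite -(scale0r (0 : A)) piZ scale0r.
split.
- split=> [x|k a b ka kb x]; first exact: pi0.
  by rewrite piD piZ ka kb scaler0 addr0.
- by move=> a b kb x; rewrite piM kb (star_rep0r piP).
- by move=> a b ka x; rewrite piM ka.
- by move=> a ka x; apply: inner_eq0; rewrite piadj cstarK ka inner0r.
- move=> a aK x; apply/normr0_eq0; rewrite rnormE; congr (_%:C)%C.
  apply: le_anti; rewrite rnorm_ge0 andbT.
  apply/ler_addgt0Pr => e e0; rewrite add0r.
  have x1 : 0 < rnorm x + 1 by rewrite ltr_wpDl ?rnorm_ge0.
  have d0 : 0 < ((e / (rnorm x + 1))%:C)%C :> R[i] by rewrite ltcR divr_gt0.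
  have [b [kb]] := aK _ (nbhsx_ballx a _ d0).
  rewrite -ball_normE /= rnormE ltcR => ab.
  have -> : pi a x = pi (a - b) x.
    by rewrite -scaleN1r piD piZ kb scaler0 addr0.
  rewrite (le_trans (pin _ _)) // (@le_trans _ _ (rnorm (a - b) * (rnorm x + 1))) //.
    by rewrite ler_wpM2l ?rnorm_ge0 // lerDl.
  by rewrite -ler_pdivlMr // ltW.
Qed.

Lemma ideal_separation I a : ~ ideal_set I a ->
  exists p : prim A, I `<=` p /\ ~ ideal_set p a.
Proof.
move=> nIa.
have nJa : ~ unitized_ideal I (unitize a) by move=> [].
have [H [pi [[piL pin pi1 piD piZ] piM piadj piI [pi0 [x0 pia]]]]] :=
  unital_separation (unit_cstar_norm A) (unitized_ideal_closed I) nJa.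
pose rho b := pi (unitize b).
have uM b c : unitize (cmul b c) = unitize b * unitize c.
  by apply: unitizationP; rewrite /= ?mul0r // !scale0r !addr0.
have rhoP : is_star_rep rho.
  split.
  - by move=> b; exact: piL.
  - move=> b; apply: (bounded_linear_continuous (piL _) (unit_norm_ge0 (unitize b))).
    exact: pin.
  - move=> b c x; rewrite /rho -piD; congr pi.
    by apply: unitizationP; rewrite //= addr0.
  - move=> k b x; rewrite /rho -piZ; congr pi.
    by apply: unitizationP; rewrite //= scaler0.
  - by move=> b c x; rewrite /rho uM piM.
  - move=> b x y; rewrite /rho piadj; congr (inner x (pi _ y)).
    by apply: unitizationP; rewrite //= conjC0.
have rhon b x : rnorm (rho b x) <= rnorm b * rnorm x.
  by rewrite (le_trans (pin _ _)) // ler_wpM2r ?rnorm_ge0 // unit_norm_unitize.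
have rhoI : irreducible_rep rho.
  split=> [|V VL Vc Vrho]; first by exists a, x0.
  apply: piI => // b v Vv; have [_ VZD] := VL.
  (* The unit acts as the identity, so a subspace invariant under [A] is invariant under the whole
     unitization. *)
  have -> : b = b.2 *: 1 + unitize b.1.
    by apply: unitizationP; rewrite /= ?scaler0 ?add0r // addr0 [RHS]mulr1.
  by rewrite piD piZ pi1; apply: VZD => //; exact: Vrho.
pose k := ClosedIdeal (rep_kernel_closed_ideal rhoP rhon).
have kP : primitive k by exists H, rho.
exists (Prim kP); split; last by move=> /(_ x0).
by move=> b Ib x; exact: pi0.
Qed.

End Separation.

Section Lattice.
Variables (R : realType) (A : cstarAlgType R).
Implicit Types (I : closed_ideal A) (p : prim A) (U : open_set (prim A)).

Lemma ideal_of_openP U a :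
  ideal_set (ideal_of_open U) a <-> forall p, ~ open_set_set U p -> ideal_set p a.
Proof.
split=> [Ua p nUp|Ua _ [p nUp <-]]; last exact: Ua.
by apply: (Ua p); exists p.
Qed.

(** The complement of [U] is the hull of some [S], and [S] lies in the ideal of [U]; so a [p]
    containing that ideal belongs to the hull. *)
Lemma open_of_ideal U p : open_set_set U p <-> ~ ideal_of_open U `<=` p.
Proof.
split=> [Up Usub|nsub]; last first.
  by apply: contrapT => nUp; apply: nsub => a /ideal_of_openP; exact.
have [S US] : hk_open U := open_setP U.
have : open_set_set U p by [].
rewrite US; apply => a Sa; apply: Usub; apply/ideal_of_openP => q.
by rewrite US => /contrapT; exact.
Qed.

(** For [s] in [I1] and [t] in [I2], all products [s a t] lie in both ideals, hence in [p]. The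
    hypothesis on [J] has the form that [lattice_map_setI] provides. *)
Lemma prim_prime p I1 I2 (J : closed_ideal A) :
  (forall a, ideal_set I1 a -> ideal_set I2 a -> ideal_set J a) ->
  J `<=` p -> I1 `<=` p \/ I2 `<=` p.
Proof.
move=> IJ Jp; apply: contrapT => /not_orP[/existsNP[s /not_implyP[Is ps]]
  /existsNP[t /not_implyP[It pt]]].
have [H [pi [piP piI pE]]] := primP p.
have [a x||] := @irreducible_prime R A H pi piP piI s t.
- have : (p : set A) (cmul (cmul s a) t).
    apply/Jp/IJ.
      by do 2 apply: (ideal_mulr (ideal_setP I1)).
    exact: (ideal_mull (ideal_setP I2)).
  by rewrite pE; exact.
- by rewrite -pE.
- by rewrite -pE.
Qed.

Lemma prim_proper p : ~ [set: A] `<=` p.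
Proof.
have [H [pi [_ [[a [x pax]] _] pE]]] := primP p.
by move=> /(_ a I); rewrite pE => /(_ x).
Qed.

End Lattice.

(** * Lattice maps and continuous maps *)

Section Pullback.
Variables (R : realType) (A : cstarAlgType R) (X : topologicalType).
Hypothesis soberX : sober X.
Implicit Types (U W : open_set X) (F : set (open_set X)) (p : prim A) (x y : X).

Lemma irreducible_closure_singleton x : irreducible_closed (closure [set x]).
Proof.
split; first exact: closed_closure.
  by exists x; exact: subset_closure.
move=> C1 C2 C1c C2c [C1s C1p] [C2s C2p] CE.
have : (C1 `|` C2) x by rewrite -CE; exact: subset_closure.
have sub (C : set X) : closed C -> C x -> closure [set x] `<=` C.
  by move=> Cc Cx; rewrite [X in _ `<=` X](iffLR (closure_id _) Cc);
    apply: closureS => _ ->.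
by move=> [/(sub _ C1c)|/(sub _ C2c)].
Qed.

Lemma closure_singletonP x U :
  open_set_set U x <-> exists2 y, open_set_set U y & closure [set x] y.
Proof.
split=> [Ux|[y Uy /(_ _ (open_nbhs_nbhs (conj (open_setP U) Uy)))[_ [-> //]]]].
by exists x => //; exact: subset_closure.
Qed.

(** Such points have the same closure, whose generic point is unique. *)
Lemma sober_eq x y : (forall U, open_set_set U x <-> open_set_set U y) -> x = y.
Proof.
move=> xy; have [z [_ zu]] := soberX (irreducible_closure_singleton x).
rewrite -(zu x) //; apply: zu; apply/seteqP; split=> w.
  move=> wy V /[dup] Vw; rewrite nbhsE => -[V' [V'o V'w] V'V].
  have [_ [-> V'y]] := wy _ (open_nbhs_nbhs (conj V'o V'w)).
  by exists x; split => //; apply/V'V/(xy (OpenSet V'o)).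
move=> wx V /[dup] Vw; rewrite nbhsE => -[V' [V'o V'w] V'V].
have [_ [-> V'x]] := wx _ (open_nbhs_nbhs (conj V'o V'w)).
by exists y; split => //; apply/V'V/(xy (OpenSet V'o)).
Qed.

Lemma pullbackP (psi : continuousType (prim A) X) U p :
  open_set_set U (psi p) <-> ~ pullback psi U `<=` p.
Proof. exact: (open_of_ideal (open_preimage psi U) p). Qed.

(** Separation gives one inclusion: an element outside the closed sum is missed by some primitive
    ideal above every [pullback psi U], and that point lies in no preimage. *)
Lemma pullback_sups (psi : continuousType (prim A) X) :
  commutes_with_sups (pullback psi).
Proof.
move=> F; apply: closed_ideal_eq; apply/seteqP; split=> [a aF|].
  apply: contrapT => /ideal_separation[p [supp npa]]; apply: npa.
  have /ideal_of_openP := aF; apply => -[U FU Upsi].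
  have /pullbackP := Upsi; apply.
  by have /ideal_supP suppF := supp; apply: suppF; exists U.
apply/ideal_supP => _ [U FU <-] a /ideal_of_openP aU.
apply/ideal_of_openP => p npF; apply: aU => Up; apply: npF.
by exists U.
Qed.

Lemma pullback_finite_infs (psi : continuousType (prim A) X) :
  commutes_with_finite_infs (pullback psi).
Proof.
move=> F finF; apply: closed_ideal_eq; apply/seteqP; split=> a.
  move=> /ideal_of_openP aF _ [U FU <-]; apply/ideal_of_openP => p npU.
  by apply: aF => pF; apply: npU; exact: pF.
move=> aF; apply/ideal_of_openP => p npF.
have [U [FU npU]] : exists U, F U /\ ~ open_set_set U (psi p).
  apply: contrapT => nU; apply: npF => U FU.
  by apply: contrapT => npU; apply: nU; exists U.
have : ideal_set (pullback psi U) a by apply: aF; exists U.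
by move=> /ideal_of_openP; apply.
Qed.

Lemma pullback_inj : injective (@pullback R A X).
Proof.
move=> psi1 psi2 E; apply/continuousEP => p; apply: sober_eq => U.
by split=> /pullbackP nsub; apply/pullbackP; [rewrite -E|rewrite E].
Qed.

Section Preimage.
Variable f : open_set X -> closed_ideal A.
Hypotheses (fsup : commutes_with_sups f) (finf : commutes_with_finite_infs f).

(** Adding [W] to the family does not change the infimum of [U1] and [U2], so preservation of finite
    infima yields binary meets and monotonicity at once. *)
Lemma lattice_map_setI U1 U2 W a :
  U1 `&` U2 `<=` W -> ideal_set (f U1) a -> ideal_set (f U2) a -> ideal_set (f W) a.
Proof.
move=> UW f1 f2.
have fin2 : finite_set [set U1; U2].
  by rewrite finite_setU; split; exact: finite_set1.
have fin3 : finite_set [set U1; U2; W].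
  by rewrite finite_setU; split=> //; exact: finite_set1.
have E : open_inf fin3 = open_inf fin2.
  apply: open_set_eq; apply/seteqP; split=> x xF U.
    by move=> U12; apply: xF; left.
  move=> [U12|->]; first exact: xF.
  by apply: UW; split; apply: xF; [left|right].
have : ideal_set (f (open_inf fin3)) a.
  by rewrite E finf => _ [U [->|->] <-].
by rewrite finf; apply; exists W => //; right.
Qed.

Lemma lattice_map_mono U W : U `<=` W -> f U `<=` f W.
Proof. by move=> UW a fUa; apply: (@lattice_map_setI U U) => // x [/UW]. Qed.

Definition kernel_open p : open_set X := open_sup [set U | f U `<=` p].

(** Preservation of suprema puts [f (kernel_open p)] itself inside [p]. *)
Lemma kernel_openP p U : f U `<=` p <-> U `<=` kernel_open p.
Proof.
split=> [fUp x Ux|Usub]; first by exists U.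
apply: subset_trans (lattice_map_mono Usub) _; rewrite fsup.
by apply/ideal_supP => _ [W fWp <-].
Qed.

Lemma kernel_open_irreducible p : irreducible_closed (~` kernel_open p).
Proof.
split; first by apply: open_closedC; exact: open_setP.
  apply/set0P/negP => /eqP kE; apply: (@prim_proper _ _ p).
  (* The empty infimum: [f] maps [X] to [A], which no primitive ideal contains. *)
  have fin0 : finite_set (set0 : set (open_set X)) by exact: finite_set0.
  have : f (open_inf fin0) `<=` p.
    apply/kernel_openP => x _; apply: contrapT => nx.
    by have : (~` kernel_open p) x by []; rewrite kE.
  by rewrite finf => sub a _; apply: sub => I' [U []].
move=> C1 C2 C1c C2c C1p C2p CE.
have nsub C (Cc : closed C) : C `<` ~` kernel_open p ->
    ~ f (OpenSet (closed_openC Cc)) `<=` p.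
  move=> [_ nC] /kernel_openP Csub; apply: nC => x nx; apply: contrapT => nCx.
  by apply: nx; exact: Csub.
have [| |sub1|sub2] := @prim_prime _ _ p (f (OpenSet (closed_openC C1c)))
  (f (OpenSet (closed_openC C2c))) (f (kernel_open p)).
- move=> a; apply: lattice_map_setI => x /= [n1 n2]; apply: contrapT => nx.
  by have : (~` kernel_open p) x by []; rewrite CE => -[].
- exact/kernel_openP.
- exact: nsub sub1.
- exact: nsub sub2.
Qed.

Lemma lattice_map_pullback : exists psi, pullback psi = f.
Proof.
have /choice[psi psiE] p : exists x, closure [set x] = ~` kernel_open p.
  by have [x [xE _]] := soberX (kernel_open_irreducible p); exists x.
(* [U] contains [psi p] exactly when it meets the closure of [psi p], that is, when it is not below
   [kernel_open p]. *)
have psiP p U : open_set_set U (psi p) <-> ~ f U `<=` p.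
  split=> [/closure_singletonP[y Uy]|nfU].
    by rewrite psiE => nky /kernel_openP/(_ _ Uy).
  apply/closure_singletonP; rewrite psiE; apply: contrapT => nex; apply: nfU.
  apply/kernel_openP => y Uy; apply: contrapT => nky; apply: nex.
  by exists y.
have psic : continuous psi.
  apply/continuousP => U Uo.
  have : hk_open (psi @^-1` U).
    exists (f (OpenSet Uo)); apply/seteqP; split=> p /=.
      by move=> /(psiP p (OpenSet Uo)).
    by move=> /(psiP p (OpenSet Uo)).
  exact.
exists (mkcts psic); apply/funext => U; apply: closed_ideal_eq.
apply/seteqP; split=> a.
  move=> /ideal_of_openP aU; apply: contrapT => /ideal_separation[p [fUp npa]].
  by apply: npa; apply: aU => /= /psiP.
move=> fUa; apply/ideal_of_openP => p /= nUp; apply: contrapT => npa.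
by apply: nUp; apply/psiP => /(_ _ fUa).
Qed.

End Preimage.

End Pullback.

Theorem lemma2p25 (R : realType) (A : cstarAlgType R) (X : topologicalType)
    (soberX : sober X) :
  set_bij [set: continuousType (prim A) X]
    [set f : open_set X -> closed_ideal A |
      commutes_with_sups f /\ commutes_with_finite_infs f]
    pullback.
Proof.
split.
- by move=> psi _; split; [exact: pullback_sups|exact: pullback_finite_infs].
- by move=> psi1 psi2 _ _; exact: pullback_inj.
- move=> f [fsup finf]; have [psi <-] := lattice_map_pullback soberX fsup finf.
  by exists psi.
Qed.
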